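(* The isomorphism $$\bigoplus_\lambda\Psi_\lambda:\ \mathrm H_n(Q)\to\bigoplus_\lambda \mathrm{Mat}_{m_\lambda}\big(\mathrm H_\lambda(Q)\big)$$ factors through the cyclotomic quotients, so that there is an isomorphism of $A$-algebras $$\mathrm H^\Lambda_n(Q)\;\simeq\;\bigoplus_{\lambda}\mathrm{Mat}_{m_\lambda}\big(\mathrm H^\Lambda_\lambda(Q)\big),$$ where both direct sums are over all $d$-compositions $\lambda=(\lambda_1,\dots,\lambda_d)$ of $n$ and $m_\lambda=\frac{n!}{\lambda_1!\cdots\lambda_d!}$.
   Context: Let $A$ be a commutative ring, $d,n\ge1$ integers, $J=\{1,\dots,d\}$, and $\mathcal K$ a finite set with a partition $\mathcal K=\bigsqcup_{j\in J}\mathcal K_j$. Let $Q=(Q_{k,k'})_{k,k'\in\mathcal K}$ be a matrix of polynomials $Q_{k,k'}\in A[u,v]$ such that $Q_{k,k'}(u,v)=Q_{k',k}(v,u)$, $Q_{k,k}=0$, and $Q_{k,k'}=1$ whenever $k\in\mathcal K_j$, $k'\in\mathcal K_{j'}$ with $j\ne j'$. For $j\in J$ let $Q^j=(Q_{k,k'})_{k,k'\in\mathcal K_j}$. $\mathfrak S_n$ acts on $n$-tuples by $\sigma\cdot(x_1,\dots,x_n)=(x_{\sigma^{-1}(1)},\dots,x_{\sigma^{-1}(n)})$ and $s_a=(a,a+1)$. The quiver Hecke algebra $\mathrm H_n(Q)$ is the unital associative $A$-algebra generated by $e(k)$ ($k\in\mathcal K^n$), $y_1,\dots,y_n$, $\psi_1,\dots,\psi_{n-1}$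 with relations: $\sum_{k\in\mathcal K^n}e(k)=1$; $e(k)e(k')=\delta_{k,k'}e(k)$; $y_ae(k)=e(k)y_a$; $\psi_ae(k)=e(s_a\cdot k)\psi_a$; $y_ay_b=y_by_a$; $\psi_ay_b=y_b\psi_a$ if $b\neq a,a+1$; $\psi_a\psi_b=\psi_b\psi_a$ if $|a-b|>1$; $\psi_ay_{a+1}e(k)=(y_a\psi_a+\delta_{k_a,k_{a+1}})e(k)$; $y_{a+1}\psi_ae(k)=(\psi_ay_a+\delta_{k_a,k_{a+1}})e(k)$; $\psi_a^2e(k)=Q_{k_a,k_{a+1}}(y_a,y_{a+1})e(k)$; and $\psi_{a+1}\psi_a\psi_{a+1}e(k)=\psi_a\psi_{a+1}\psi_ae(k)+\frac{Q_{k_a,k_{a+1}}(y_a,y_{a+1})-Q_{k_{a+2},k_{a+1}}(y_{a+2},y_{a+1})}{y_a-y_{a+2}}e(k)$ if $k_a=k_{a+2}$ (polynomial quotient), $\psi_{a+1}\psi_a\psi_{a+1}e(k)=\psi_a\psi_{a+1}\psi_ae(k)$ otherwise. $\mathrm H_m(Q^j)$ is defined likewise from $\mathcal K_j,Q^j$, with $\mathrm H_0(Q^j)=A$. For each $w\in\mathfrak S_n$ fix a reduced expression $w=s_{a_1}\cdots s_{a_r}$ and put $\psi_w=\psi_{a_1}\cdots\psi_{a_r}$. **Cyclotomic quotients.** Let $\Lambda=(\Lambda_k)_{k\in\mathcal K}$ be a tuple of non-negative integers and, for each $k\in\mathcal K$, fix coefficients $c_{k,m}\in A$ ($0\le m\le\Lambda_k$)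 with $c_{k,\Lambda_k}=1$. $\mathrm H_n^\Lambda(Q)$ is the quotient of $\mathrm H_n(Q)$ by the two-sided ideal generated by the $\sum_{m=0}^{\Lambda_{k_1}}c_{k_1,m}y_1^me(k)$, $k\in\mathcal K^n$. For $j\in J$ let $\Lambda^j$ be the restriction of $\Lambda$ to $\mathcal K_j$, and define $\mathrm H^{\Lambda^j}_m(Q^j)$ likewise, using the same coefficients $c_{k,m}$, $k\in\mathcal K_j$ (it is $A$ for $m=0$). A $d$-composition of $n$ is a tuple $\lambda=(\lambda_1,\dots,\lambda_d)$ of non-negative integers with sum $n$. Put $\mathrm H_\lambda(Q)=\bigotimes_{j=1}^d\mathrm H_{\lambda_j}(Q^j)$ and $\mathrm H_\lambda^\Lambda(Q)=\bigotimes_{j=1}^d\mathrm H^{\Lambda^j}_{\lambda_j}(Q^j)$ (tensor products over $A$). **The maps.** For a $d$-composition $\lambda$ of $n$, let $J^\lambda\subseteq J^n$ be the set of $\mathfrak t$ in which each $j$ occurs exactly $\lambda_j$ times (so $|J^\lambda|=m_\lambda$), $\mathfrak t^\lambda=(1,\dots,1,\dots,d,\dots,d)\in J^\lambda$ the weakly increasing one, and for $\mathfrak t\in J^\lambda$ let $\pi_{\mathfrak t}\in\mathfrak S_n$ be the unique element of minimal length with $\pi_{\mathfrak t}\cdot\mathfrak t=\mathfrak t^\lambda$. Let $e(\mathfrak t)=\sum e(k)$ over $k\in\mathcal K^n$ with $k_a\in\mathcal K_{\mathfrak t_a}$ for all $a$, and $e(\lambda)=\sum_{\mathfrak t\in J^\lambda}e(\mathfrak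 t)$ (central idempotents with sum $1$). $\mathrm H_\lambda(Q)$ is identified with $e(\mathfrak t^\lambda)\mathrm H_n(Q)e(\mathfrak t^\lambda)$ via the isomorphism sending the generators $y,\psi$ of the $j$-th tensor factor, with indices shifted by $\lambda_1+\dots+\lambda_{j-1}$, to the corresponding $y_ae(\mathfrak t^\lambda),\psi_ae(\mathfrak t^\lambda)$, and $e(k^1)\otimes\cdots\otimes e(k^d)$ to $e(k)$ with $k$ the concatenation of $k^1,\dots,k^d$. Index rows and columns of $\mathrm{Mat}_{m_\lambda}$ by $J^\lambda$, with elementary matrices $E_{\mathfrak t',\mathfrak t}$. Then $\Psi_\lambda:e(\lambda)\mathrm H_n(Q)\to\mathrm{Mat}_{m_\lambda}(\mathrm H_\lambda(Q))$ is the $A$-algebra isomorphism given by $\Psi_\lambda(w)=(\psi_{\pi_{\mathfrak t'}}w\,\psi_{\pi_{\mathfrak t}^{-1}})E_{\mathfrak t',\mathfrak t}$ for $w\in e(\mathfrak t')\mathrm H_n(Q)e(\mathfrak t)$. *)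

(* Defs.v *)
From HB Require Import structures.
From mathcomp Require Import all_boot all_order all_fingroup all_algebra.
From mathcomp Require Import generic_quotient.
From mathcomp Require Import boolp.
From mathcomp Require Import finmap monalg.

Set Implicit Arguments.
Unset Strict Implicit.
Unset Printing Implicit Defensive.

Import GRing.Theory.
Local Open Scope ring_scope.
Local Open Scope quotient_scope.

(* The library's algType requires 1 != 0, whereas the algebras below may be
   trivial (e.g. a cyclotomic quotient with Lambda = 0).  An A-algebra is here a
   ring with a ring morphism from A to its centre, and a acts on x as alg a * x. *)
HB.mixin Record isAlgOver (A : comNzRingType) V of GRing.PzRing V := {
  alg : A -> V;
  alg_zmod_morphism : zmod_morphism alg;
  alg_monoid_morphism : monoid_morphism alg;
  algC : forall (a : A) (x : V), alg a * x = x * alg a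
}.

#[short(type="algOverType")]
HB.structure Definition AlgOver (A : comNzRingType) :=
  {V of GRing.PzRing V & isAlgOver A V}.

HB.instance Definition _ (A : comNzRingType) (V : algOverType A) :=
  GRing.isZmodMorphism.Build A V (@alg A V) alg_zmod_morphism.
HB.instance Definition _ (A : comNzRingType) (V : algOverType A) :=
  GRing.isMonoidMorphism.Build A V (@alg A V) alg_monoid_morphism.

HB.mixin Record isAlgHom (A : comNzRingType) (B C : algOverType A)
    (f : B -> C) := { alg_homE : forall a : A, f (alg a) = alg a }.

HB.structure Definition AlgHom (A : comNzRingType) (B C : algOverType A) :=
  {f of @GRing.RMorphism B C f & isAlgHom A B C f}.

Notation "{ 'alghom' B -> C }" := (@AlgHom.type _ B%type C%type)
  (at level 0, B at level 98, C at level 99,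
   format "{ 'alghom'  B  ->  C }") : type_scope.

Section FreeAlgebra.
Variables (A : comNzRingType) (X : choiceType).

Definition freealg := {malg A[{fmonom X}]}.

HB.instance Definition _ := GRing.PzRing.on freealg.

Definition freealg_const (a : A) : freealg := malgC a.

Lemma freealg_zmod : zmod_morphism freealg_const.
Proof. exact: raddfB. Qed.

Lemma freealg_monoid : monoid_morphism freealg_const.
Proof. by split=> [|x y]; [exact: rmorph1|exact: rmorphM]. Qed.

Lemma freealg_constC (a : A) (x : freealg) :
  freealg_const a * x = x * freealg_const a.
Proof.
rewrite [LHS]fgmulUg [RHS]fgmulgU; apply: eq_bigr => k _.
by rewrite mul1m mulm1 mulrC.
Qed.

HB.instance Definition _ :=
  isAlgOver.Build A freealg freealg_zmod freealg_monoid freealg_constC.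

Definition fgen (x : X) : freealg := mkmalgU (fmu x) 1.

End FreeAlgebra.

Section FreeAlgebraEval.
Variables (A : comNzRingType) (X : choiceType) (C : algOverType A) (h : X -> C).

Definition feval (g : freealg A X) : C :=
  \sum_(m <- msupp (g : {malg A[{fmonom X}]}))
     alg (mcoeff m g) * \prod_(x <- (m : seq X)) h x.

Lemma fevalEw (D : {fset {fmonom X}}) (g : freealg A X) :
  (msupp (g : {malg A[{fmonom X}]}) `<=` D)%fset ->
  feval g = \sum_(m <- D) alg (mcoeff m g) * \prod_(x <- (m : seq X)) h x.
Proof.
move=> le; rewrite /feval (big_fset_incl _ le) //= => m _ /mcoeff_outdom ->.
by rewrite rmorph0 mul0r.
Qed.

Lemma feval_zmod : zmod_morphism feval.
Proof.
move=> x y.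
pose D := (msupp (x : {malg A[{fmonom X}]}) `|` msupp (y : {malg A[{fmonom X}]}))%fset.
have lx : (msupp (x : {malg A[{fmonom X}]}) `<=` D)%fset by exact: fsubsetUl.
have ly : (msupp (y : {malg A[{fmonom X}]}) `<=` D)%fset by exact: fsubsetUr.
have lz : (msupp (x - y : {malg A[{fmonom X}]}) `<=` D)%fset.
  by apply: fsubset_trans (msuppD_le _ _) _; rewrite fsubUset msuppN ly lx.
rewrite (fevalEw lx) (fevalEw ly) (fevalEw lz) -sumrB.
by apply: eq_bigr => m _; rewrite mcoeffB rmorphB mulrBl.
Qed.

HB.instance Definition _ :=
  GRing.isZmodMorphism.Build (freealg A X) C feval feval_zmod.

Lemma feval_mono (a : A) (m : {fmonom X}) :
  feval (mkmalgU m a) = alg a * \prod_(x <- (m : seq X)) h x.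
Proof. by rewrite (fevalEw msuppU_le) big_seq_fset1 mcoeffUU. Qed.

Lemma feval_monoid : monoid_morphism feval.
Proof.
split=> [|x y].
  rewrite (_ : 1 = mkmalgU (mone : {fmonom X}) 1) // feval_mono fm1 big_nil.
  by rewrite rmorph1 mulr1.
rewrite malgME raddf_sum /= [in RHS]/feval mulr_suml.
apply: eq_bigr => m _; rewrite raddf_sum mulr_sumr; apply: eq_bigr => m' _ /=.
rewrite feval_mono rmorphM -!mulrA; congr (_ * _); rewrite mulrA.
rewrite -algC -mulrA; congr (_ * _).
by rewrite (_ : (mmul m m' : seq X) = m ++ m') ?big_cat // [mmul _ _]fmmulE.
Qed.

HB.instance Definition _ :=
  GRing.isMonoidMorphism.Build (freealg A X) C feval feval_monoid.

Lemma feval_alg (a : A) : feval (alg a) = alg a.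
Proof. by rewrite [LHS]feval_mono fm1 big_nil mulr1. Qed.

HB.instance Definition _ := isAlgHom.Build A (freealg A X) C feval feval_alg.

Lemma feval_gen (x : X) : feval (fgen A x) = h x.
Proof. by rewrite feval_mono fmuE big_seq1 rmorph1 mul1r. Qed.

End FreeAlgebraEval.

Section IdealQuotient.
Variables (A : comNzRingType) (B : algOverType A) (S : B -> Prop).

Inductive idealgen : B -> Prop :=
| idealgen_mem s of S s : idealgen s
| idealgen0 : idealgen 0
| idealgenD x y of idealgen x & idealgen y : idealgen (x + y)
| idealgenM u x v of idealgen x : idealgen (u * x * v).

Lemma idealgenN x : idealgen x -> idealgen (- x).
Proof. by move=> /(idealgenM (-1) 1); rewrite mulN1r mulr1. Qed.

Definition idealrel (x y : B) := `[< idealgen (x - y) >].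

Lemma idealrel_refl : reflexive idealrel.
Proof. by move=> x; apply/asboolP; rewrite subrr; exact: idealgen0. Qed.

Lemma idealrel_sym : symmetric idealrel.
Proof.
by move=> x y; apply/asboolP/asboolP => /idealgenN; rewrite opprB.
Qed.

Lemma idealrel_trans : transitive idealrel.
Proof.
move=> y x z /asboolP xy /asboolP yz; apply/asboolP.
by rewrite -(subrK y x) -addrA; exact: idealgenD.
Qed.

Canonical idealrel_equiv :=
  EquivRel idealrel idealrel_refl idealrel_sym idealrel_trans.

Definition algquot := {eq_quot idealrel}.

HB.instance Definition _ := Choice.on algquot.
HB.instance Definition _ := Quotient.on algquot.

Lemma aqE (x y : B) : \pi_(algquot) x = \pi_(algquot) y <-> idealgen (x - y).
Proof.
by split=> [/eqmodP/asboolP|xy] //; apply/eqmodP/asboolP.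
Qed.

Lemma aqP (z : algquot) : exists x, z = \pi_(algquot) x.
Proof. by exists (repr z); rewrite reprK. Qed.

Let lift1 (f : B -> B) (z : algquot) : algquot := \pi_(algquot) (f (repr z)).
Let lift2 (f : B -> B -> B) (z t : algquot) : algquot :=
  \pi_(algquot) (f (repr z) (repr t)).

Let lift1E f : (forall x y, idealgen (x - y) -> idealgen (f x - f y)) ->
  forall x, lift1 f (\pi_(algquot) x) = \pi_(algquot) (f x).
Proof. by move=> fE x; apply/aqE/fE/aqE; rewrite reprK. Qed.

Let lift2E f :
    (forall x x' y y', idealgen (x - x') -> idealgen (y - y') ->
       idealgen (f x y - f x' y')) ->
  forall x y, lift2 f (\pi_(algquot) x) (\pi_(algquot) y) = \pi_(algquot) (f x y).
Proof. by move=> fE x y; apply/aqE/fE; apply/aqE; rewrite reprK. Qed.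

Definition aqadd := lift2 +%R.
Definition aqopp := lift1 -%R.
Definition aqmul := lift2 *%R.

Lemma aqaddE x y : aqadd (\pi_(algquot) x) (\pi_(algquot) y) = \pi_(algquot) (x + y).
Proof. by apply: lift2E => x1 x2 y1 y2 ? ?; rewrite opprD addrACA; exact: idealgenD. Qed.

Lemma aqoppE x : aqopp (\pi_(algquot) x) = \pi_(algquot) (- x).
Proof. by apply: lift1E => x1 x2 ?; rewrite -opprD; exact: idealgenN. Qed.

Lemma aqmulE x y : aqmul (\pi_(algquot) x) (\pi_(algquot) y) = \pi_(algquot) (x * y).
Proof.
apply: lift2E => x1 x2 y1 y2 Ix Iy.
rewrite (_ : _ - _ = 1 * (x1 - x2) * y1 + x2 * (y1 - y2) * 1).
  by apply: idealgenD; apply: idealgenM.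
by rewrite mul1r mulr1 mulrBl mulrBr addrA subrK.
Qed.

Let aqEs := (aqaddE, aqoppE, aqmulE).
Let pi0 : algquot := \pi_(algquot) 0.
Let pi1 : algquot := \pi_(algquot) 1.

Let aqaddA : associative aqadd.
Proof.
by move=> x y z; have [[[? ->] [? ->]] [? ->]] := (aqP x, aqP y, aqP z);
  rewrite !aqEs addrA.
Qed.
Let aqaddC : commutative aqadd.
Proof. by move=> x y; have [[? ->] [? ->]] := (aqP x, aqP y); rewrite !aqEs addrC. Qed.
Let aqadd0 : left_id pi0 aqadd.
Proof. by move=> x; have [? ->] := aqP x; rewrite !aqEs add0r. Qed.
Let aqaddN : left_inverse pi0 aqopp aqadd.
Proof. by move=> x; have [? ->] := aqP x; rewrite !aqEs addNr. Qed.

HB.instance Definition _ :=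
  GRing.isZmodule.Build algquot aqaddA aqaddC aqadd0 aqaddN.

Let aqmulA : associative aqmul.
Proof.
by move=> x y z; have [[[? ->] [? ->]] [? ->]] := (aqP x, aqP y, aqP z);
  rewrite !aqEs mulrA.
Qed.
Let aqmul1l : left_id pi1 aqmul.
Proof. by move=> x; have [? ->] := aqP x; rewrite !aqEs mul1r. Qed.
Let aqmul1r : right_id pi1 aqmul.
Proof. by move=> x; have [? ->] := aqP x; rewrite !aqEs mulr1. Qed.
Let aqmulDl : left_distributive aqmul +%R.
Proof.
by move=> x y z; have [[[? ->] [? ->]] [? ->]] := (aqP x, aqP y, aqP z);
  rewrite [_ + _]aqEs !aqEs mulrDl [RHS]aqEs.
Qed.
Let aqmulDr : right_distributive aqmul +%R.
Proof.
by move=> x y z; have [[[? ->] [? ->]] [? ->]] := (aqP x, aqP y, aqP z);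
  rewrite [_ + _]aqEs !aqEs mulrDr [RHS]aqEs.
Qed.

HB.instance Definition _ :=
  GRing.Zmodule_isPzRing.Build algquot aqmulA aqmul1l aqmul1r aqmulDl aqmulDr.

End IdealQuotient.

Section IdealQuotientProj.
Variables (A : comNzRingType) (B : algOverType A) (S : B -> Prop).
Local Notation algquot := (algquot S).
Local Notation idealgen := (idealgen S).

Definition aqproj (x : B) : algquot := \pi_(algquot) x.

Lemma aqproj_surj (z : algquot) : exists x, z = aqproj x.
Proof. exact: aqP. Qed.

Lemma aqproj_zmod : zmod_morphism aqproj.
Proof.
move=> x y; rewrite /aqproj.
transitivity (@aqadd _ _ S (\pi_(algquot) x) (aqopp (\pi_(algquot) y))) => //.
by rewrite aqoppE aqaddE.
Qed.
HB.instance Definition _ :=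
  GRing.isZmodMorphism.Build B algquot aqproj aqproj_zmod.

Lemma aqproj_monoid : monoid_morphism aqproj.
Proof.
split=> // x y; rewrite /aqproj.
transitivity (@aqmul _ _ S (\pi_(algquot) x) (\pi_(algquot) y)) => //.
by rewrite aqmulE.
Qed.
HB.instance Definition _ :=
  GRing.isMonoidMorphism.Build B algquot aqproj aqproj_monoid.

Definition aqalg (a : A) : algquot := aqproj (alg a).

Lemma aqalg_zmod : zmod_morphism aqalg.
Proof. by move=> a b; rewrite /aqalg (rmorphB (@alg A B)) (rmorphB). Qed.
Lemma aqalg_monoid : monoid_morphism aqalg.
Proof.
split=> [|a b]; rewrite /aqalg.
  by rewrite (rmorph1 (@alg A B)) rmorph1.
by rewrite (rmorphM (@alg A B)) rmorphM.
Qed.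
Lemma aqalgC (a : A) (z : algquot) : aqalg a * z = z * aqalg a.
Proof. by have [x ->] := aqproj_surj z; rewrite -!rmorphM algC. Qed.

HB.instance Definition _ :=
  isAlgOver.Build A algquot aqalg_zmod aqalg_monoid aqalgC.
HB.instance Definition _ :=
  isAlgHom.Build A B algquot aqproj (fun=> erefl).

Lemma aqproj_eq0 x : aqproj x = 0 <-> idealgen x.
Proof. by rewrite -[X in idealgen X]subr0; exact: aqE. Qed.

End IdealQuotientProj.

Section IdealQuotientLift.
Variables (A : comNzRingType) (B C : algOverType A) (S : B -> Prop).
Variables (f : {alghom B -> C}) (fS : forall s, S s -> f s = 0).

Lemma idealgen_ker x : idealgen S x -> f x = 0.
Proof.
elim=> {x} [s /fS //||x y _ fx _ fy|u x v _ fx]; rewrite ?rmorph0 //.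
  by rewrite rmorphD /= fx fy addr0.
by rewrite !rmorphM /= fx mulr0 mul0r.
Qed.

(* The proof fS is an argument so that instances can be attached. *)
Definition aqlift of (forall s, S s -> f s = 0) :=
  fun z : algquot S => f (repr z).
Let F := aqlift fS.

Lemma aqliftE x : F (aqproj S x) = f x.
Proof.
apply/eqP; rewrite -subr_eq0 -rmorphB; apply/eqP/idealgen_ker/aqE.
by rewrite reprK.
Qed.

Lemma aqlift_zmod : zmod_morphism F.
Proof.
move=> z t; have [[x ->] [y ->]] := (aqproj_surj z, aqproj_surj t).
by rewrite -rmorphB !aqliftE rmorphB.
Qed.
HB.instance Definition _ := GRing.isZmodMorphism.Build (algquot S) C
  (aqlift fS) aqlift_zmod.

Lemma aqlift_monoid : monoid_morphism F.
Proof.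
split=> [|z t]; first by rewrite -(rmorph1 (aqproj S)) aqliftE rmorph1.
have [[x ->] [y ->]] := (aqproj_surj z, aqproj_surj t).
by rewrite -rmorphM !aqliftE rmorphM.
Qed.
HB.instance Definition _ := GRing.isMonoidMorphism.Build (algquot S) C
  (aqlift fS) aqlift_monoid.

Lemma aqlift_alg (a : A) : F (alg a) = alg a.
Proof. by rewrite aqliftE alg_homE. Qed.
HB.instance Definition _ := isAlgHom.Build A (algquot S) C
  (aqlift fS) aqlift_alg.

End IdealQuotientLift.

(* The A-algebra generated by X subject to the relations u = v for R u v *)
Definition algpres (A : comNzRingType) (X : choiceType)
    (R : freealg A X -> freealg A X -> Prop) : algOverType A :=
  algquot (fun w : freealg A X => exists u v, R u v /\ w = u - v).

Definition pgen (A : comNzRingType) (X : choiceType)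
    (R : freealg A X -> freealg A X -> Prop) (x : X) : algpres R :=
  aqproj _ (fgen A x).

Section PresentationLift.
Variables (A : comNzRingType) (X : choiceType).
Variables (R : freealg A X -> freealg A X -> Prop) (C : algOverType A).
Variables (h : X -> C) (hR : forall u v, R u v -> feval h u = feval h v).

Lemma pgenP u v : R u v ->
  aqproj (fun w : freealg A X => exists u v, R u v /\ w = u - v) u =
  aqproj _ v.
Proof.
move=> Ruv; apply/eqP; rewrite -subr_eq0 -rmorphB; apply/eqP/aqproj_eq0.
by apply: idealgen_mem; exists u, v.
Qed.

Lemma plift_proof w : (exists u v, R u v /\ w = u - v) -> feval h w = 0.
Proof. by move=> [u [v [/hR uv ->]]]; rewrite rmorphB /= uv subrr. Qed.

Definition plift : {alghom algpres R -> C} := aqlift plift_proof.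

Lemma plift_gen x : plift (pgen R x) = h x.
Proof. by rewrite [LHS]aqliftE /= feval_gen. Qed.

End PresentationLift.

Section DirectProduct.
Variables (A : comNzRingType) (I : Type) (B : I -> algOverType A).

Definition dprodalg := forall i, B i.

HB.instance Definition _ := gen_eqMixin dprodalg.
HB.instance Definition _ := gen_choiceMixin dprodalg.

Let ext (x y : dprodalg) : (forall i, x i = y i) -> x = y.
Proof. exact: functional_extensionality_dep. Qed.

Definition dpadd (x y : dprodalg) : dprodalg := fun i => x i + y i.
Definition dpopp (x : dprodalg) : dprodalg := fun i => - x i.
Definition dpmul (x y : dprodalg) : dprodalg := fun i => x i * y i.
Definition dpzero : dprodalg := fun=> 0.
Definition dpone : dprodalg := fun=> 1.
Definition dpalg (a : A) : dprodalg := fun=> alg a.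

Lemma dpaddA : associative dpadd.
Proof. by move=> x y z; apply: ext => i; exact: addrA. Qed.
Lemma dpaddC : commutative dpadd.
Proof. by move=> x y; apply: ext => i; exact: addrC. Qed.
Lemma dpadd0 : left_id dpzero dpadd.
Proof. by move=> x; apply: ext => i; exact: add0r. Qed.
Lemma dpaddN : left_inverse dpzero dpopp dpadd.
Proof. by move=> x; apply: ext => i; exact: addNr. Qed.
HB.instance Definition _ :=
  GRing.isZmodule.Build dprodalg dpaddA dpaddC dpadd0 dpaddN.

Lemma dpmulA : associative dpmul.
Proof. by move=> x y z; apply: ext => i; exact: mulrA. Qed.
Lemma dpmul1l : left_id dpone dpmul.
Proof. by move=> x; apply: ext => i; exact: mul1r. Qed.
Lemma dpmul1r : right_id dpone dpmul.
Proof. by move=> x; apply: ext => i; exact: mulr1. Qed.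
Lemma dpmulDl : left_distributive dpmul +%R.
Proof. by move=> x y z; apply: ext => i; exact: mulrDl. Qed.
Lemma dpmulDr : right_distributive dpmul +%R.
Proof. by move=> x y z; apply: ext => i; exact: mulrDr. Qed.
HB.instance Definition _ :=
  GRing.Zmodule_isPzRing.Build dprodalg dpmulA dpmul1l dpmul1r dpmulDl dpmulDr.

Lemma dpalg_zmod : zmod_morphism dpalg.
Proof. by move=> a b; apply: ext => i; exact: rmorphB. Qed.
Lemma dpalg_monoid : monoid_morphism dpalg.
Proof. by split=> [|a b]; apply: ext => i; [exact: rmorph1|exact: rmorphM]. Qed.
Lemma dpalgC (a : A) (x : dprodalg) : dpalg a * x = x * dpalg a.
Proof. by apply: ext => i; exact: algC. Qed.
HB.instance Definition _ :=
  isAlgOver.Build A dprodalg dpalg_zmod dpalg_monoid dpalgC.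

End DirectProduct.

Section MatrixAlgebra.
Variables (A : comNzRingType) (B : algOverType A) (n : nat).

Definition mxalg_const (a : A) : 'M[B]_n := (alg a)%:M.

Lemma mxalg_zmod : zmod_morphism mxalg_const.
Proof. by move=> a b; rewrite /mxalg_const !raddfB. Qed.
Lemma mxalg_monoid : monoid_morphism mxalg_const.
Proof.
by split=> [|a b]; rewrite /mxalg_const ?(rmorph1 (@alg A B)) //
  (rmorphM (@alg A B)) scalar_mxM.
Qed.
Lemma mxalgC (a : A) (M : 'M[B]_n) : mxalg_const a * M = M * mxalg_const a.
Proof.
apply/matrixP => i j; rewrite [LHS]mxE [RHS]mxE.
rewrite (bigD1 i) //= big1 ?addr0 => [|k ki]; last first.
  by rewrite mxE eq_sym (negPf ki) mul0r.
rewrite (bigD1 j) //= big1 ?addr0 => [|k kj]; last first.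
  by rewrite mxE (negPf kj) mulr0.
by rewrite !mxE !eqxx algC.
Qed.
HB.instance Definition _ :=
  isAlgOver.Build A 'M[B]_n mxalg_zmod mxalg_monoid mxalgC.

End MatrixAlgebra.

(* Square matrices with rows and columns indexed by a finite type *)
Notation "''Mat' [ B ]_ T" := 'M[B]_#|T|
  (at level 8, T at level 2, format "''Mat' [ B ]_ T").

Definition entry (B : Type) (T : finType) (M : 'Mat[B]_T) (t' t : T) : B :=
  M (enum_rank t') (enum_rank t).

Section TensorProduct.
Variables (A : comNzRingType) (I : eqType) (B : I -> algOverType A).
Local Notation X b := (fgen A (b : dprodalg B)).

(* Generators are the families of factors; the multiplicative relations reduce
   every element to a linear combination of generators, so that the underlying
   A-module is the free module on families modulo multilinearity. *)
Inductive tens_rel :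
    freealg A (dprodalg B) -> freealg A (dprodalg B) -> Prop :=
| tens_one : tens_rel (X 1) 1
| tens_mul b c : tens_rel (X (b * c)) (X b * X c)
| tens_add b i (x y : B i) :
    tens_rel (X (dfwith b (x + y))) (X (dfwith b x) + X (dfwith b y))
| tens_scale b i (a : A) (x : B i) :
    tens_rel (X (dfwith b (alg a * x))) (alg a * X (dfwith b x)).

Definition tens : algOverType A := algpres tens_rel.

Definition pure (b : dprodalg B) : tens := pgen tens_rel b.

Definition tensin (i : I) (x : B i) : tens := pure (dfwith (1 : dprodalg B) x).

Lemma pure1 : pure 1 = 1.
Proof. by rewrite /pure /pgen (pgenP tens_one) rmorph1. Qed.

Lemma pureM b c : pure (b * c) = pure b * pure c.
Proof. by rewrite /pure /pgen (pgenP (tens_mul b c)) rmorphM. Qed.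

Lemma pureD b i (x y : B i) :
  pure (dfwith b (x + y)) = pure (dfwith b x) + pure (dfwith b y).
Proof. by rewrite /pure /pgen (pgenP (tens_add b x y)) rmorphD. Qed.

Lemma pureZ b i (a : A) (x : B i) :
  pure (dfwith b (alg a * x)) = alg a * pure (dfwith b x).
Proof. by rewrite /pure /pgen (pgenP (tens_scale b a x)) rmorphM. Qed.

End TensorProduct.

Section TensorMap.
Variables (A : comNzRingType) (I : eqType) (B C : I -> algOverType A).
Variable (f : forall i, {alghom B i -> C i}).

Definition tens_map_gen (b : dprodalg B) : tens C := pure (fun i => f i (b i)).

Lemma tens_map_with (b : dprodalg B) i (x : B i) :
  (fun j => f j (dfwith b x j)) = dfwith (fun j => f j (b j)) (f i x).
Proof.
apply: functional_extensionality_dep => j.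
by case: dfwithP => [|k ik]; rewrite ?dfwith_in ?dfwith_out.
Qed.

Lemma tens_map_rel u v :
  tens_rel u v -> feval tens_map_gen u = feval tens_map_gen v.
Proof.
case=> {u v} [|b c|b i x y|b i a x].
- rewrite feval_gen rmorph1 -pure1; congr pure.
  by apply: functional_extensionality_dep => i; exact: rmorph1.
- rewrite rmorphM /= !feval_gen -pureM; congr pure.
  by apply: functional_extensionality_dep => i; exact: rmorphM.
- rewrite rmorphD /= !feval_gen /tens_map_gen !tens_map_with rmorphD /=.
  exact: pureD.
- rewrite rmorphM /= !feval_gen feval_alg /tens_map_gen !tens_map_with.
  rewrite rmorphM /= alg_homE; exact: pureZ.
Qed.

Definition tens_map : {alghom tens B -> tens C} := plift tens_map_rel.

Lemma tens_map_pure (b : dprodalg B) :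
  tens_map (pure b) = pure (fun i => f i (b i)).
Proof. exact: plift_gen. Qed.

End TensorMap.

(* Elements of A[u,v] are represented in {poly {poly A}}, with u the inner and
   v the outer variable. *)
Section Evaluation.
Variables (A : comNzRingType) (B : algOverType A).
Implicit Types (p : {poly {poly A}}) (x y z : B).

Definition ev2 p x y : B :=
  \sum_(i < size p) \sum_(j < size p`_i) alg p`_i`_j * (x ^+ j * y ^+ i).

(* (p(x, y) - p(z, y)) / (x - z), using
   (x^j - z^j) / (x - z) = \sum_(m < j) x^(j-1-m) z^m *)
Definition divdiff p x y z : B :=
  \sum_(i < size p) \sum_(j < size p`_i)
    alg p`_i`_j * ((\sum_(m < j) x ^+ (j.-1 - m) * z ^+ m) * y ^+ i).

Lemma divdiffE p x y z : x * z = z * x ->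
  (x - z) * divdiff p x y z = ev2 p x y - ev2 p z y.
Proof.
move=> xz; rewrite -sumrB mulr_sumr; apply: eq_bigr => i _.
rewrite -sumrB mulr_sumr; apply: eq_bigr => j _.
rewrite mulrA -algC -mulrA -mulrBr; congr (_ * _).
rewrite mulrA -mulrBl; congr (_ * _).
by rewrite subrXX_comm //; congr (_ * _); apply: eq_bigr => m _; rewrite subnS predn_sub.
Qed.

End Evaluation.

(* Indices are 0-based: y_0, ..., y_(n-1) and psi_0, ..., psi_(n-2). *)
Section Indices.
Variable n : nat.

Lemma hi_subproof (a : 'I_n.-1) : (a.+1 < n)%N.
Proof. by rewrite -ltn_predRL. Qed.

Definition lo (a : 'I_n.-1) : 'I_n := widen_ord (leq_pred n) a.
Definition hi (a : 'I_n.-1) : 'I_n := Ordinal (hi_subproof a).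
Definition sperm (a : 'I_n.-1) : 'S_n := tperm (lo a) (hi a).

Definition act (T : Type) (s : 'S_n) (x : n.-tuple T) : n.-tuple T :=
  [tuple tnth x ((s^-1)%g i) | i < n].

(* The composition of functions s_(a_1) \o ... \o s_(a_r); products of library
   permutations compose in the opposite order. *)
Definition word_perm (l : seq 'I_n.-1) : 'S_n :=
  foldr (fun a w => (w * sperm a)%g) 1%g l.

Definition reduced_expr (w : 'S_n) (l : seq 'I_n.-1) : Prop :=
  word_perm l = w /\ forall l', word_perm l' = w -> (size l <= size l')%N.

End Indices.

Section QuiverHecke.
Variables (A : comNzRingType) (K : finType) (Q : K -> K -> {poly {poly A}}).
Variable n : nat.

Definition qH_gen : choiceType := (n.-tuple K + ('I_n + 'I_n.-1))%type.

Local Notation F := (freealg A qH_gen).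
Local Notation e k := (fgen A (inl k : qH_gen) : F).
Local Notation y a := (fgen A (inr (inl a) : qH_gen) : F).
Local Notation psi a := (fgen A (inr (inr a) : qH_gen) : F).

Inductive qH_rel : F -> F -> Prop :=
| qH_sum1 : qH_rel (\sum_(k : n.-tuple K) e k) 1
| qH_idem (k k' : n.-tuple K) :
    qH_rel (e k * e k') (if k == k' then e k else 0)
| qH_ye (a : 'I_n) (k : n.-tuple K) : qH_rel (y a * e k) (e k * y a)
| qH_psie (a : 'I_n.-1) (k : n.-tuple K) :
    qH_rel (psi a * e k) (e (act (sperm a) k) * psi a)
| qH_yy (a b : 'I_n) : qH_rel (y a * y b) (y b * y a)
| qH_psiy (a : 'I_n.-1) (b : 'I_n) of b != lo a & b != hi a :
    qH_rel (psi a * y b) (y b * psi a)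
| qH_psipsi (a b : 'I_n.-1) of (a.+1 < b)%N || (b.+1 < a)%N :
    qH_rel (psi a * psi b) (psi b * psi a)
| qH_psiyS (a : 'I_n.-1) (k : n.-tuple K) :
    qH_rel (psi a * y (hi a) * e k)
           ((y (lo a) * psi a + (tnth k (lo a) == tnth k (hi a))%:R) * e k)
| qH_ySpsi (a : 'I_n.-1) (k : n.-tuple K) :
    qH_rel (y (hi a) * psi a * e k)
           ((psi a * y (lo a) + (tnth k (lo a) == tnth k (hi a))%:R) * e k)
| qH_psi2 (a : 'I_n.-1) (k : n.-tuple K) :
    qH_rel (psi a ^+ 2 * e k)
           (ev2 (Q (tnth k (lo a)) (tnth k (hi a))) (y (lo a)) (y (hi a)) * e k)
| qH_braid_eq (a b : 'I_n.-1) (k : n.-tuple K)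
    of b = a.+1 :> nat & tnth k (lo a) = tnth k (hi b) :
    qH_rel (psi b * psi a * psi b * e k)
           (psi a * psi b * psi a * e k +
            divdiff (Q (tnth k (lo a)) (tnth k (hi a))) (y (lo a)) (y (hi a)) (y (hi b))
            * e k)
| qH_braid_neq (a b : 'I_n.-1) (k : n.-tuple K)
    of b = a.+1 :> nat & tnth k (lo a) <> tnth k (hi b) :
    qH_rel (psi b * psi a * psi b * e k) (psi a * psi b * psi a * e k).

(* For n = 0 the only generator is e [tuple], equal to 1, and qH is A. *)
Definition qH : algOverType A := algpres qH_rel.

Definition qH_e (k : n.-tuple K) : qH := pgen qH_rel (inl k).
Definition qH_y (a : 'I_n) : qH := pgen qH_rel (inr (inl a)).
Definition qH_psi (a : 'I_n.-1) : qH := pgen qH_rel (inr (inr a)).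
Definition qH_psiw (l : seq 'I_n.-1) : qH := \prod_(a <- l) qH_psi a.

Variables (Lam : K -> nat) (c : K -> nat -> A).

(* Empty when n = 0, since then there is no index a. *)
Inductive cyc_elt : qH -> Prop :=
| CycElt (a : 'I_n) (k : n.-tuple K) of a = 0 :> nat :
    cyc_elt (\sum_(m < (Lam (tnth k a)).+1)
               alg (c (tnth k a) m) * (qH_y a ^+ m * qH_e k)).

Definition qHcyc : algOverType A := algquot cyc_elt.

Definition qHcyc_proj : {alghom qH -> qHcyc} := aqproj cyc_elt.

End QuiverHecke.

Section Compositions.
Variables d n : nat.

(* The parts of a d-composition of n, being at most n, are encoded in 'I_n.+1. *)
Definition dcomp : finType :=
  {l : {ffun 'I_d -> 'I_n.+1} | (\sum_j l j)%N == n}.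

Definition part_of (l : dcomp) (j : 'I_d) : nat := val l j.

Definition multinom (l : dcomp) : nat :=
  (n`! %/ \prod_(j < d) (part_of l j)`!)%N.

Lemma dcomp_sum (l : dcomp) : (\sum_(j < d) part_of l j)%N = n.
Proof. exact: (eqP (valP l)). Qed.

Definition Jset (l : dcomp) : finType :=
  {t : n.-tuple 'I_d | [forall j, count_mem j t == part_of l j]}.

(* t_lambda = (1, ..., 1, ..., d, ..., d) *)
Definition tlam_seq (l : dcomp) : seq 'I_d :=
  flatten [seq nseq (part_of l j) j | j <- enum 'I_d].

Lemma tlam_size (l : dcomp) : size (tlam_seq l) == n.
Proof.
rewrite size_flatten /shape -map_comp sumnE big_map big_enum /=.
by under eq_bigr do rewrite size_nseq; rewrite dcomp_sum.
Qed.

Definition tlam (l : dcomp) : n.-tuple 'I_d := Tuple (tlam_size l).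

Definition offset (l : dcomp) (j : 'I_d) : nat :=
  (\sum_(i < d | (i < j)%N) part_of l i)%N.

Lemma offset_le (l : dcomp) (j : 'I_d) : (offset l j + part_of l j <= n)%N.
Proof.
rewrite -[leqRHS](dcomp_sum l) [leqRHS](bigID (fun i : 'I_d => (i < j)%N)) /=.
by rewrite leq_add2l (bigD1 j) ?ltnn // leq_addr.
Qed.

Lemma shift_subproof l j (b : 'I_(part_of l j)) : (offset l j + b < n)%N.
Proof. by apply: leq_trans (offset_le l j); rewrite ltn_add2l. Qed.

Lemma shiftp_subproof l j (b : 'I_(part_of l j).-1) :
  (offset l j + b < n.-1)%N.
Proof.
rewrite ltn_predRL -addnS; apply: leq_trans (offset_le l j).
by rewrite ltn_add2l -ltn_predRL.
Qed.

Definition shift l j (b : 'I_(part_of l j)) : 'I_n :=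
  Ordinal (shift_subproof b).
Definition shiftp l j (b : 'I_(part_of l j).-1) : 'I_n.-1 :=
  Ordinal (shiftp_subproof b).

Variable red : 'S_n -> seq 'I_n.-1.

(* The w of minimal length with w . t = t_lambda; red w being a reduced
   expression of w, its size is the length of w. *)
Definition pi_t (l : dcomp) (t : Jset l) : 'S_n :=
  [arg min_(w < 1%g | act w (val t) == tlam l) size (red w)]%N.

End Compositions.

Section Blocks.
Variables (A : comNzRingType) (d n : nat) (K : finType) (part : K -> 'I_d).
Variable Q : K -> K -> {poly {poly A}}.

Definition Kj (j : 'I_d) : finType := {k : K | part k == j}.
Definition Qj (j : 'I_d) (k k' : Kj j) : {poly {poly A}} := Q (val k) (val k').

Definition e_t (t : n.-tuple 'I_d) : qH Q n :=
  \sum_(k : n.-tuple K | [forall a, part (tnth k a) == tnth t a]) qH_e Q k.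

Definition Hfactor (l : dcomp d n) (j : 'I_d) : algOverType A :=
  qH (@Qj j) (part_of l j).

Definition Hlam (l : dcomp d n) : algOverType A := tens (Hfactor l).

Lemma concat_subproof (l : dcomp d n) (k : forall j, (part_of l j).-tuple (Kj j)) :
  size (flatten [seq [seq val x | x <- k j] | j <- enum 'I_d]) == n.
Proof.
rewrite size_flatten /shape -map_comp sumnE big_map big_enum /=.
by under eq_bigr do rewrite size_map size_tuple; rewrite dcomp_sum.
Qed.

Definition concat (l : dcomp d n) (k : forall j, (part_of l j).-tuple (Kj j)) :
  n.-tuple K := Tuple (concat_subproof k).

(* f identifies H_lambda(Q) with e(t_lambda) H_n(Q) e(t_lambda), with the
   prescribed values on generators; these determine f. *)
Record corner_iso (l : dcomp d n) (f : Hlam l -> qH Q n) : Prop := CornerIso {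
  corner_add : {morph f : x y / x + y};
  corner_scale : forall (a : A) x, f (alg a * x) = alg a * f x;
  corner_mul : {morph f : x y / x * y};
  corner_one : f 1 = e_t (tlam l);
  corner_inj : injective f;
  corner_im : forall z, (exists x, f x = z) <->
                        (exists w, z = e_t (tlam l) * w * e_t (tlam l));
  corner_y : forall j (b : 'I_(part_of l j)),
    f (tensin (qH_y (@Qj j) b : Hfactor l j)) = qH_y Q (shift b) * e_t (tlam l);
  corner_psi : forall j (b : 'I_(part_of l j).-1),
    f (tensin (qH_psi (@Qj j) b : Hfactor l j)) =
    qH_psi Q (shiftp b) * e_t (tlam l);
  corner_e : forall k : (forall j, (part_of l j).-tuple (Kj j)),
    f (pure (fun j => qH_e (@Qj j) (k j) : Hfactor l j)) = qH_e Q (concat k)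
}.

Variables (Lam : K -> nat) (c : K -> nat -> A).

Definition Hfactor_cyc (l : dcomp d n) (j : 'I_d) : algOverType A :=
  @qHcyc A (Kj j) (@Qj j) (part_of l j)
         (fun k => Lam (val k)) (fun k => c (val k)).

Definition Hlam_cyc (l : dcomp d n) : algOverType A := tens (Hfactor_cyc l).

Definition Hlam_proj (l : dcomp d n) : {alghom Hlam l -> Hlam_cyc l} :=
  tens_map (fun j => qHcyc_proj (@Qj j) (part_of l j) (fun k => Lam (val k))
                                (fun k => c (val k))).

Definition sum_mat (B : dcomp d n -> algOverType A) : algOverType A :=
  dprodalg (fun l => 'Mat[B l]_(Jset l) : algOverType A).

Variable red : 'S_n -> seq 'I_n.-1.

(* The coefficient of E_(t', t) in Psi_lambda is
   psi_(pi_t') e(t') x e(t) psi_(pi_t^-1), viewed in H_lambda(Q) through f. *)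
Definition Psi_entry (l : dcomp d n) (t' t : Jset l) (x : qH Q n) : qH Q n :=
  qH_psiw Q (red (pi_t red t')) * (e_t (val t') * x * e_t (val t)) *
  qH_psiw Q (red (pi_t red t)^-1%g).

End Blocks.

(* Main.v *)
(** No basis theorem for H_n(Q) is used: Psi_lambda is defined on generators and
    the relations are checked in the matrix algebra.  e(k) goes to the tensor of
    the restrictions of k to the blocks of K, placed at E_(t,t) with t the colour
    of k; y_a e(t) goes to the y of the a-th strand among those of its colour;
    psi_a e(t) goes to E_(s_a t, t) if t_a <> t_(a+1), and otherwise to the psi
    of the two neighbouring strands of equal colour.

    Conversely, the generators of H_lambda act in the corner
    e(t_lambda) H_n(Q) e(t_lambda), which gives the map f.  Since Q = 1 between
    different colours, psi_a e(t) is invertible when t_a <> t_(a+1), and three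
    strands whose outer colours differ satisfy the braid relation without error
    term.  Hence sorting t by adjacent descents is confluent: all words from t to
    t_lambda crossing only strands of different colours give the same element
    N_t, through which e, y and psi slide.  In particular reduced words of pi_t
    and of its inverse give N_t and N_t^-1.  On generators
    f (Psi x)_(t',t) = N_t' x N_t^-1 and Psi (f z) = z E_(t_lambda,t_lambda), so
    that f is injective and Psi is bijective.

    For the quotients, Psi maps the cyclotomic element of k to the cyclotomic
    element of the factor of colour t_1, placed at E_(t,t).  Every colour j with
    lambda_j > 0 is the first one of some t, so the two ideals correspond. *)
Require Import Defs.
From HB Require Import structures.
From mathcomp Require Import all_boot all_order all_fingroup all_algebra.
From mathcomp Require Import boolp.
From mathcomp Require Import finmap monalg.
From mathcomp Require Import zify.

Set Implicit Arguments.
Unset Strict Implicit.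
Unset Printing Implicit Defensive.

Import GRing.Theory.
Local Open Scope ring_scope.

(* mathcomp.fingroup.action also has an [act]. *)
Local Notation act := Defs.act.

(** * Presented algebras and tensor products *)

(** The hinge is [entry_embed], the identity f(Psi(x)_(t',t)) = N_t' x N_t^-1. It is compatible with
    sums and products in x, so it is tested on generators only. The matrix representation has to be
    built before anything is known about f: injectivity of f comes from a left inverse read off from
    Psi. Reduced words enter through one property, [short_cpath]: a word that is as short as its
    effect on the colours allows never exchanges equal colours. Between different colours psi_a is
    its own inverse, so N_t follows a word through ascents as well as descents. Each generator acts
    by a matrix with at most one nonzero entry per column ([mono]); a relation then becomes an
    identity of coefficients in H_lambda for each t, and ranks within a colour tell which generator
    of which factor occurs there. Most sections work with arbitrary algebras whose elements satisfy
    [qHrels], because the same relations are used in H_n and the factors and are proved in the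
    matrix algebra and the corner. The ideal form [recon_ideal] gives injectivity both before and
    after the cyclotomic quotient. *)

Section Generation.
Variables (A : comNzRingType) (X : choiceType).

Lemma mkmalgU_prod (a : A) (s : seq X) :
  (mkmalgU (FMonom s : {fmonom X}) a : freealg A X) = alg a * \prod_(x <- s) fgen A x.
Proof.
elim: s a => [|x s IH] a.
  rewrite big_nil mulr1; congr (mkmalgU _ a : {malg A[{fmonom X}]}).
  by apply: val_inj; rewrite /= fm1.
rewrite big_cons mulrA algC -mulrA -IH.
rewrite [RHS]fgmulUU mul1r; congr (mkmalgU _ a : {malg A[{fmonom X}]}).
by apply: val_inj; rewrite /= [mmul _ _]fmmulE fmuE.
Qed.

(** An element is a finite sum of monomials, and [mkmalgU_prod] splits a monomial into a constant
    and letters; the empty sum and the empty product are the constants 0 and 1. *)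
Lemma freealg_ind (P : freealg A X -> Prop) :
  (forall a, P (alg a)) -> (forall x, P (fgen A x)) ->
  (forall u v, P u -> P v -> P (u + v)) ->
  (forall u v, P u -> P v -> P (u * v)) -> forall g, P g.
Proof.
move=> Pa Px PD PM g; rewrite (monalgE g).
apply: (big_ind P) => // [|m _]; first by have := Pa 0; rewrite (rmorph0 (@alg A (freealg A X))).
case: m => s; rewrite mkmalgU_prod; apply: (PM) => //.
have P1 := Pa 1; rewrite (rmorph1 (@alg A (freealg A X))) in P1; exact: (big_ind P).
Qed.

Lemma algpres_ind (R : freealg A X -> freealg A X -> Prop)
    (P : algpres R -> Prop) :
  (forall a, P (alg a)) -> (forall x, P (pgen R x)) ->
  (forall u v, P u -> P v -> P (u + v)) ->
  (forall u v, P u -> P v -> P (u * v)) -> forall z, P z.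
Proof.
move=> Pa Px PD PM z; have [g ->] := aqproj_surj z.
elim/freealg_ind: g => [a|x|u v Pu Pv|u v Pu Pv].
- by rewrite alg_homE.
- exact: Px.
- by rewrite rmorphD; exact: PD.
- by rewrite rmorphM; exact: PM.
Qed.

Lemma alghom_feval (C : algOverType A) (f : {alghom freealg A X -> C}) g :
  f g = feval (fun x => f (fgen A x)) g.
Proof.
elim/freealg_ind: g => [a|x|u v Hu Hv|u v Hu Hv].
- by rewrite alg_homE feval_alg.
- by rewrite feval_gen.
- by rewrite !rmorphD /= Hu Hv.
- by rewrite !rmorphM /= Hu Hv.
Qed.

Definition algpres_proj (R : freealg A X -> freealg A X -> Prop) :
  {alghom freealg A X -> algpres R} := aqproj _.

(** The family [g] is only assumed pointwise equal to [pgen R], because the generators of a quiver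
    Hecke algebra are given by a case analysis on the index type. *)
Lemma algpres_rel (R : freealg A X -> freealg A X -> Prop) u v :
  R u v -> forall g, g =1 pgen R -> feval g u = feval g v.
Proof.
move=> /pgenP E g /funext ->; rewrite -[LHS](alghom_feval (algpres_proj R)).
by rewrite -[RHS](alghom_feval (algpres_proj R)).
Qed.

End Generation.

Section EvaluationMorphism.
Variables (A : comNzRingType) (B C : algOverType A) (f : {alghom B -> C}).

Lemma alghom_ev2 p x y : f (ev2 p x y) = ev2 p (f x) (f y).
Proof.
rewrite rmorph_sum; apply: eq_bigr => i _; rewrite rmorph_sum.
by apply: eq_bigr => j _; rewrite !rmorphM /= alg_homE !rmorphXn.
Qed.

Lemma alghom_divdiff p x y z : f (divdiff p x y z) = divdiff p (f x) (f y) (f z).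
Proof.
rewrite rmorph_sum; apply: eq_bigr => i _; rewrite rmorph_sum.
apply: eq_bigr => j _; rewrite !rmorphM /= alg_homE rmorphXn rmorph_sum.
by congr (_ * (_ * _)); apply: eq_bigr => m _; rewrite rmorphM !rmorphXn.
Qed.

End EvaluationMorphism.

Section EvaluationTrivial.
Variables (A : comNzRingType) (B : algOverType A).
Implicit Types (x y z : B).

Lemma ev2_1 x y : ev2 (1 : {poly {poly A}}) x y = 1.
Proof.
rewrite /ev2 size_poly1 big_ord1 !coefC /= size_poly1 big_ord1 coefC /=.
by rewrite rmorph1 !mul1r.
Qed.

(** Removes the braid error when two strands with equal labels enclose a strand of another colour,
    where Q is 1. *)
Lemma divdiff_1 x y z : divdiff (1 : {poly {poly A}}) x y z = 0.
Proof.
rewrite /divdiff size_poly1 big_ord1 !coefC /= size_poly1 big_ord1.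
by rewrite big_ord0 mul0r mulr0.
Qed.

End EvaluationTrivial.

Section DirectProductEntries.
Variables (A : comNzRingType) (I : Type) (B : I -> algOverType A).
Implicit Types (x y : dprodalg B).

Lemma dprodalgM i x y : (x * y) i = x i * y i. Proof. by []. Qed.
Lemma dprodalg1 i : (1 : dprodalg B) i = 1. Proof. by []. Qed.

(** Named so that it can carry the structure of a morphism: [alghom_ev2] and [alghom_divdiff] then
    evaluate polynomials in a product componentwise. *)
Definition dproj i (x : dprodalg B) : B i := x i.

Lemma dproj_zmod i : zmod_morphism (dproj i). Proof. by []. Qed.
Lemma dproj_monoid i : monoid_morphism (dproj i). Proof. by []. Qed.
HB.instance Definition _ i :=
  GRing.isZmodMorphism.Build (dprodalg B) (B i) (dproj i) (@dproj_zmod i).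
HB.instance Definition _ i :=
  GRing.isMonoidMorphism.Build (dprodalg B) (B i) (dproj i) (@dproj_monoid i).
HB.instance Definition _ i :=
  isAlgHom.Build A (dprodalg B) (B i) (dproj i) (fun=> erefl).

End DirectProductEntries.

Section TensorUniversal.
Variables (A : comNzRingType) (d : nat) (B : 'I_d -> algOverType A).

Lemma dfwith1M i (x y : B i) :
  dfwith (1 : dprodalg B) (x * y) =
  (dfwith (1 : dprodalg B) x : dprodalg B) * (dfwith (1 : dprodalg B) y : dprodalg B).
Proof.
apply: functional_extensionality_dep => j; rewrite dprodalgM.
by case: dfwithP => [|k ik]; rewrite ?dfwith_in ?dfwith_out // ?dprodalg1 mulr1.
Qed.

Lemma tensin_zmod i : zmod_morphism (@tensin A _ B i).
Proof.
move=> x y; apply/eqP; rewrite eq_sym subr_eq -pureD; apply/eqP.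
by rewrite /tensin subrK.
Qed.
HB.instance Definition _ i :=
  GRing.isZmodMorphism.Build (B i) (tens B) (@tensin A _ B i) (@tensin_zmod i).

Lemma dfwith1 i : dfwith (1 : dprodalg B) (1 : B i) = (1 : dprodalg B).
Proof.
by apply: functional_extensionality_dep => j; case: dfwithP.
Qed.

Lemma tensin_monoid i : monoid_morphism (@tensin A _ B i).
Proof.
split=> [|x y]; first by rewrite /tensin dfwith1 pure1.
by rewrite /tensin dfwith1M pureM.
Qed.
HB.instance Definition _ i :=
  GRing.isMonoidMorphism.Build (B i) (tens B) (@tensin A _ B i) (@tensin_monoid i).

Lemma tensin_alg i a : @tensin A _ B i (alg a) = alg a.
Proof. by rewrite -[alg a]mulr1 /tensin pureZ dfwith1 pure1 mulr1. Qed.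
HB.instance Definition _ i :=
  isAlgHom.Build A (B i) (tens B) (@tensin A _ B i) (@tensin_alg i).

Lemma tensinC i j (x : B i) (y : B j) : i != j ->
  tensin x * tensin y = tensin y * tensin x.
Proof.
move=> ij; rewrite /tensin -!pureM; congr pure.
apply: functional_extensionality_dep => k; rewrite !dprodalgM.
case: dfwithP => [|l il]; first by rewrite dfwith_out 1?eq_sym // mulr1 mul1r.
by rewrite mul1r mulr1.
Qed.

Lemma pure_prod (b : dprodalg B) : pure b = \prod_(j < d) tensin (b j).
Proof.
(* The induction runs over duplicate-free lists of slots, with [1] in the slots outside the list. *)
have H (s : seq 'I_d) : uniq s ->
    pure ((fun j => if j \in s then b j else 1) : dprodalg B) =
    \prod_(j <- s) tensin (b j).
  elim: s => [|i s IH] /=; first by rewrite big_nil -pure1.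
  move=> /andP[is_ us]; rewrite big_cons -IH // -pureM; congr pure.
  apply: functional_extensionality_dep => j; rewrite dprodalgM inE.
  case: dfwithP => [|k ik]; first by rewrite eqxx (negPf is_) mulr1.
  by rewrite eq_sym (negPf ik) mul1r.
rewrite -H ?index_enum_uniq //; congr pure.
by apply: functional_extensionality_dep => j; rewrite mem_index_enum.
Qed.

Lemma tens_ind (P : tens B -> Prop) :
  (forall a, P (alg a)) -> (forall i (x : B i), P (tensin x)) ->
  (forall u v, P u -> P v -> P (u + v)) ->
  (forall u v, P u -> P v -> P (u * v)) -> forall z, P z.
Proof.
move=> Pa Pi PD PM z; elim/algpres_ind: z => // b.
rewrite -/(pure b) pure_prod.
have P1 := Pa 1; rewrite (rmorph1 (@alg A (tens B))) in P1; exact: (big_ind P).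
Qed.

Variables (C : algOverType A) (g : forall i, {alghom B i -> C}).
Hypothesis gC : forall i j (x : B i) (y : B j), i != j -> g i x * g j y = g j y * g i x.

Definition tens_lift_gen (b : dprodalg B) : C := \prod_(i < d) g i (b i).

Lemma tens_lift_genM b c :
  tens_lift_gen (b * c) = tens_lift_gen b * tens_lift_gen c.
Proof.
rewrite /tens_lift_gen; elim: (index_enum _) (index_enum_uniq 'I_d) => [|i s IH] /=.
  by rewrite !big_nil mulr1.
move=> /andP[is_ us]; rewrite !big_cons IH // rmorphM -!mulrA; congr (_ * _).
rewrite !mulrA; congr (_ * _).
(* It remains to move [g i (c i)] past the factors of [b] with index in [s], none of which is
   [i]. *)
elim: s is_ {IH us} => [|j s IH]; first by rewrite !big_nil mulr1 mul1r.
rewrite inE negb_or => /andP[ij is_]; rewrite !big_cons mulrA gC // -!mulrA.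
by rewrite IH.
Qed.

Lemma tens_lift_gen_tensin i (x : B i) : tens_lift_gen (dfwith (1 : dprodalg B) x) = g i x.
Proof.
rewrite /tens_lift_gen; have := index_enum_uniq 'I_d.
have := mem_index_enum i; elim: (index_enum _) => //= j s IH.
rewrite inE big_cons => ijs /andP[js us]; case: eqVneq ijs => [ij _|ij] /=.
  subst j; rewrite dfwith_in big_seq big1 ?mulr1 // => k ks; rewrite dfwith_out ?rmorph1 //.
  by apply: contraTneq ks => <-.
by move/IH=> H; rewrite (H us) dfwith_out // rmorph1 mul1r.
Qed.

(** Isolates slot [i], so that the two multilinearity relations of the tensor product follow from
    multiplicativity together with additivity and linearity of [g i]. *)
Lemma dfwith_split i (x : B i) (b : dprodalg B) :
  dfwith b x = (dfwith (1 : dprodalg B) x : dprodalg B) * (dfwith b (1 : B i) : dprodalg B).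
Proof.
apply: functional_extensionality_dep => j; rewrite dprodalgM.
by case: dfwithP => [|k ik]; rewrite ?dfwith_in ?dfwith_out // ?dprodalg1 ?mulr1 ?mul1r.
Qed.

Lemma tens_lift_rel u v :
  tens_rel u v -> feval tens_lift_gen u = feval tens_lift_gen v.
Proof.
case=> {u v} [|b c|b i x y|b i a x].
- rewrite feval_gen rmorph1 /tens_lift_gen big1 // => i _; exact: rmorph1.
- by rewrite rmorphM /= !feval_gen tens_lift_genM.
- rewrite rmorphD /= !feval_gen dfwith_split (dfwith_split x) (dfwith_split y).
  by rewrite !tens_lift_genM !tens_lift_gen_tensin rmorphD mulrDl.
- rewrite rmorphM /= !feval_gen feval_alg dfwith_split (dfwith_split x).
  by rewrite !tens_lift_genM !tens_lift_gen_tensin rmorphM /= alg_homE mulrA.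
Qed.

Definition tens_lift : {alghom tens B -> C} := plift tens_lift_rel.

Lemma tens_lift_pure b : tens_lift (pure b) = \prod_(i < d) g i (b i).
Proof. exact: plift_gen. Qed.

Lemma tens_lift_in i (x : B i) : tens_lift (tensin x) = g i x.
Proof. by rewrite tens_lift_pure -[RHS]tens_lift_gen_tensin. Qed.

End TensorUniversal.

(** * Corner algebras and monomial matrices *)

Section Corner.
Variables (A : comNzRingType) (B : algOverType A) (e : B).

Definition corner_pred := fun x : B => e * x * e == x.

Lemma corner_zmod_closed : zmod_closed corner_pred.
Proof.
split=> [|x y /eqP xe /eqP ye]; first by rewrite unfold_in /corner_pred mulr0 mul0r.
by rewrite unfold_in /corner_pred mulrBr mulrBl xe ye.
Qed.
HB.instance Definition _ := GRing.isZmodClosed.Build B corner_pred corner_zmod_closed.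

(** The proof of idempotence is a parameter of the type, so that the ring structure with unit [e],
    which depends on it, can be attached as an instance. *)
Definition corner of e * e = e := {x : B | corner_pred x}.

Variable ee : e * e = e.
Local Notation C := (corner ee).

HB.instance Definition _ := SubType.on C.
HB.instance Definition _ := Choice.on C.
HB.instance Definition _ := [SubChoice_isSubZmodule of C by <:].

Definition cval (x : C) : B := val x.

Lemma cval_inj : injective cval. Proof. exact: val_inj. Qed.

Lemma cval_zmod : zmod_morphism cval. Proof. by []. Qed.
HB.instance Definition _ := GRing.isZmodMorphism.Build C B cval cval_zmod.

Lemma corner_e2 (x : C) : e * cval x * e = cval x.
Proof. exact/eqP/(valP x). Qed.
Lemma corner_el (x : C) : e * cval x = cval x.
Proof. by rewrite -(corner_e2 x) !mulrA ee. Qed.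
Lemma corner_er (x : C) : cval x * e = cval x.
Proof. by rewrite -(corner_e2 x) -!mulrA ee. Qed.

Lemma corner_mul_subproof (x y : C) : corner_pred (cval x * cval y).
Proof. by rewrite /corner_pred mulrA corner_el -mulrA corner_er. Qed.
Definition corner_mulr (x y : C) : C := Sub (cval x * cval y) (corner_mul_subproof x y).

Lemma corner_one_subproof : corner_pred e.
Proof. by rewrite /corner_pred !ee. Qed.
Definition corner_oner : C := Sub e corner_one_subproof.

Let cmulA : associative corner_mulr.
Proof. by move=> x y z; apply: cval_inj; rewrite /cval /= mulrA. Qed.
Let cmul1l : left_id corner_oner corner_mulr.
Proof. by move=> x; apply: cval_inj; rewrite /cval /= corner_el. Qed.
Let cmul1r : right_id corner_oner corner_mulr.
Proof. by move=> x; apply: cval_inj; rewrite /cval /= corner_er. Qed.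
Let cmulDl : left_distributive corner_mulr +%R.
Proof. by move=> x y z; apply: cval_inj; rewrite /cval /= mulrDl. Qed.
Let cmulDr : right_distributive corner_mulr +%R.
Proof. by move=> x y z; apply: cval_inj; rewrite /cval /= mulrDr. Qed.
HB.instance Definition _ :=
  GRing.Zmodule_isPzRing.Build C cmulA cmul1l cmul1r cmulDl cmulDr.

Lemma corner_valM (x y : C) : cval (x * y) = cval x * cval y. Proof. by []. Qed.
Lemma corner_val1 : cval (1 : C) = e. Proof. by []. Qed.

Lemma corner_alg_subproof a : corner_pred (alg a * e).
Proof. by rewrite /corner_pred mulrA -algC -!mulrA ee ee. Qed.
Definition corner_alg (a : A) : C := Sub (alg a * e) (corner_alg_subproof a).

Lemma corner_alg_zmod : zmod_morphism corner_alg.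
Proof. by move=> a b; apply: cval_inj; rewrite /cval /= rmorphB mulrBl. Qed.
Lemma corner_alg_monoid : monoid_morphism corner_alg.
Proof.
split=> [|a b]; apply: cval_inj; rewrite /cval /= ?rmorph1 ?mul1r //.
by rewrite rmorphM -[RHS]mulrA (mulrA e) -(algC b e) -(mulrA _ e) ee mulrA.
Qed.
Lemma corner_algC a x : corner_alg a * x = x * corner_alg a.
Proof.
apply: cval_inj; rewrite !corner_valM /= -mulrA corner_el mulrA -algC.
by rewrite -[RHS]mulrA corner_er.
Qed.
HB.instance Definition _ :=
  isAlgOver.Build A C corner_alg_zmod corner_alg_monoid corner_algC.

Lemma corner_valZ a (x : C) : cval (alg a * x) = alg a * cval x.
Proof. by rewrite corner_valM /= -mulrA corner_el. Qed.

Definition corner_cut (x : B) : C.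
Proof.
by exists (e * x * e); rewrite /corner_pred -!mulrA ee !mulrA ee.
Defined.

Lemma corner_val_exp (x : C) (X : B) n : X * e = e * X -> cval x = X * e ->
  cval (x ^+ n) = X ^+ n * e.
Proof.
move=> Xe xX; elim: n => [|n IH]; first by rewrite mul1r.
rewrite exprS corner_valM xX IH exprS -!mulrA; congr (_ * _).
by rewrite mulrA (commrX n (esym Xe)) -mulrA ee.
Qed.

Lemma corner_val_mul (x y : C) (X Y : B) : Y * e = e * Y -> cval x = X * e ->
  cval y = Y * e -> cval (x * y) = X * Y * e.
Proof.
by move=> Ye xX yY; rewrite corner_valM xX yY -mulrA (mulrA e) -Ye -mulrA ee mulrA.
Qed.

(** Cutting by [e] is not multiplicative on [B], so [alghom_ev2] does not apply; commutation with
    [e] is what allows all its occurrences to be collected on the right. *)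
Lemma corner_val_ev2 p (x y : C) (X Y : B) : X * e = e * X -> Y * e = e * Y ->
  cval x = X * e -> cval y = Y * e -> cval (ev2 p x y) = ev2 p X Y * e.
Proof.
move=> Xe Ye xX yY; rewrite raddf_sum mulr_suml; apply: eq_bigr => i _.
rewrite raddf_sum mulr_suml; apply: eq_bigr => j _; rewrite /= corner_valZ.
rewrite (corner_val_mul (X := X ^+ j) (Y := Y ^+ i)) ?mulrA //.
- exact/esym/(commrX i (esym Ye)).
- exact: corner_val_exp.
- exact: corner_val_exp.
Qed.

Lemma corner_val_divdiff p (x y z : C) (X Y Z : B) :
  X * e = e * X -> Y * e = e * Y -> Z * e = e * Z ->
  cval x = X * e -> cval y = Y * e -> cval z = Z * e ->
  cval (divdiff p x y z) = divdiff p X Y Z * e.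
Proof.
move=> Xe Ye Ze xX yY zZ; rewrite raddf_sum mulr_suml; apply: eq_bigr => i _.
rewrite raddf_sum mulr_suml; apply: eq_bigr => j _; rewrite /= corner_valZ.
rewrite (corner_val_mul (X := \sum_(m < j) X ^+ (j.-1 - m) * Z ^+ m) (Y := Y ^+ i)) ?mulrA //.
- exact/esym/(commrX i (esym Ye)).
- rewrite raddf_sum mulr_suml; apply: eq_bigr => m _.
  apply: corner_val_mul; [|exact: corner_val_exp..].
  exact/esym/(commrX m (esym Ze)).
- exact: corner_val_exp.
Qed.

End Corner.

Section MonomialMatrix.
Variables (A : comNzRingType) (B : algOverType A) (T : finType).
Implicit Types (s : T -> T) (x y : T -> B).

(** On columns: the basis vector at [t] goes to [x t] times the one at [s t]. All generators of H_n
    have this shape, with [s] the identity or the action of an adjacent transposition. *)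
Definition mono s x : 'Mat[B]_T :=
  \matrix_(i, j) if enum_val i == s (enum_val j) then x (enum_val j) else 0.

Lemma mono_entry s x t' t : entry (mono s x) t' t = if t' == s t then x t else 0.
Proof. by rewrite /entry mxE !enum_rankK. Qed.

Lemma entry_inj (M N : 'Mat[B]_T) :
  (forall t' t, entry M t' t = entry N t' t) -> M = N.
Proof.
move=> H; apply/matrixP => i j; rewrite -(enum_valK i) -(enum_valK j).
exact: H.
Qed.

Lemma entryM (M N : 'Mat[B]_T) t' t :
  entry (M * N) t' t = \sum_u entry M t' u * entry N u t.
Proof.
rewrite /entry mxE (reindex (@enum_val T predT)) /=; last exact/onW_bij/enum_val_bij.
by apply: eq_bigr => i _; rewrite enum_valK.
Qed.

Lemma entryD (M N : 'Mat[B]_T) t' t :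
  entry (M + N) t' t = entry M t' t + entry N t' t.
Proof. by rewrite /entry mxE. Qed.

Lemma entry_sum (I : Type) (r : seq I) (P : pred I) (M : I -> 'Mat[B]_T) t' t :
  entry (\sum_(i <- r | P i) M i) t' t = \sum_(i <- r | P i) entry (M i) t' t.
Proof. by rewrite /entry summxE. Qed.

Lemma entry_alg a t' t :
  entry (alg a : 'Mat[B]_T) t' t = if t' == t then alg a else 0.
Proof.
rewrite /entry [X in fun_of_matrix X _ _]/(mxalg_const _ _ a) mxE.
by rewrite (inj_eq enum_rank_inj); case: eqP.
Qed.

Lemma mono1 : mono id (fun=> 1) = 1.
Proof.
apply: entry_inj => t' t; rewrite mono_entry -(rmorph1 (@alg A 'M[B]__)) entry_alg.
by rewrite rmorph1.
Qed.

Lemma mono_mul s x s' y :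
  mono s x * mono s' y = mono (s \o s') (fun t => x (s' t) * y t).
Proof.
apply: entry_inj => t' t; rewrite entryM (bigD1 (s' t)) //= big1 ?addr0.
  by rewrite !mono_entry eqxx; case: eqP => // _; rewrite mul0r.
by move=> u /negPf us; rewrite !mono_entry us mulr0.
Qed.

(** A zero coefficient leaves its row undetermined, hence the disjunction. *)
Lemma mono_eq s x s' y :
  (forall t, x t = y t /\ (s t = s' t \/ x t = 0)) -> mono s x = mono s' y.
Proof.
move=> H; apply: entry_inj => t' t; rewrite !mono_entry; have [<- [->|->]] //:= H t.
by rewrite !if_same.
Qed.

(** Seen as a morphism from a product algebra, so that [ev2] and [divdiff] of diagonal matrices are
    computed entry by entry. *)
Definition diag (x : dprodalg (fun _ : T => B)) : 'Mat[B]_T := mono id x.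

Lemma diag_zmod : zmod_morphism diag.
Proof.
move=> x y; apply: entry_inj => t' t; rewrite /entry !mxE.
by case: eqP; rewrite ?subr0.
Qed.
Lemma diag_monoid : monoid_morphism diag.
Proof. by split=> [|x y]; [exact: mono1 | rewrite /diag mono_mul]. Qed.
HB.instance Definition _ :=
  GRing.isZmodMorphism.Build (dprodalg (fun _ : T => B)) 'Mat[B]_T diag diag_zmod.
HB.instance Definition _ :=
  GRing.isMonoidMorphism.Build (dprodalg (fun _ : T => B)) 'Mat[B]_T diag diag_monoid.
Lemma diag_alg a : diag (alg a) = alg a.
Proof. by apply: entry_inj => t' t; rewrite mono_entry entry_alg. Qed.
HB.instance Definition _ :=
  isAlgHom.Build A (dprodalg (fun _ : T => B)) 'Mat[B]_T diag diag_alg.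

Lemma mono_ev2 p x y :
  ev2 p (mono id x) (mono id y) = mono id (fun t => ev2 p (x t) (y t)).
Proof.
rewrite -[LHS](alghom_ev2 diag p (x : dprodalg (fun _ : T => B)) y).
by apply: mono_eq => t; split; [exact: (alghom_ev2 (dproj t)) | left].
Qed.

Lemma mono_divdiff p x y z :
  divdiff p (mono id x) (mono id y) (mono id z) =
  mono id (fun t => divdiff p (x t) (y t) (z t)).
Proof.
rewrite -[LHS](alghom_divdiff diag p (x : dprodalg (fun _ : T => B)) y z).
by apply: mono_eq => t; split; [exact: (alghom_divdiff (dproj t)) | left].
Qed.

End MonomialMatrix.

(** * Colours, ranks and restrictions of tuples *)

Section TupleAction.
Variables (n : nat) (T : Type).
Implicit Types (x : n.-tuple T) (a : 'I_n.-1).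

Lemma tnth_act (s : 'S_n) x i : tnth (act s x) i = tnth x ((s^-1)%g i).
Proof. by rewrite tnth_mktuple. Qed.

Lemma tupact1 x : act 1%g x = x.
Proof. by apply: eq_from_tnth => i; rewrite tnth_act invg1 perm1. Qed.

Lemma tupactM (s s' : 'S_n) x : act (s * s')%g x = act s' (act s x).
Proof. by apply: eq_from_tnth => i; rewrite !tnth_act invMg permM. Qed.

Lemma spermV a : ((sperm a)^-1)%g = sperm a.
Proof. exact: tpermV. Qed.

Lemma lo_neq_hi a : lo a != hi a.
Proof. by rewrite -val_eqE /= neq_ltn ltnS leqnn. Qed.

Lemma act_lo a x : tnth (act (sperm a) x) (lo a) = tnth x (hi a).
Proof. by rewrite tnth_act spermV tpermL. Qed.

Lemma act_hi a x : tnth (act (sperm a) x) (hi a) = tnth x (lo a).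
Proof. by rewrite tnth_act spermV tpermR. Qed.

Lemma act_out a b x : b != lo a -> b != hi a ->
  tnth (act (sperm a) x) b = tnth x b.
Proof. by move=> bl bh; rewrite tnth_act spermV tpermD // eq_sym. Qed.

Lemma act_spermK a : involutive (fun x => act (sperm a) x).
Proof. by move=> x; rewrite -tupactM tperm2 tupact1. Qed.

(** Turns an adjacent transposition into an exchange of two consecutive list entries, the form in
    which prefixes, counts and filters can be computed. *)
Lemma act_split a x : exists (s1 : seq T) u v (s2 : seq T),
  [/\ tval x = s1 ++ [:: u, v & s2], tval (act (sperm a) x) = s1 ++ [:: v, u & s2],
      size s1 = a, u = tnth x (lo a) & v = tnth x (hi a)].
Proof.
set u := tnth x (lo a); set v := tnth x (hi a).
have an : (a.+1 < n)%N := hi_subproof a.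
have E1 : tval x = take a x ++ [:: u, v & drop a.+2 x].
  rewrite -[LHS](cat_take_drop a); congr (_ ++ _).
  rewrite (drop_nth u) ?size_tuple 1?ltnW //; congr cons.
    exact: esym (tnth_nth u x (lo a)).
  rewrite (drop_nth v) ?size_tuple //; congr cons.
  exact: esym (tnth_nth v x (hi a)).
have sz : size (take a x) = a by rewrite size_takel // size_tuple ltnW // ltnW.
exists (take a x), u, v, (drop a.+2 x); split => //.
apply: (@eq_from_nth _ u) => [|i].
  by rewrite size_tuple -[LHS](size_tuple x) [in LHS]E1 !size_cat.
rewrite size_tuple => ilt; rewrite -(tnth_nth u _ (Ordinal ilt)).
rewrite nth_cat sz; case: ltngtP => [ia|ai|ai].
- rewrite act_out ?(tnth_nth u) /= ?nth_take // -val_eqE /= neq_ltn ?ia //.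
  by rewrite ltnS ltnW.
- have [ia|ia] := eqVneq i a.+1.
    have -> : Ordinal ilt = hi a by exact: val_inj.
    by rewrite act_hi ia subSnn.
  have ai2 : (a.+1 < i)%N by rewrite ltn_neqAle eq_sym ia.
  rewrite act_out -?val_eqE //= 1?gtn_eqF // (tnth_nth u) /= [in LHS]E1 nth_cat sz.
  by rewrite ltnNge ltnW //= -(subnSK ai) -(subnSK ai2).
- have -> : Ordinal ilt = lo a by exact: val_inj.
  by rewrite act_lo ai subnn.
Qed.

Lemma act_splitE a x (s1 : seq T) u v (s2 : seq T) :
  tval x = s1 ++ [:: u, v & s2] -> size s1 = a ->
  tval (act (sperm a) x) = s1 ++ [:: v, u & s2].
Proof.
have [r1 [u' [v' [r2 [-> -> sr _ _]]]]] := act_split a x.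
move=> E sa; have E1 : r1 = s1.
  by have := congr1 (take a) E; rewrite !take_size_cat.
have E2 : [:: u', v' & r2] = [:: u, v & s2].
  by have := congr1 (drop a) E; rewrite !drop_size_cat.
by case: E2 => -> -> ->; rewrite E1.
Qed.

End TupleAction.

Lemma act_map (n : nat) (T U : Type) (f : T -> U) (s : 'S_n) (x : n.-tuple T) :
  act s (map_tuple f x) = map_tuple f (act s x).
Proof. by apply: eq_from_tnth => i; rewrite !(tnth_act, tnth_map). Qed.

Lemma perm_act (n : nat) (T : eqType) (s : 'S_n) (x : n.-tuple T) :
  perm_eq (act s x) x.
Proof. by apply/tuple_permP; exists (s^-1)%g. Qed.

Lemma perm_act_exists (n : nat) (T : eqType) (x y : n.-tuple T) :
  perm_eq x y -> exists s, act s x = y.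
Proof.
rewrite perm_sym => /tuple_permP[p yE]; exists (p^-1)%g; apply: val_inj.
rewrite /= yE; apply: eq_map => i; by rewrite invgK.
Qed.

Lemma count_act (n : nat) (T : eqType) (s : 'S_n) (x : n.-tuple T) p :
  count p (act s x) = count p x.
Proof. exact: (elimT seq.permP (perm_act s x)). Qed.

Section Rank.
Variables (d n : nat).
Implicit Types (t : n.-tuple 'I_d) (j : 'I_d) (a b : 'I_n.-1) (i : 'I_n).

(** When position [c] carries colour [j], this is the 0-based index of that strand among the strands
    of its colour. *)
Definition rk j t (c : nat) : nat := count_mem j (take c t).
Arguments rk : simpl never.

Lemma rkS j t i : rk j t i.+1 = (rk j t i + (tnth t i == j))%N.
Proof.
rewrite /rk (take_nth j) ?size_tuple // -cats1 count_cat /= addn0.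
by rewrite (tnth_nth j).
Qed.

Lemma rk_leq j t c c' : (c <= c')%N -> (rk j t c <= rk j t c')%N.
Proof. by move=> cc; rewrite /rk -(subnKC cc) takeD count_cat leq_addr. Qed.

Lemma rk_le_count j t c : (rk j t c <= count_mem j t)%N.
Proof. by rewrite -[in leqRHS](cat_take_drop c t) count_cat leq_addr. Qed.

Lemma rk_lt t i c : (i < c)%N -> (rk (tnth t i) t i < rk (tnth t i) t c)%N.
Proof. by move=> /(rk_leq (tnth t i) t); rewrite rkS eqxx addn1. Qed.

Lemma rk_lt_count t i : (rk (tnth t i) t i < count_mem (tnth t i) t)%N.
Proof.
apply: leq_trans (rk_le_count _ _ i.+1); exact: rk_lt.
Qed.

Lemma rk_inj t i i' : tnth t i = tnth t i' ->
  rk (tnth t i) t i = rk (tnth t i) t i' -> i = i'.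
Proof.
move=> tt E; apply: val_inj; case: (ltngtP i i') => // /(rk_lt t).
  by rewrite E ltnn.
by rewrite -tt E ltnn.
Qed.

Lemma rk_hi t a : rk (tnth t (lo a)) t (hi a) = (rk (tnth t (lo a)) t (lo a)).+1.
Proof. by rewrite /= (rkS _ _ (lo a)) eqxx addn1. Qed.

(** Only the prefix of length [a.+1] contains one of the two exchanged entries without the other. *)
Lemma rk_act j t a (c : nat) : c != a.+1 -> rk j (act (sperm a) t) c = rk j t c.
Proof.
have [s1 [u [v [s2 [E1 E2 sz _ _]]]]] := act_split a t.
move=> ca; rewrite /rk E1 E2 !take_cat sz; case: ltnP => // ac.
have [->|ca'] := eqVneq c a; first by rewrite subnn !take0.
have ac2 : (a.+1 < c)%N by rewrite ltn_neqAle eq_sym ca ltn_neqAle eq_sym ca'.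
rewrite -(subnSK (ltnW ac2)) -(subnSK ac2).
by rewrite !count_cat; congr addn; rewrite /= addnCA.
Qed.

Lemma rk_act_lo t a : rk (tnth t (hi a)) (act (sperm a) t) (lo a) =
  rk (tnth t (hi a)) t (lo a).
Proof. by rewrite rk_act //= neq_ltn ltnSn. Qed.

Lemma rk_act_hi t a : tnth t (hi a) != tnth t (lo a) ->
  rk (tnth t (lo a)) (act (sperm a) t) (hi a) = rk (tnth t (lo a)) t (lo a).
Proof.
move=> ne; rewrite [hi a : nat]/= (rkS _ _ (lo a)) act_lo (negPf ne) addn0.
by rewrite rk_act //= neq_ltn ltnSn.
Qed.

(** Strands of one colour never pass each other when the two crossing strands have different
    colours, so every strand keeps its index within its colour. *)
Lemma rk_act_perm t a i : tnth t (lo a) != tnth t (hi a) ->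
  rk (tnth t i) (act (sperm a) t) (sperm a i) = rk (tnth t i) t i.
Proof.
move=> ne; rewrite /sperm.
have [->|il] := eqVneq i (lo a); first by rewrite tpermL rk_act_hi // eq_sym.
have [->|ih] := eqVneq i (hi a).
  by rewrite tpermR rk_act_lo [hi a : nat]/= (rkS _ _ (lo a)) (negPf ne) addn0.
rewrite tpermD 1?eq_sym // rk_act //; apply: contraNneq ih => E.
Qed.

Lemma act_id t a : tnth t (lo a) = tnth t (hi a) -> act (sperm a) t = t.
Proof.
move=> E; apply: eq_from_tnth => i.
have [->|il] := eqVneq i (lo a); first by rewrite act_lo.
have [->|ih] := eqVneq i (hi a); first by rewrite act_hi.
by rewrite act_out.
Qed.

End Rank.

Section Restriction.
Variables (d n : nat) (K : finType) (part : K -> 'I_d).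
Implicit Types (k : seq K) (j : 'I_d).
Local Notation Kj := (Kj part).

(** A list rather than a tuple: its length is [part_of l j] only when the colours of [k] have
    content [l]. *)
Definition kres j k : seq (Kj j) := pmap insub k.
Arguments kres : simpl never.

Lemma kres_val j k : map val (kres j k) = [seq x <- k | part x == j].
Proof. by rewrite /kres (pmap_filter (insubK _)); apply: eq_filter => x; exact: isSome_insub. Qed.

Lemma kres_cat j k k' : kres j (k ++ k') = kres j k ++ kres j k'.
Proof. exact: pmap_cat. Qed.

Lemma kres_cons j x k :
  kres j (x :: k) = if insub x is Some y then y :: kres j k else kres j k.
Proof. by rewrite /kres /=; case: insub. Qed.

Lemma kres_cons_neq j x k : part x != j -> kres j (x :: k) = kres j k.
Proof. by move=> xj; rewrite kres_cons insubN. Qed.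

Lemma size_kres j k : size (kres j k) = count_mem j (map part k).
Proof. by rewrite -(size_map val) kres_val size_filter count_map. Qed.

(** Reading from the left, the colour sequence tells from which restriction the next letter has to
    be taken. *)
Lemma kres_inj k k' : map part k = map part k' ->
  (forall j, kres j k = kres j k') -> k = k'.
Proof.
elim: k k' => [|x k IH] [|x' k'] //= [pE kE] H.
have := H (part x); rewrite !kres_cons !insubT -?pE // => px px'.
case=> xE rE; congr (_ :: _); first by [].
apply: IH => // j; have [<-//|xj] := eqVneq (part x) j.
by have := H j; rewrite !kres_cons_neq // -pE.
Qed.

Definition colour (k : n.-tuple K) : n.-tuple 'I_d := map_tuple part k.

Lemma tnth_colour (k : n.-tuple K) i : tnth (colour k) i = part (tnth k i).
Proof. exact: tnth_map. Qed.

Lemma colour_act s (k : n.-tuple K) : colour (act s k) = act s (colour k).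
Proof. by rewrite /colour act_map. Qed.

Lemma kres_tnth m (k : n.-tuple K) j (u : m.-tuple (Kj j)) (i : 'I_n) (r : 'I_m) :
  tval u = kres j k -> part (tnth k i) = j -> rk j (colour k) i = r ->
  val (tnth u r) = tnth k i.
Proof.
move=> uE pE rE; have x0 : Kj j by exact: tnth u r.
rewrite (tnth_nth x0) uE -rE (tnth_nth (val x0)) -(nth_map _ (val x0)); last first.
  by rewrite -uE size_tuple rE.
rewrite kres_val /rk /= -map_take count_map.
have -> : count (preim part (pred1 j)) (take i k) = size [seq x <- take i k | part x == j].
  by rewrite size_filter.
rewrite -{1}(cat_take_drop i k) filter_cat nth_cat ltnn subnn.
by rewrite (drop_nth (val x0)) ?size_tuple //= -tnth_nth pE eqxx.
Qed.

(** Exchanging letters of different colours changes only how the restrictions are interleaved. *)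
Lemma kres_act_neq a (k : n.-tuple K) j :
  part (tnth k (lo a)) != part (tnth k (hi a)) ->
  kres j (act (sperm a) k) = kres j k.
Proof.
have [s1 [u [v [s2 [E1 E2 sz <- <-]]]]] := act_split a k; rewrite E1 E2 => ne.
rewrite !kres_cat; congr (_ ++ _).
have [uj|uj] := eqVneq (part u) j; last by rewrite (kres_cons_neq _ uj) !(kres_cons j v) (kres_cons_neq _ uj).
have vj : part v != j by rewrite -uj eq_sym.
by rewrite (kres_cons_neq _ vj) !(kres_cons j u) (kres_cons_neq _ vj).
Qed.

Lemma kres_act_out a (k : n.-tuple K) j :
  part (tnth k (lo a)) != j -> part (tnth k (hi a)) != j ->
  kres j (act (sperm a) k) = kres j k.
Proof.
have [s1 [u [v [s2 [E1 E2 sz <- <-]]]]] := act_split a k; rewrite E1 E2 => uj vj.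
by rewrite !kres_cat !kres_cons_neq.
Qed.

Lemma kres_act_eq a (k : n.-tuple K) j m (u : m.-tuple (Kj j)) (b : 'I_m.-1) :
  tval u = kres j k -> part (tnth k (lo a)) = j -> part (tnth k (hi a)) = j ->
  rk j (colour k) (lo a) = b ->
  kres j (act (sperm a) k) = act (sperm b) u.
Proof.
have [s1 [x [y [s2 [E1 E2 sz <- <-]]]]] := act_split a k; rewrite E2 => uE xj yj rE.
have xj' : part x == j by rewrite xj.
have yj' : part y == j by rewrite yj.
rewrite (@act_splitE _ _ b u (kres j s1) (Sub x xj') (Sub y yj') (kres j s2)).
- by rewrite kres_cat !kres_cons !insubT.
- by rewrite uE E1 kres_cat !kres_cons !insubT.
- by rewrite size_kres -rE /rk /= E1 map_cat take_size_cat // size_map sz.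
Qed.

End Restriction.

Lemma flatten_single (I : eqType) (T : Type) (r : seq I) (i : I) (F : I -> seq T) :
  uniq r -> i \in r -> (forall j, j != i -> F j = [::]) ->
  flatten [seq F j | j <- r] = F i.
Proof.
move=> ur ir F0; elim: r ur ir => //= j r IH /andP[jr ur]; rewrite inE.
have [ij _|ij /= ir] := eqVneq i j; last by rewrite F0 1?eq_sym // IH.
subst j.
rewrite -[RHS]cats0; congr (_ ++ _).
apply/nilP; rewrite /nilp size_flatten /shape -map_comp sumnE big_map big_seq big1 // => k kr /=.
by rewrite F0 //; apply: contraTneq kr => ->.
Qed.

Section CompositionTuples.
Variables (d n : nat) (l : dcomp d n).
Implicit Types (t : n.-tuple 'I_d) (j : 'I_d) (a : 'I_n.-1) (i : 'I_n).

Definition has_content t := forall j, count_mem j t = part_of l j.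

Lemma JsetP (t : Jset l) : has_content (val t).
Proof. by move=> j; apply/eqP/(forallP (valP t)). Qed.

Definition mkJset t (H : has_content t) : Jset l :=
  Sub t (introT forallP (fun j => introT eqP (H j))).

Lemma act_content s t : has_content t -> has_content (act s t).
Proof. by move=> H j; rewrite count_act. Qed.

Definition actJ s (t : Jset l) : Jset l := mkJset (act_content s (JsetP t)).

Lemma tlam_content : has_content (tlam l).
Proof.
move=> j; rewrite /= /tlam_seq count_flatten -map_comp sumnE big_map big_enum /=.
rewrite (bigD1 j) //= big1 ?addn0 => [|i ij]; rewrite count_nseq /= ?eqxx ?mul1n //.
by rewrite (negPf ij).
Qed.

Definition nodesc t := forall a, (tnth t (lo a) <= tnth t (hi a))%N.

Lemma nodesc_le t (i i' : 'I_n) : nodesc t -> (i <= i')%N -> (tnth t i <= tnth t i')%N.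
Proof.
move=> H; case: i' => i'; elim: i' => [|i' IH] lti' /=.
  by rewrite leqn0 => /eqP i0; rewrite (_ : i = Ordinal lti') //; exact: val_inj.
rewrite leq_eqVlt => /orP[/eqP E|]; first by rewrite (_ : i = Ordinal lti') //; exact: val_inj.
rewrite ltnS => ii'; have lt' : (i' < n)%N by exact: ltnW.
apply: leq_trans (IH lt' ii') _.
have la : (i' < n.-1)%N by rewrite ltn_predRL.
have := H (Ordinal la); rewrite (_ : lo _ = Ordinal lt') 1?(_ : hi _ = Ordinal lti') //; exact: val_inj.
Qed.

(** In an increasing sequence the prefix before [i] contains all strands of smaller colours and none
    of larger ones; the remaining ones are counted by the rank. *)
Lemma nodesc_pos t i : nodesc t -> has_content t ->
  (offset l (tnth t i) + rk (tnth t i) t i)%N = i.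
Proof.
move=> S H; set j := tnth t i.
have E j' : (rk j' t i = if j' < j then part_of l j' else if j' == j then rk j t i else 0)%N.
  case: ifPn => [jj|jj]; last case: eqVneq => [->//|ne].
    rewrite -H /rk -{2}(cat_take_drop i t) count_cat [X in (_ + X)%N](_ : _ = 0)%N ?addn0 //.
    apply/eqP; rewrite -leqn0 leqNgt -has_count; apply/hasPn => x /(nthP j)[p].
    rewrite size_drop size_tuple ltn_subRL => pn; rewrite nth_drop => <- /=.
    rewrite -(tnth_nth j t (Ordinal pn)); apply/negP => /eqP E.
    have := @nodesc_le t i (Ordinal pn) S (leq_addr _ _); rewrite E -/j.
    by rewrite leqNgt jj.
  apply/eqP; rewrite -leqn0 leqNgt -has_count; apply/hasPn => x /(nthP j)[p].
  rewrite size_take size_tuple ltn_ord => pi; rewrite nth_take // => <-.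
  have pn : (p < n)%N by exact: ltn_trans pi _.
  rewrite -(tnth_nth j t (Ordinal pn)) /=; apply/negP => /eqP E.
  have := @nodesc_le t (Ordinal pn) i S (ltnW pi); rewrite E -/j.
  by rewrite leq_eqVlt val_eqE (negPf ne) (negPf jj).
have sE : (i : nat) = (\sum_j' rk j' t i)%N.
  transitivity (size (take i t)); first by rewrite size_takel ?size_tuple 1?ltnW.
  rewrite -sum1_size [LHS](partition_big id xpredT) //=; apply: eq_bigr => j' _.
  by rewrite /rk -sum1_count; apply: eq_bigl => x; rewrite eq_sym.
rewrite [RHS]sE; under [RHS]eq_bigr do rewrite E.
rewrite [RHS](bigID (fun j' : 'I_d => (j' < j)%N)) /=; congr (_ + _)%N.
  by apply: eq_bigr => j' ->.
rewrite (bigD1 j) ?ltnn //= eqxx big1 ?addn0 // => j' /andP[/negPf -> /negPf ->].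
by [].
Qed.

Lemma offset_mono j j' : (j < j')%N -> (offset l j + part_of l j <= offset l j')%N.
Proof.
move=> jj; rewrite /offset [leqRHS](bigD1 j) //= addnC leq_add2l.
rewrite [leqRHS](bigID (fun i : 'I_d => (i < j)%N)) /=.
apply: leq_trans (leq_addr _ _); apply: eq_leq; apply: eq_bigl => i.
case: (ltnP i j) => ij; rewrite ?andbF // (ltn_trans ij jj) /= andbT.
by rewrite -val_eqE /= neq_ltn ij.
Qed.

Lemma offset_inj j j' r r' : (r < part_of l j)%N -> (r' < part_of l j')%N ->
  (offset l j + r = offset l j' + r')%N -> j = j' /\ r = r'.
Proof.
move=> rj rj' E; case: (ltngtP j j') => [jj|jj|/val_inj jj].
- have := leq_trans (leq_addr r' _) (eq_leq (esym E)); have := offset_mono jj => h1.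
  move=> _; have : (offset l j + r < offset l j')%N.
    by apply: leq_trans h1; rewrite ltn_add2l.
  by rewrite E ltnNge leq_addr.
- have h1 := offset_mono jj; have : (offset l j' + r' < offset l j)%N.
    by apply: leq_trans h1; rewrite ltn_add2l.
  by rewrite -E ltnNge leq_addr.
- by subst j'; split=> //; move/addnI: E.
Qed.

Lemma nodesc_shift t j (b : 'I_(part_of l j)) : nodesc t -> has_content t ->
  tnth t (shift b) = j /\ rk j t (shift b) = b.
Proof.
move=> S H; have := nodesc_pos (shift b) S H.
set j' := tnth t _; move=> E.
have H1 : (rk j' t (shift b) < part_of l j')%N by rewrite -H; exact: rk_lt_count.
have [E1 E2] := offset_inj H1 (ltn_ord b) E.
by split=> //; move: E2; rewrite {1}E1.
Qed.

Lemma tlam_nodesc : nodesc (tlam l).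
Proof.
have S : sorted (fun i j : 'I_d => (i <= j)%N) (tlam l).
  rewrite /= /tlam_seq; have : sorted (fun i j : 'I_d => (i < j)%N) (enum 'I_d).
    by have := iota_ltn_sorted 0 d; rewrite -val_enum_ord sorted_map.
  elim: (enum 'I_d) => // j r IH /= pr.
  have /IH {}IH : sorted (fun i j : 'I_d => (i < j)%N) r by exact: path_sorted pr.
  have tr : transitive (fun i j : 'I_d => (i <= j)%N) by move=> x y z; exact: leq_trans.
  have tr' : transitive (fun i j : 'I_d => (i < j)%N) by move=> x y z; exact: ltn_trans.
  elim: (part_of l j) => //= m IHm; rewrite (path_sortedE tr) IHm andbT.
  apply/allP => x; rewrite mem_cat => /orP[/nseqP[-> _]|] //.
  move=> /flatten_mapP[i ir /nseqP[-> _]].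
  by have := allP (order_path_min tr' pr) _ ir; exact: ltnW.
move=> a; have j := tnth (tlam l) (lo a).
rewrite !(tnth_nth j); move/sortedP: S; move/(_ j a); apply.
by rewrite size_tuple; exact: (hi_subproof a).
Qed.

(** Every position is a [shift], and an increasing sequence of content [l] has the colour of the
    block there. *)
Lemma nodesc_uniq t : nodesc t -> has_content t -> t = tlam l.
Proof.
move=> S H; apply: eq_from_tnth => i.
have := nodesc_pos i S H; have lt := rk_lt_count t i.
rewrite H in lt; pose b : 'I_(part_of l (tnth t i)) := Ordinal lt.
move=> E; have <- : shift b = i by apply: val_inj.
by rewrite (nodesc_shift b tlam_nodesc tlam_content).1 (nodesc_shift b S H).1.
Qed.

Lemma content_perm t t' : has_content t -> has_content t' -> perm_eq t t'.
Proof. by move=> H H'; apply/allP => j _ /=; rewrite H H'. Qed.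

Lemma content_head j (i0 : 'I_n) : (0 < part_of l j)%N -> i0 = 0 :> nat ->
  exists t : Jset l, tnth (val t) i0 = j.
Proof.
move=> lj i00; pose b : 'I_(part_of l j) := Ordinal lj.
exists (actJ (tperm i0 (shift b)) (mkJset tlam_content)).
rewrite /= tnth_act tpermV tpermL.
exact: (nodesc_shift b tlam_nodesc tlam_content).1.
Qed.

Variables (K : finType) (part : K -> 'I_d).

Lemma colour_concat (k : forall j, (part_of l j).-tuple (Kj part j)) :
  colour part (concat k) = tlam l.
Proof.
apply: val_inj; rewrite /= map_flatten -map_comp /tlam_seq; congr flatten.
apply: eq_map => j /=; apply: (@eq_from_nth _ j).
  by rewrite !size_map size_nseq size_tuple.
move=> i; rewrite !size_map size_tuple => il.
rewrite -map_comp nth_nseq il.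
case: (tval (k j)) (size_tuple (k j)) => [|x s] sz; first by rewrite -sz in il.
by rewrite (nth_map x) ?sz //=; exact/eqP/(valP (nth x (x :: s) i)).
Qed.

Lemma kres_concat (k : forall j, (part_of l j).-tuple (Kj part j)) j :
  kres part j (concat k) = k j.
Proof.
apply: (inj_map val_inj); rewrite kres_val /= filter_flatten -map_comp.
rewrite (@flatten_single _ _ _ j) ?enum_uniq ?mem_enum //= => [|i ij].
  apply/all_filterP; rewrite all_map; apply/allP => x _ /=; exact: (valP x).
apply/eqP; rewrite -size_eq0 size_filter -leqn0 leqNgt -has_count has_map.
by apply/hasPn => x _ /=; rewrite (eqP (valP x)) eq_sym eq_sym.
Qed.

End CompositionTuples.

(** * The number of colour sequences of given content *)

Section Multinomial.
Variable d : nat.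

Definition ntuples (n : nat) (m : 'I_d -> nat) : nat :=
  #|[pred t : n.-tuple 'I_d | [forall j, count_mem j t == m j]]|.

(** Recursion on the first entry [i], whose removal lowers [m i] by one; the product form keeps
    division out of the induction. *)
Lemma ntuplesE n (m : 'I_d -> nat) : (\sum_j m j)%N = n ->
  (ntuples n m * \prod_j (m j)`! = n`!)%N.
Proof.
elim: n m => [|n IH] m mn.
  have m0 j : m j = 0%N.
    by apply/eqP; rewrite -leqn0 -mn (bigD1 j) //= leq_addr.
  rewrite big1 ?muln1 => [|j _]; last by rewrite m0.
  rewrite /ntuples -[RHS](card_tuple 0 'I_d); apply: eq_card => t; rewrite !inE.
  by apply/forallP => j; rewrite tuple0 m0.
pose m' i j := (m j - (i == j))%N.
have -> : ntuples n.+1 m = (\sum_(i | (0 < m i)%N) ntuples n (m' i))%N.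
  rewrite /ntuples -sum1_card (partition_big (fun t : n.+1.-tuple 'I_d => thead t)
     (fun i => 0 < m i)%N) /=; last first.
    move=> t /forallP /(_ (thead t)) /eqP <-.
    by rewrite (tuple_eta t) /= theadE eqxx.
  apply: eq_bigr => i mi; rewrite -sum1_card.
  rewrite (reindex (fun t : n.-tuple 'I_d => cons_tuple i t)) /=.
    apply: eq_bigl => t; rewrite !inE theadE eqxx andbT.
    apply: eq_forallb => j /=; rewrite /m'; have [ij|ij] := eqVneq i j.
      by subst j; rewrite add1n -[in LHS](prednK mi) eqSS subn1.
    by rewrite add0n subn0.
  exists (fun t : n.+1.-tuple 'I_d => behead_tuple t) => t.
    by move=> _; apply: val_inj.
  rewrite !inE => /andP[_ /eqP <-]; rewrite [RHS](tuple_eta t).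
  by apply: val_inj.
(* The factor [n.+1] of the factorial becomes the sum of the [m i], so the two sides are compared
   for each first entry separately. *)
rewrite big_distrl /= factS -mn big_distrl /= [RHS](bigID (fun i => 0 < m i)%N) /=.
rewrite [X in (_ + X)%N]big1 ?addn0 => [|i]; last by rewrite lt0n negbK => /eqP ->.
apply: eq_bigr => i mi.
have m'n : (\sum_j m' i j = n)%N.
  apply: succn_inj; rewrite -mn (bigD1 i) // [RHS](bigD1 i) //= /m' eqxx subn1.
  rewrite -addSn prednK //; congr addn; apply: eq_bigr => j ji.
  by rewrite eq_sym (negPf ji) subn0.
rewrite -(IH _ m'n) mulnCA; congr muln.
rewrite (bigD1 i) // [in RHS](bigD1 i) //= /m' eqxx subn1 mulnA.
rewrite -{1 2}(prednK mi) factS; congr muln.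
apply: eq_bigr => j ji.
by rewrite eq_sym (negPf ji) subn0.
Qed.

Lemma card_Jset n (l : dcomp d n) : #|Jset l| = multinom l.
Proof.
rewrite /multinom -(ntuplesE (dcomp_sum l)) mulnK; last first.
  by apply: prodn_gt0 => j; exact: fact_gt0.
by rewrite /ntuples card_sig; apply: eq_card.
Qed.

End Multinomial.

(** * Universal property of quiver Hecke algebras *)

Section MorphismExpansion.
Variables (A : comNzRingType) (B C : algOverType A) (f : {alghom B -> C}).
Implicit Types (x y z t : B).

(** This lemma and the next ones each match one shape of a side of a defining relation, so that
    [feval] is brought down to the generators in one step. *)
Lemma alghomM3 x y z : f (x * y * z) = f x * f y * f z.
Proof. by rewrite !rmorphM. Qed.

Lemma alghomM4 x y z t : f (x * y * z * t) = f x * f y * f z * f t.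
Proof. by rewrite !rmorphM. Qed.

Lemma alghomMD x y m z : f ((x * y + m%:R) * z) = (f x * f y + m%:R) * f z.
Proof. by rewrite rmorphM rmorphD rmorphM rmorph_nat. Qed.

Lemma alghomX2M x y : f (x ^+ 2 * y) = f x ^+ 2 * f y.
Proof. by rewrite rmorphM rmorphXn. Qed.

Lemma alghom_ev2M p x y z : f (ev2 p x y * z) = ev2 p (f x) (f y) * f z.
Proof. by rewrite rmorphM /= alghom_ev2. Qed.

Lemma alghom_braid p x y z t a b c :
  f (x * y * z * t + divdiff p a b c * t) =
  f x * f y * f z * f t + divdiff p (f a) (f b) (f c) * f t.
Proof. by rewrite rmorphD /= alghomM4 rmorphM /= alghom_divdiff. Qed.

End MorphismExpansion.

Section QuiverHeckeRelations.
Variables (A : comNzRingType) (K : finType) (Q : K -> K -> {poly {poly A}}).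
Variable n : nat.

(** The defining relations for arbitrary elements of an arbitrary algebra: proved for matrices and
    for the corner to construct morphisms, and used as rewriting rules in [qH] itself. *)
Record qHrels (C : algOverType A) (e : n.-tuple K -> C) (y : 'I_n -> C)
    (psi : 'I_n.-1 -> C) : Prop := QHRels {
  rel_sum1 : \sum_k e k = 1;
  rel_idem : forall k k', e k * e k' = if k == k' then e k else 0;
  rel_ye : forall a k, y a * e k = e k * y a;
  rel_psie : forall a k, psi a * e k = e (act (sperm a) k) * psi a;
  rel_yy : forall a b, y a * y b = y b * y a;
  rel_psiy : forall a b, b != lo a -> b != hi a -> psi a * y b = y b * psi a;
  rel_psipsi : forall a b : 'I_n.-1, (a.+1 < b)%N || (b.+1 < a)%N ->
    psi a * psi b = psi b * psi a;
  rel_psiyS : forall a k, psi a * y (hi a) * e k =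
    (y (lo a) * psi a + (tnth k (lo a) == tnth k (hi a))%:R) * e k;
  rel_ySpsi : forall a k, y (hi a) * psi a * e k =
    (psi a * y (lo a) + (tnth k (lo a) == tnth k (hi a))%:R) * e k;
  rel_psi2 : forall a k, psi a ^+ 2 * e k =
    ev2 (Q (tnth k (lo a)) (tnth k (hi a))) (y (lo a)) (y (hi a)) * e k;
  rel_braid_eq : forall (a b : 'I_n.-1) k, b = a.+1 :> nat ->
    tnth k (lo a) = tnth k (hi b) ->
    psi b * psi a * psi b * e k = psi a * psi b * psi a * e k +
      divdiff (Q (tnth k (lo a)) (tnth k (hi a))) (y (lo a)) (y (hi a)) (y (hi b)) * e k;
  rel_braid_neq : forall (a b : 'I_n.-1) k, b = a.+1 :> nat ->
    tnth k (lo a) <> tnth k (hi b) ->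
    psi b * psi a * psi b * e k = psi a * psi b * psi a * e k
}.

Definition qH_lift_gen (C : algOverType A) (e : n.-tuple K -> C) (y : 'I_n -> C)
    (psi : 'I_n.-1 -> C) (x : qH_gen K n) : C :=
  match x with inl k => e k | inr (inl a) => y a | inr (inr a) => psi a end.

Lemma qHrels_of_feval (C : algOverType A) (e : n.-tuple K -> C) (y : 'I_n -> C)
    (psi : 'I_n.-1 -> C) :
  (forall u v, qH_rel Q u v ->
     feval (qH_lift_gen e y psi) u = feval (qH_lift_gen e y psi) v) ->
  qHrels e y psi.
Proof.
move=> qH_feval; split.
- have := qH_feval _ _ (qH_sum1 Q n); rewrite rmorph_sum rmorph1 => <-.
  by apply: eq_bigr => k _; rewrite /= feval_gen.
- move=> k k'; have := qH_feval _ _ (qH_idem Q k k'); rewrite [LHS]rmorphM /= !feval_gen /= => ->.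
  by case: eqP; rewrite ?feval_gen ?rmorph0.
- move=> a k; have := qH_feval _ _ (qH_ye Q a k).
  by rewrite [LHS]rmorphM [RHS]rmorphM /= !feval_gen.
- move=> a k; have := qH_feval _ _ (qH_psie Q a k).
  by rewrite [LHS]rmorphM [RHS]rmorphM /= !feval_gen.
- move=> a b; have := qH_feval _ _ (qH_yy Q a b).
  by rewrite [LHS]rmorphM [RHS]rmorphM /= !feval_gen.
- move=> a b al ah; have := qH_feval _ _ (qH_psiy Q al ah).
  by rewrite [LHS]rmorphM [RHS]rmorphM /= !feval_gen.
- move=> a b ab; have := qH_feval _ _ (qH_psipsi Q ab).
  by rewrite [LHS]rmorphM [RHS]rmorphM /= !feval_gen.
- move=> a k; have := qH_feval _ _ (qH_psiyS Q a k).
  by rewrite [LHS]alghomM3 [RHS]alghomMD /= !feval_gen.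
- move=> a k; have := qH_feval _ _ (qH_ySpsi Q a k).
  by rewrite [LHS]alghomM3 [RHS]alghomMD /= !feval_gen.
- move=> a k; have := qH_feval _ _ (qH_psi2 Q a k).
  by rewrite [LHS]alghomX2M [RHS]alghom_ev2M /= !feval_gen.
- move=> a b k ba kk; have := qH_feval _ _ (qH_braid_eq Q ba kk).
  by rewrite [LHS]alghomM4 [RHS]alghom_braid /= !feval_gen.
- move=> a b k ba kk; have := qH_feval _ _ (qH_braid_neq Q ba kk).
  by rewrite [LHS]alghomM4 [RHS]alghomM4 /= !feval_gen.
Qed.

Lemma qH_feval u v : qH_rel Q u v ->
  feval (qH_lift_gen (@qH_e A K Q n) (@qH_y A K Q n) (@qH_psi A K Q n)) u =
  feval (qH_lift_gen (@qH_e A K Q n) (@qH_y A K Q n) (@qH_psi A K Q n)) v.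
Proof.
by move=> /algpres_rel; apply => -[k|[a|a]].
Qed.

Lemma qH_rels : qHrels (@qH_e A K Q n) (@qH_y A K Q n) (@qH_psi A K Q n).
Proof. exact: (qHrels_of_feval qH_feval). Qed.

Lemma qH_ind (P : qH Q n -> Prop) :
  (forall a, P (alg a)) -> (forall k, P (qH_e Q k)) ->
  (forall a, P (qH_y Q a)) -> (forall a, P (qH_psi Q a)) ->
  (forall u v, P u -> P v -> P (u + v)) ->
  (forall u v, P u -> P v -> P (u * v)) -> forall z, P z.
Proof.
move=> Pa Pe Py Pp PD PM z; elim/algpres_ind: z => [a|[k|[a|a]]|u v|u v].
- exact: Pa.
- exact: Pe.
- exact: Py.
- exact: Pp.
- exact: PD.
- exact: PM.
Qed.

Variables (C : algOverType A) (e : n.-tuple K -> C) (y : 'I_n -> C).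
Variables (psi : 'I_n.-1 -> C) (R : qHrels e y psi).

Lemma qH_lift_rel u v : qH_rel Q u v ->
  feval (qH_lift_gen e y psi) u = feval (qH_lift_gen e y psi) v.
Proof.
case=> {u v}.
- rewrite rmorph_sum rmorph1 -(rel_sum1 R); apply: eq_bigr => k _.
  exact: feval_gen.
- move=> k k'; rewrite [LHS]rmorphM /= !feval_gen /= (rel_idem R).
  by case: eqP; rewrite ?feval_gen ?rmorph0.
- move=> a k; rewrite [LHS]rmorphM [RHS]rmorphM /= !feval_gen /=.
  exact: (rel_ye R).
- move=> a k; rewrite [LHS]rmorphM [RHS]rmorphM /= !feval_gen /=.
  exact: (rel_psie R).
- move=> a b; rewrite [LHS]rmorphM [RHS]rmorphM /= !feval_gen /=.
  exact: (rel_yy R).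
- move=> a b al ah; rewrite [LHS]rmorphM [RHS]rmorphM /= !feval_gen /=.
  exact: (rel_psiy R).
- move=> a b ab; rewrite [LHS]rmorphM [RHS]rmorphM /= !feval_gen /=.
  exact: (rel_psipsi R).
- move=> a k; rewrite [LHS]alghomM3 [RHS]alghomMD /= !feval_gen /=.
  exact: (rel_psiyS R).
- move=> a k; rewrite [LHS]alghomM3 [RHS]alghomMD /= !feval_gen /=.
  exact: (rel_ySpsi R).
- move=> a k; rewrite [LHS]alghomX2M [RHS]alghom_ev2M /= !feval_gen /=.
  exact: (rel_psi2 R).
- move=> a b k ba kk; rewrite [LHS]alghomM4 [RHS]alghom_braid /= !feval_gen /=.
  exact: (rel_braid_eq R).
- move=> a b k ba kk; rewrite [LHS]alghomM4 [RHS]alghomM4 /= !feval_gen /=.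
  exact: (rel_braid_neq R).
Qed.

Definition qH_lift : {alghom qH Q n -> C} := plift qH_lift_rel.

Lemma qH_lift_e k : qH_lift (qH_e Q k) = e k. Proof. exact: plift_gen. Qed.
Lemma qH_lift_y a : qH_lift (qH_y Q a) = y a. Proof. exact: plift_gen. Qed.
Lemma qH_lift_psi a : qH_lift (qH_psi Q a) = psi a. Proof. exact: plift_gen. Qed.

End QuiverHeckeRelations.

(** * Words crossing strands of different colours *)

Section CrossingWords.
Variables (d n : nat).
Implicit Types (t : n.-tuple 'I_d) (a b : 'I_n.-1) (w : seq 'I_n.-1).
Local Notation sw a t := (act (sperm a) t).

(** The last letter acts first, as in [psiw w * ecol t], where the last factor meets the
    idempotent. *)
Definition wact w t : n.-tuple 'I_d := foldr (fun a t => sw a t) t w.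

Lemma wact_perm w t : wact w t = act (word_perm w) t.
Proof. by elim: w => [|a w IH] /=; rewrite ?tupact1 // tupactM IH. Qed.

Lemma wact_rcons w a t : wact (rcons w a) t = wact w (sw a t).
Proof. by rewrite /wact foldr_rcons. Qed.

Lemma wact_revK w t : wact (rev w) (wact w t) = t.
Proof.
by elim: w t => [|a w IH] t //=; rewrite rev_cons wact_rcons act_spermK IH.
Qed.

Lemma wact_content (l : dcomp d n) w t : has_content l t -> has_content l (wact w t).
Proof. by rewrite wact_perm => H; exact: act_content. Qed.

(** Along a [cpath] the product of the psi is invertible on [ecol t]; along a [dpath], the special
    case where every letter removes a descent, [weight] decreases. *)
Fixpoint cpath w t : bool :=
  if w is a :: w' then
    cpath w' t && (tnth (wact w' t) (lo a) != tnth (wact w' t) (hi a))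
  else true.

Fixpoint dpath w t : bool :=
  if w is a :: w' then
    dpath w' t && (tnth (wact w' t) (hi a) < tnth (wact w' t) (lo a))%N
  else true.

Lemma cpath_rcons w a t :
  cpath (rcons w a) t = (tnth t (lo a) != tnth t (hi a)) && cpath w (sw a t).
Proof.
elim: w => [|b w IH] /=; first by rewrite andbT.
by rewrite IH wact_rcons andbA.
Qed.

Lemma dpath_rcons w a t :
  dpath (rcons w a) t = (tnth t (hi a) < tnth t (lo a))%N && dpath w (sw a t).
Proof.
elim: w => [|b w IH] /=; first by rewrite andbT.
by rewrite IH wact_rcons andbA.
Qed.

Lemma dpath_cpath w t : dpath w t -> cpath w t.
Proof.
elim: w => //= a w IH /andP[/IH -> /=]; apply: contraTneq => ->.
by rewrite ltnn.
Qed.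

Lemma cpath_rev w t : cpath w t -> cpath (rev w) (wact w t).
Proof.
elim: w t => //= a w IH t /andP[cw ne]; rewrite rev_cons cpath_rcons.
by rewrite act_lo act_hi eq_sym ne act_spermK IH.
Qed.

(* Deleting a crossing of two strands of the same colour does not change the
   action on t. *)
Lemma short_cpath w t :
  (forall w', wact w' t = wact w t -> (size w <= size w')%N) -> cpath w t.
Proof.
elim: w => //= a w IH H; apply/andP; split.
  apply: IH => w' E; have := H (a :: w'); rewrite /= E => /(_ erefl).
  by rewrite ltnS.
apply/negP => /eqP E; have := H w; rewrite act_id // => /(_ erefl).
by rewrite ltnn.
Qed.

Definition sortedb t := [forall a, (tnth t (lo a) <= tnth t (hi a))%N].

Lemma sortedbP t : reflect (nodesc t) (sortedb t).
Proof. exact: forallP. Qed.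

Lemma sortedbPn t : ~~ sortedb t -> exists a, (tnth t (hi a) < tnth t (lo a))%N.
Proof. by rewrite negb_forall => /existsP[a]; rewrite -ltnNge; exists a. Qed.

(** Plays the part of the number of inversions: removing an adjacent descent lowers it by the
    difference of the two colours. *)
Definition weight t : nat := (\sum_(i < n) (n - i) * tnth t i)%N.

Lemma weight_desc a t :
  (tnth t (hi a) < tnth t (lo a))%N -> (weight (sw a t) < weight t)%N.
Proof.
move=> D; have hl : hi a != lo a by rewrite eq_sym lo_neq_hi.
have W t' : weight t' = ((n - a) * tnth t' (lo a) + ((n - a.+1) * tnth t' (hi a) +
    \sum_(i < n | (i != lo a) && (i != hi a)) (n - i) * tnth t' i))%N.
  by rewrite /weight (bigD1 (lo a)) // (bigD1 (hi a)).
rewrite !W; set S := (X in (_ < _ + (_ + X))%N).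
rewrite [X in (_ + (_ + X) < _)%N](_ : _ = S); last first.
  by apply: eq_bigr => i /andP[il ih]; rewrite act_out.
rewrite act_lo act_hi !addnA ltn_add2r.
have -> : (n - a = (n - a.+1).+1)%N by rewrite subnSK // ltnW // hi_subproof.
by rewrite !mulSn -!addnA [X in (_ < _ + X)%N]addnC ltn_add2r.
Qed.

Lemma weight_ind (P : n.-tuple 'I_d -> Prop) :
  (forall t, (forall t', (weight t' < weight t)%N -> P t') -> P t) -> forall t, P t.
Proof.
move=> H t; have [m] := ubnP (weight t); elim: m t => // m IH t tm.
by apply: H => t' tt; apply: IH; apply: leq_trans tt _.
Qed.

Definition sorting w t := dpath w t && sortedb (wact w t).

Lemma sorting_rcons w a t :
  sorting (rcons w a) t = (tnth t (hi a) < tnth t (lo a))%N && sorting w (sw a t).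
Proof. by rewrite /sorting dpath_rcons wact_rcons andbA. Qed.

Lemma sorting_exists t : exists w, sorting w t.
Proof.
elim/weight_ind: t => t IH; have [s|/sortedbPn[a D]] := boolP (sortedb t).
  by exists [::].
have [w Hw] := IH _ (weight_desc D).
by exists (rcons w a); rewrite sorting_rcons D.
Qed.

Lemma sperm_far a b : (a.+1 < b)%N || (b.+1 < a)%N ->
  [/\ lo b != lo a, lo b != hi a, hi b != lo a & hi b != hi a].
Proof. by case/orP => ab; split; rewrite -val_eqE /= neq_ltn; lia. Qed.

Lemma act_far (T : Type) a b (x : n.-tuple T) : (a.+1 < b)%N || (b.+1 < a)%N ->
  act (sperm a) (act (sperm b) x) = act (sperm b) (act (sperm a) x).
Proof.
case/sperm_far => h1 h2 h3 h4; rewrite -!tupactM; congr act.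
by rewrite conjgC /sperm tpermJ !tpermD // eq_sym.
Qed.

Lemma act_braid (T : Type) a b (x : n.-tuple T) : b = a.+1 :> nat ->
  act (sperm a) (act (sperm b) (act (sperm a) x)) =
  act (sperm b) (act (sperm a) (act (sperm b) x)).
Proof.
move=> ba; have lb : lo b = hi a by exact: val_inj.
have h : lo a != hi b by rewrite -val_eqE /= ba neq_ltn ltnW.
have hh : hi a != hi b by rewrite -val_eqE /= ba neq_ltn ltnSn.
rewrite -!tupactM; congr act; rewrite !mulgA.
have E (s s' : 'S_n) : (s^-1 = s -> s * s' * s = s' ^ s)%g by move=> {1}<-; rewrite conjgE mulgA.
rewrite !E ?spermV // /sperm !tpermJ lb tpermR tpermL !tpermD // 1?eq_sym //.
by rewrite lo_neq_hi.
Qed.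

(** Bundled as one multirule, which evaluates any word in two neighbouring transpositions at the
    three positions concerned. *)
Lemma act_triple (T : Type) a b : b = a.+1 :> nat ->
  ((lo b = hi a) *
  (((forall x : n.-tuple T, tnth (act (sperm a) x) (lo a) = tnth x (hi a)) *
  (forall x : n.-tuple T, tnth (act (sperm a) x) (hi a) = tnth x (lo a)) *
  (forall x : n.-tuple T, tnth (act (sperm a) x) (hi b) = tnth x (hi b))) *
  ((forall x : n.-tuple T, tnth (act (sperm b) x) (lo a) = tnth x (lo a)) *
  (forall x : n.-tuple T, tnth (act (sperm b) x) (hi a) = tnth x (hi b)) *
  (forall x : n.-tuple T, tnth (act (sperm b) x) (hi b) = tnth x (hi a)))))%type.
Proof.
move=> ba; have lb : lo b = hi a by exact: val_inj.
have h : lo a != hi b by rewrite -val_eqE /= ba neq_ltn ltnW.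
have hh : hi a != hi b by rewrite -val_eqE /= ba neq_ltn ltnSn.
split=> //; split; (split; first split) => x; rewrite ?act_lo ?act_hi //.
- by rewrite act_out 1?eq_sym.
- by rewrite act_out // lb lo_neq_hi.
- by rewrite -lb act_lo.
- by rewrite -lb.
Qed.

Lemma sorting_rcons2 w a b t : sorting (rcons (rcons w b) a) t =
  [&& (tnth t (hi a) < tnth t (lo a))%N,
      (tnth (sw a t) (hi b) < tnth (sw a t) (lo b))%N & sorting w (sw b (sw a t))].
Proof. by rewrite !sorting_rcons. Qed.

End CrossingWords.

(** * The elements N_t and how e, y and psi slide through them *)

Section CrossingElements.
Variables (A : comNzRingType) (d n : nat) (K : finType) (part : K -> 'I_d).
Variable (Q : K -> K -> {poly {poly A}}).
Hypothesis Q_part : forall k k' : K, part k != part k' -> Q k k' = 1.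
Variables (C : algOverType A) (e : n.-tuple K -> C) (y : 'I_n -> C).
Variables (psi : 'I_n.-1 -> C) (R : qHrels Q e y psi).
Implicit Types (t : n.-tuple 'I_d) (a b : 'I_n.-1) (w : seq 'I_n.-1) (k : n.-tuple K).
Local Notation sw a t := (act (sperm a) t).
Local Notation colour := (colour part).

Definition ecol t : C := \sum_(k | colour k == t) e k.
Definition psiw w : C := \prod_(a <- w) psi a.

Lemma ecol_e t k : ecol t * e k = if colour k == t then e k else 0.
Proof.
rewrite /ecol mulr_suml; case: eqP => kt.
  rewrite (bigD1 k) /=; last exact/eqP.
  rewrite (rel_idem R) eqxx big1 ?addr0 // => k' /andP[_ /negPf kk].
  by rewrite (rel_idem R) kk.
rewrite big1 // => k' /eqP k't; rewrite (rel_idem R); case: eqP => // kk.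
by case: kt; rewrite -kk.
Qed.

Lemma e_ecol t k : e k * ecol t = if colour k == t then e k else 0.
Proof.
rewrite /ecol mulr_sumr; case: eqP => kt.
  rewrite (bigD1 k) /=; last exact/eqP.
  rewrite (rel_idem R) eqxx big1 ?addr0 // => k' /andP[_ /negPf kk].
  by rewrite (rel_idem R) eq_sym kk.
rewrite big1 // => k' /eqP k't; rewrite (rel_idem R); case: eqP => // kk.
by case: kt; rewrite kk.
Qed.

Lemma ecol_idem t t' : ecol t * ecol t' = if t == t' then ecol t else 0.
Proof.
rewrite {2}/ecol mulr_sumr; case: eqP => [<-|tt].
  by apply: eq_bigr => k /eqP kt; rewrite ecol_e kt eqxx.
rewrite big1 // => k /eqP kt; rewrite ecol_e; case: eqP => // kt'.
by case: tt; rewrite -kt' -kt.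
Qed.

Lemma ecol2 t : ecol t * ecol t = ecol t.
Proof. by rewrite ecol_idem eqxx. Qed.

Lemma sum_ecol : \sum_t ecol t = 1.
Proof.
rewrite -(rel_sum1 R) [RHS](partition_big colour xpredT) //=.
Qed.

Lemma y_ecol i t : y i * ecol t = ecol t * y i.
Proof.
by rewrite /ecol mulr_sumr mulr_suml; apply: eq_bigr => k _; rewrite (rel_ye R).
Qed.

Lemma psi_ecol a t : psi a * ecol t = ecol (sw a t) * psi a.
Proof.
rewrite /ecol mulr_sumr mulr_suml [RHS](reindex (fun k => sw a k)) /=; last first.
  by exists (fun k => sw a k) => k _; exact: act_spermK.
apply: eq_big => [k|k _]; last by rewrite (rel_psie R).
by rewrite colour_act (inj_eq (inv_inj (act_spermK a))).
Qed.

Lemma ecol_ext (x x' : C) t :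
  (forall k, colour k = t -> x * e k = x' * e k) -> x * ecol t = x' * ecol t.
Proof.
by move=> H; rewrite /ecol !mulr_sumr; apply: eq_bigr => k /eqP; exact: H.
Qed.

Lemma neq_colour a k : tnth (colour k) (lo a) != tnth (colour k) (hi a) ->
  part (tnth k (lo a)) != part (tnth k (hi a)) /\ (tnth k (lo a) == tnth k (hi a)) = false.
Proof.
rewrite !tnth_colour => ne; split=> //; apply: contraNF ne => /eqP ->.
exact: eqxx.
Qed.

Lemma psi2_ecol a t : tnth t (lo a) != tnth t (hi a) -> psi a * psi a * ecol t = ecol t.
Proof.
move=> ne; rewrite -[RHS]mul1r; apply: ecol_ext => k kt; rewrite -kt in ne.
have [ne' _] := neq_colour ne.
by rewrite -expr2 (rel_psi2 R) Q_part // ev2_1.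
Qed.

(** The correction term compares two entries of [k], which differ because their colours do. *)
Lemma psiy_ecol a (i : 'I_n) t : tnth t (lo a) != tnth t (hi a) ->
  psi a * y i * ecol t = y (sperm a i) * psi a * ecol t.
Proof.
move=> ne; apply: ecol_ext => k kt; rewrite -kt in ne.
have [_ E] := neq_colour ne; rewrite /sperm.
have [->|il] := eqVneq i (lo a).
  by rewrite tpermL (rel_ySpsi R) E addr0.
have [->|ih] := eqVneq i (hi a).
  by rewrite tpermR (rel_psiyS R) E addr0.
by rewrite tpermD 1?eq_sym // (rel_psiy R).
Qed.

Lemma braid_ecol a b t : b = a.+1 :> nat -> tnth t (lo a) != tnth t (hi b) ->
  psi b * psi a * psi b * ecol t = psi a * psi b * psi a * ecol t.
Proof.
move=> ba ne; apply: ecol_ext => k kt; apply: (rel_braid_neq R) => //.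
by move=> E; move: ne; rewrite -kt !tnth_colour E eqxx.
Qed.

Lemma psiw_cons a w : psiw (a :: w) = psi a * psiw w.
Proof. exact: big_cons. Qed.

Lemma psiw_rcons w a : psiw (rcons w a) = psiw w * psi a.
Proof. by rewrite /psiw -cats1 big_cat big_seq1. Qed.

Lemma psiw_nil : psiw [::] = 1.
Proof. exact: big_nil. Qed.

Lemma psiw_ecol w t : psiw w * ecol t = ecol (wact w t) * psiw w.
Proof.
elim: w => [|a w IH] /=; first by rewrite psiw_nil mul1r mulr1.
by rewrite psiw_cons -mulrA IH mulrA psi_ecol mulrA.
Qed.

Lemma psiw_rconsE w a t :
  psiw (rcons w a) * ecol t = psiw w * ecol (sw a t) * psi a.
Proof. by rewrite psiw_rcons -!mulrA psi_ecol. Qed.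

(** The product collapses from the middle, one square [psi a * psi a] at a time. *)
Lemma psiw_revK w t : cpath w t -> psiw (rev w) * psiw w * ecol t = ecol t.
Proof.
elim: w t => [|a w IH] t /=; first by rewrite psiw_nil !mul1r.
move=> /andP[cw ne]; rewrite rev_cons psiw_rcons psiw_cons.
rewrite -!mulrA psiw_ecol !mulrA -(mulrA _ (psi a) (psi a)) -(mulrA _ (psi a * psi a)).
by rewrite psi2_ecol // -mulrA -psiw_ecol mulrA IH.
Qed.

(* Two descents either are far apart or involve three strands of decreasing
   colours, to which the braid relation without error term applies. *)
Lemma sorting_unique t w w' : sorting w t -> sorting w' t ->
  psiw w * ecol t = psiw w' * ecol t.
Proof.
elim/weight_ind: t w w' => t IH w w'.
have base a v : sorting (rcons v a) t -> sortedb t -> False.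
  rewrite sorting_rcons => /andP[D _] /forallP /(_ a).
  by rewrite leqNgt D.
case/lastP: w => [|w a]; case/lastP: w' => [|w' a'] //.
- by move=> /andP[_ S] /base; case.
- by move=> /base H /andP[_ /H].
rewrite !sorting_rcons => /andP[D Sw] /andP[D' Sw'].
(* Sorting words with the same last letter agree by induction; hence the rest of a word may be
   replaced by any other sorting word. *)
have IHa b : (tnth t (hi b) < tnth t (lo b))%N -> forall v v',
    sorting v (sw b t) -> sorting v' (sw b t) ->
    psiw (rcons v b) * ecol t = psiw (rcons v' b) * ecol t.
  by move=> Db v v' Sv Sv'; rewrite !psiw_rconsE (IH _ (weight_desc Db) v v').
have [aa|ne] := eqVneq a a'; first by subst a'; exact: IHa.
wlog : a a' w w' D D' Sw Sw' ne / (a < a')%N.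
  move=> H; have := ne; rewrite -val_eqE /= neq_ltn => /orP[aa|aa]; first exact: H.
  by apply/esym/H => //; rewrite eq_sym.
rewrite leq_eqVlt => /orP[/eqP aa|far].
- have T3 := act_triple 'I_d (esym aa); rewrite T3 in D'.
  (* A common continuation [u] closes the diamond: [w] and [w'] are replaced by words that sort the
     three strands in the two possible ways and then follow [u]. *)
  have [u Su] := sorting_exists (sw a (sw a' (sw a t))).
  have D2 := ltn_trans D' D.
  rewrite (IHa a D w (rcons (rcons u a) a')) // ?(IHa a' _ w' (rcons (rcons u a') a)) ?T3 //.
  + rewrite !psiw_rcons -!mulrA; congr (_ * _); rewrite !mulrA.
    by apply/esym/braid_ecol; rewrite // -val_eqE neq_ltn D2 orbT.
  + by rewrite sorting_rcons2 -act_braid // Su !T3 D2 D.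
  + by rewrite sorting_rcons2 Su !T3 D2 D'.
- have far' : (a.+1 < a')%N || (a'.+1 < a)%N by rewrite far.
  have [h1 h2 h3 h4] := sperm_far far'.
  have [u Su] := sorting_exists (sw a' (sw a t)).
  rewrite (IHa a D w (rcons u a')) // ?(IHa a' D' w' (rcons u a)) //.
  + by rewrite !psiw_rcons -!mulrA; congr (_ * _); rewrite !mulrA (rel_psipsi R far').
  + by rewrite sorting_rcons act_far // Su !act_out 1?eq_sym // D.
  + by rewrite sorting_rcons Su !act_out // D'.
Qed.

(** An arbitrary choice; by [sorting_unique] the element [crossing t] built from it, the N_t of the
    overview, does not depend on it. *)
Definition sword t := @xchoose _ (fun w => sorting w t) (sorting_exists t).
(* Locked, since otherwise matching x * y unfolds these products. *)
Fact product_key : unit. Proof. exact: tt. Qed.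
Definition crossing t : C := locked_with product_key (psiw (sword t) * ecol t).
Definition crossing_inv t : C := locked_with product_key (ecol t * psiw (rev (sword t))).

Lemma crossingE t : crossing t = psiw (sword t) * ecol t. Proof. exact: unlock. Qed.
Lemma crossing_invE t : crossing_inv t = ecol t * psiw (rev (sword t)). Proof. exact: unlock. Qed.

Lemma swordP t : sorting (sword t) t.
Proof. exact: (@xchooseP _ (fun w => sorting w t)). Qed.

Lemma crossing_ecol t : crossing t * ecol t = crossing t.
Proof. by rewrite crossingE -mulrA ecol2. Qed.

Lemma crossing_sorted t : nodesc t -> crossing t = ecol t.
Proof.
move=> /sortedbP S; rewrite crossingE (sorting_unique (w' := [::]) (swordP t)) ?psiw_nil ?mul1r //.
Qed.

Lemma crossing_desc a t : (tnth t (hi a) < tnth t (lo a))%N -> crossing t = crossing (sw a t) * psi a.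
Proof.
move=> D; rewrite !crossingE (sorting_unique (w' := rcons (sword (sw a t)) a) (swordP t)).
  by rewrite psiw_rconsE.
by rewrite sorting_rcons D swordP.
Qed.

(** At an ascent, [sw a t] has a descent at [a]; its descent rule is multiplied by [psi a], which
    squares to one on [ecol t]. *)
Lemma crossing_neq a t : tnth t (lo a) != tnth t (hi a) -> crossing t = crossing (sw a t) * psi a.
Proof.
move=> ne; have := ne; rewrite -val_eqE neq_ltn => /orP[D|D]; last exact: crossing_desc.
have E : crossing (sw a t) = crossing t * psi a.
  by rewrite (@crossing_desc a) ?act_spermK // act_lo act_hi.
have P : ecol t * (psi a * psi a) = ecol t.
  by rewrite -[RHS](psi2_ecol ne) -[RHS]mulrA psi_ecol [in RHS]mulrA psi_ecol act_spermK -mulrA.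
by rewrite E -[in RHS]crossing_ecol -!mulrA P crossing_ecol.
Qed.

(** The word may go up and down before it reaches the sorted sequence: [crossing_neq] strips its
    last letter in either case. *)
Lemma cpath_crossing w t : cpath w t -> nodesc (wact w t) -> psiw w * ecol t = crossing t.
Proof.
elim/last_ind: w t => [|w a IH] t; first by rewrite psiw_nil mul1r => _ /crossing_sorted ->.
rewrite cpath_rcons wact_rcons => /andP[ne cw] S.
by rewrite psiw_rconsE IH // -crossing_neq.
Qed.

Variable l : dcomp d n.

Lemma sword_tlam t : has_content l t -> wact (sword t) t = tlam l.
Proof.
move=> H; apply: nodesc_uniq; last exact: wact_content.
by apply/sortedbP; case/andP: (swordP t).
Qed.

Lemma crossing_inv_crossing t : crossing_inv t * crossing t = ecol t.
Proof.
have /andP[cw _] := swordP t.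
by rewrite crossing_invE crossingE -mulrA (mulrA (psiw _)) psiw_revK ?ecol2 //; exact: dpath_cpath.
Qed.

Lemma crossing_crossing_inv t : has_content l t -> crossing t * crossing_inv t = ecol (tlam l).
Proof.
move=> H; have /andP[cw _] := swordP t.
rewrite crossingE crossing_invE -mulrA (mulrA (ecol t)) ecol2.
have E : ecol t * psiw (rev (sword t)) = psiw (rev (sword t)) * ecol (tlam l).
  by rewrite psiw_ecol -(sword_tlam H) wact_revK.
rewrite E mulrA -{1}(revK (sword t)) psiw_revK // -(sword_tlam H).
exact/cpath_rev/dpath_cpath.
Qed.

Lemma ecol_crossing_inv t : ecol t * crossing_inv t = crossing_inv t.
Proof. by rewrite crossing_invE mulrA ecol2. Qed.

Lemma crossing_crossing_inv_neq t t' : t != t' -> crossing t * crossing_inv t' = 0.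
Proof.
by move=> /negPf tt; rewrite -crossing_ecol -ecol_crossing_inv mulrA -(mulrA (crossing t)) ecol_idem tt mulr0 mul0r.
Qed.

Lemma cpath_crossing_inv w t : has_content l t -> cpath w (tlam l) -> wact w (tlam l) = t ->
  psiw w * ecol (tlam l) = crossing_inv t.
Proof.
move=> H cw wt; have E : psiw (rev w) * ecol t = crossing t.
  rewrite -wt; apply: cpath_crossing; first exact: cpath_rev.
  by rewrite wact_revK; exact: tlam_nodesc.
rewrite -(crossing_crossing_inv H) -{1}E 2!mulrA -{1}(revK w) psiw_revK ?ecol_crossing_inv //.
by rewrite -wt; exact: cpath_rev.
Qed.

(** The position in [tlam l] at which the strand starting at [i] arrives once [t] is sorted. *)
Definition pos t (i : 'I_n) : nat := (offset l (tnth t i) + rk (tnth t i) t i)%N.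

Lemma pos_act a t i : tnth t (lo a) != tnth t (hi a) ->
  pos (sw a t) (sperm a i) = pos t i.
Proof.
by move=> ne; rewrite /pos tnth_act spermV /sperm tpermK rk_act_perm.
Qed.

Lemma crossing_y t (i i' : 'I_n) : has_content l t -> pos t i = i' ->
  crossing t * y i = y i' * crossing t.
Proof.
elim/weight_ind: t i => t IH i H p; have [S|/sortedbPn[a D]] := boolP (sortedb t).
  have {}S := elimT (sortedbP t) S; rewrite crossing_sorted //.
  rewrite /pos nodesc_pos // in p; rewrite (val_inj p); exact/esym/y_ecol.
have ne : tnth t (lo a) != tnth t (hi a) by rewrite -val_eqE neq_ltn D orbT.
rewrite -[in LHS]crossing_ecol -mulrA -y_ecol mulrA (crossing_desc D) -!mulrA (mulrA (psi a)).
rewrite psiy_ecol // mulrA mulrA (IH _ (weight_desc D)) ?pos_act //.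
  by rewrite -!mulrA (mulrA (crossing _)) -(crossing_desc D) crossing_ecol.
exact: act_content.
Qed.

(** A descent far from [a] commutes with [psi a]. A descent next to [a] moves a third strand past
    one of the two equally coloured ones; it is made to pass the other one too, and the braid
    relation, without error since the outer colours differ, replaces [psi a] by the psi at the
    descent. *)
Lemma crossing_psi t a (b : 'I_n.-1) : has_content l t ->
  tnth t (lo a) = tnth t (hi a) -> pos t (lo a) = b ->
  crossing t * psi a = psi b * crossing t.
Proof.
elim/weight_ind: t a => t IH a H E p; have [S|/sortedbPn[c D]] := boolP (sortedb t).
  have {}S := elimT (sortedbP t) S; rewrite crossing_sorted //.
  rewrite /pos nodesc_pos // in p; have -> : b = a by exact/val_inj.
  by rewrite psi_ecol act_id.
have ne : tnth t (lo c) != tnth t (hi c) by rewrite -val_eqE neq_ltn D orbT.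
have ca : c != a by apply: contraTneq ne => ->; rewrite E eqxx.
rewrite -[in LHS]crossing_ecol -mulrA -[t in ecol t](act_id E) -psi_ecol mulrA.
have [far|] := boolP ((c.+1 < a)%N || (a.+1 < c)%N).
  have [h1 h2 h3 h4] := sperm_far far.
  rewrite (crossing_desc D) -(mulrA (crossing _)) (rel_psipsi R far) mulrA.
  rewrite (IH _ (weight_desc D) a); first by rewrite -!mulrA (mulrA (crossing _)) -(crossing_desc D) crossing_ecol.
  - exact: act_content.
  - by rewrite !act_out.
  - by rewrite -p -[in RHS](pos_act (lo a) ne) /sperm tpermD // eq_sym.
rewrite negb_or -!leqNgt => /andP[ac ca'].
have [aS|cS] : a = c.+1 :> nat \/ c = a.+1 :> nat.
  move: ca; rewrite -val_eqE /= neq_ltn => /orP[lt|lt].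
    by left; apply/eqP; rewrite eqn_leq ac.
  by right; apply/eqP; rewrite eqn_leq ca'.
(* The colours at the three positions are (x, z, z) with z < x: the strand of colour x moves right
   past both. *)
- have T3 := act_triple 'I_d aS.
  have l2 : lo c != hi a by rewrite -val_eqE /= aS neq_ltn ltnW.
  rewrite T3 in E.
  have D2 : (tnth (sw c t) (hi a) < tnth (sw c t) (lo a))%N by rewrite !T3 -E.
  have ne2 : tnth (sw c t) (lo a) != tnth (sw c t) (hi a).
    by rewrite -val_eqE neq_ltn D2 orbT.
  have NN : crossing t = crossing (sw a (sw c t)) * psi a * psi c by rewrite -!crossing_desc.
  rewrite {1}NN -!mulrA (mulrA (psi a)) (mulrA (psi a * _)) braid_ecol //; last by rewrite -E.
  rewrite !mulrA (IH _ _ c); first by rewrite -!mulrA; congr (_ * _); rewrite !mulrA -NN crossing_ecol.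
  - exact: ltn_trans (weight_desc D2) (weight_desc D).
  - exact/act_content/act_content.
  - by rewrite !T3.
  - have E1 : sperm c (lo a) = lo c by rewrite T3 /sperm tpermR.
    have E2 : sperm a (lo c) = lo c.
      by rewrite /sperm tpermD // eq_sym // T3 lo_neq_hi.
    by rewrite -p -(pos_act (lo a) ne) E1 -(pos_act _ ne2) E2.
(* The mirror case: the colours are (z, z, x) with x < z, and the strand of colour x moves left past
   both. *)
- have T3 := act_triple 'I_d cS.
  have l2 : lo a != hi c by rewrite -val_eqE /= cS neq_ltn ltnW.
  have lo_c : lo c = hi a by rewrite T3.
  rewrite !T3 in D ne.
  have D' : (tnth t (hi c) < tnth t (lo c))%N by rewrite !T3.
  have ne' : tnth t (lo c) != tnth t (hi c) by rewrite !T3.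
  have D2 : (tnth (sw c t) (hi a) < tnth (sw c t) (lo a))%N by rewrite !T3 E.
  have ne2 : tnth (sw c t) (lo a) != tnth (sw c t) (hi a).
    by rewrite -val_eqE neq_ltn D2 orbT.
  have NN : crossing t = crossing (sw a (sw c t)) * psi a * psi c by rewrite -!crossing_desc.
  rewrite {1}NN -!mulrA (mulrA (psi a)) (mulrA (psi a * _)) -braid_ecol //; last by rewrite E.
  rewrite !mulrA (IH _ _ c); first by rewrite -!mulrA; congr (_ * _); rewrite !mulrA -NN crossing_ecol.
  - exact: ltn_trans (weight_desc D2) (weight_desc D').
  - exact/act_content/act_content.
  - by rewrite !T3.
  - have E1 : sperm c (lo a) = lo a.
      by rewrite /sperm tpermD // eq_sym // lo_c lo_neq_hi.
    have E2 : sperm a (lo a) = lo c by rewrite lo_c /sperm tpermL.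
    by rewrite -p -(pos_act (lo a) ne') E1 -(pos_act _ ne2) E2.
Qed.

(** Sorting the colours preserves all restrictions of [k], and [k'] is the only tuple of sorted
    colour with these restrictions. *)
Lemma crossing_e t k k' : has_content l t -> colour k = t -> colour k' = tlam l ->
  (forall j, kres part j k' = kres part j k) -> crossing t * e k = e k' * crossing t.
Proof.
elim/weight_ind: t k => t IH k H kt k't kk; have [S|/sortedbPn[a D]] := boolP (sortedb t).
  have {}S := elimT (sortedbP t) S; rewrite crossing_sorted //.
  have tt := nodesc_uniq S H.
  have -> : k' = k.
    apply: val_inj; apply: (kres_inj (part := part)) => //.
    by have := congr1 val (etrans k't (esym (etrans kt tt))).
  by rewrite ecol_e e_ecol kt.
have ne : tnth t (lo a) != tnth t (hi a) by rewrite -val_eqE neq_ltn D orbT.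
rewrite (crossing_desc D) -mulrA (rel_psie R) mulrA (IH _ (weight_desc D)) ?mulrA //.
- exact: act_content.
- by rewrite colour_act kt.
- by move=> j; rewrite kres_act_neq // -!tnth_colour kt.
Qed.

End CrossingElements.

(** * The matrix representation *)

Section Distribution.
Variables (R : pzRingType) (I : finType) (T_ : I -> finType).
Variable (F : forall i : I, T_ i -> R).

(** The summation ranges vary with [i], so the sums are moved to the tagged union of the ranges
    before the product is distributed. *)
Lemma prod_sum_fprod :
  \prod_(i : I) (\sum_(u : T_ i) F u) = \sum_(t : fprod T_) \prod_(i : I) F (t i).
Proof.
pose P i : {ffun T_ i -> R} := [ffun u => F u].
transitivity (\sum_(t : fprod T_) \prod_(i : I) P i (t i)); last first.
  by apply: eq_bigr => t _; apply: eq_bigr => i _; rewrite ffunE.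
rewrite [RHS](big_fprod 1 +%R P).
rewrite -(bigA_distr_big_dep (fun i j => tagged_with T_ i j) (fun i j => untag 0 (P i) j)).
apply: eq_bigr => i _.
rewrite -(big_tag (fun i => P i)) /=.
by apply: eq_bigr => u _; rewrite ffunE.
Qed.

End Distribution.

Section CommutingFamily.
Variables (A : comNzRingType) (d : nat) (B : 'I_d -> algOverType A).
Variables (H : algOverType A) (inj : forall j, {alghom B j -> H}).
Hypothesis injC : forall i j (x : B i) (y : B j), i != j ->
  inj i x * inj j y = inj j y * inj i x.
Implicit Types (j : 'I_d) (z : dprodalg B).

(** For [H] the tensor product and [inj] the inclusions of its factors this is [pure z], by
    [pure_prod]. *)
Definition inj_prod z : H := locked_with product_key (tens_lift_gen inj z).

Lemma inj_prodE z : inj_prod z = \prod_(i < d) inj i (z i). Proof. exact: unlock. Qed.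

Lemma inj_prodM z z' : inj_prod (z * z') = inj_prod z * inj_prod z'.
Proof. by rewrite /inj_prod !unlock; exact: tens_lift_genM. Qed.

Lemma inj_prod_in j (x : B j) : inj_prod (dfwith (1 : dprodalg B) x) = inj j x.
Proof. by rewrite /inj_prod unlock; exact: tens_lift_gen_tensin. Qed.

(** With [inj_prod_absorb], the device that lifts relations of one factor to [H]: all computation
    takes place in slot [j]. *)
Lemma inj_prod_comm j (x x' : B j) z z' : x * z j = z' j * x' ->
  (forall i, i != j -> z i = z' i) -> inj j x * inj_prod z = inj_prod z' * inj j x'.
Proof.
move=> xz zz; rewrite -!inj_prod_in -!inj_prodM; congr inj_prod.
apply: functional_extensionality_dep => i; rewrite !dprodalgM.
have [E|ij] := eqVneq i j; first by subst i; rewrite !dfwith_in.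
by rewrite !dfwith_out 1?eq_sym // !dprodalg1 mul1r mulr1 zz.
Qed.

Lemma inj_prod_absorb j (x x' : B j) z : x * z j = x' * z j ->
  inj j x * inj_prod z = inj j x' * inj_prod z.
Proof.
move=> xz; rewrite -!inj_prod_in -!inj_prodM; congr inj_prod.
apply: functional_extensionality_dep => i; rewrite !dprodalgM.
have [E|ij] := eqVneq i j; first by subst i; rewrite !dfwith_in.
by rewrite !dfwith_out 1?eq_sym.
Qed.

Lemma inj_prod0 j z : z j = 0 -> inj_prod z = 0.
Proof.
move=> z0; rewrite (_ : z = (dfwith (1 : dprodalg B) (0 : B j) : dprodalg B) * z).
  by rewrite inj_prodM inj_prod_in rmorph0 mul0r.
apply: functional_extensionality_dep => i; rewrite !dprodalgM.
have [E|ij] := eqVneq i j; first by subst i; rewrite !dfwith_in z0 mulr0.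
by rewrite !dfwith_out 1?eq_sym // dprodalg1 mul1r.
Qed.

Variables (n : nat) (l : dcomp d n) (K : finType) (part : K -> 'I_d).
Variable (Q : K -> K -> {poly {poly A}}).
Hypothesis Q_part : forall k k' : K, part k != part k' -> Q k k' = 1.
Local Notation m := (part_of l).
Local Notation colour := (colour part).
Local Notation kres := (kres part).
Local Notation sw a t := (act (sperm a) t).
Local Notation Kj := (Kj part).
Variables (e : forall j, (m j).-tuple (Kj j) -> B j) (y : forall j, 'I_(m j) -> B j).
Variables (psi : forall j, 'I_(m j).-1 -> B j).
Hypothesis R : forall j, qHrels (@Qj A d K part Q j) (@e j) (@y j) (@psi j).

(* Extended by 0, so that ranks and restrictions need no bounds. *)
Definition eN j (s : seq (Kj j)) : B j := oapp (@e j) 0 (insub s).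
Definition yN j (r : nat) : B j := oapp (@y j) 0 (insub r).
Definition psiN j (r : nat) : B j := oapp (@psi j) 0 (insub r).

Lemma eNE j (u : (m j).-tuple (Kj j)) : eN u = e u.
Proof. by rewrite /eN valK. Qed.
Lemma yNE j (i : 'I_(m j)) : yN j i = y i.
Proof. by rewrite /yN valK. Qed.
Lemma psiNE j (b : 'I_(m j).-1) : psiN j b = psi b.
Proof. by rewrite /psiN valK. Qed.

Definition e_prod (k : n.-tuple K) : H := inj_prod (fun j => eN (kres j k)).

Lemma kres_tuple k j : has_content l (colour k) ->
  {u : (m j).-tuple (Kj j) | tval u = kres j k}.
Proof.
move=> Hk; have sz : size (kres j k) == m j by rewrite size_kres; apply/eqP/Hk.
by exists (Tuple sz).
Qed.

(** Different tuples of the same colour differ in some restriction, and in that slot the two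
    idempotents are orthogonal. *)
Lemma e_prod_idem k k' : has_content l (colour k) -> colour k = colour k' ->
  e_prod k * e_prod k' = if k == k' then e_prod k else 0.
Proof.
move=> Hk kk'; rewrite /e_prod -inj_prodM; case: eqP => [<-|ne].
  congr inj_prod; apply: functional_extensionality_dep => j; rewrite dprodalgM.
  have [u uE] := kres_tuple j Hk.
  by rewrite -uE eNE (rel_idem (@R j)) eqxx.
have [j ne'] : exists j, kres j k != kres j k'.
  apply: contrapT => /forallNP H'; apply: ne; apply: val_inj.
  apply: (kres_inj (part := part)); first exact: (congr1 val kk').
  by move=> j; apply/eqP; apply: contrapT => /negP; exact: H'.
apply: (@inj_prod0 j); rewrite dprodalgM.
have [u uE] := kres_tuple j Hk.
have Hk' : has_content l (colour k') by rewrite -kk'.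
have [u' uE'] := kres_tuple j Hk'.
rewrite -uE -uE' !eNE (rel_idem (@R j)); case: eqP => // uu.
by rewrite -uE -uE' uu eqxx in ne'.
Qed.

Lemma e_prod_y k j r : has_content l (colour k) ->
  inj j (yN j r) * e_prod k = e_prod k * inj j (yN j r).
Proof.
move=> Hk; apply: inj_prod_comm => //; have [u <-] := kres_tuple j Hk.
rewrite eNE /yN; case: insubP => /= [i _ _|_]; first exact: (rel_ye (@R j)).
by rewrite mul0r mulr0.
Qed.

(** Neighbouring strands of colour [j] have consecutive ranks and hence are neighbours in the
    restriction as well; [b] is the rank of the left one. *)
Lemma neighbours k (a : 'I_n.-1) j : has_content l (colour k) ->
  part (tnth k (lo a)) = j -> part (tnth k (hi a)) = j ->
  exists (u : (m j).-tuple (Kj j)) (b : 'I_(m j).-1),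
  [/\ tval u = kres j k, rk j (colour k) (lo a) = b,
      val (tnth u (lo b)) = tnth k (lo a) & val (tnth u (hi b)) = tnth k (hi a)].
Proof.
move=> Hk ka kb; have [u uE] := kres_tuple j Hk.
have clo : tnth (colour k) (lo a) = j by rewrite tnth_colour.
have chi : tnth (colour k) (hi a) = j by rewrite tnth_colour.
have rhi : rk j (colour k) (hi a) = (rk j (colour k) (lo a)).+1.
  by have := rk_hi (colour k) a; rewrite clo.
have lt : (rk j (colour k) (lo a) < (m j).-1)%N.
  rewrite ltn_predRL -rhi -Hk -{1}chi -{1}chi; exact: rk_lt_count.
exists u, (Ordinal lt); split=> //.
- exact: (kres_tnth (i := lo a) uE).
- exact: (kres_tnth (i := hi a) uE).
Qed.

Lemma e_prod_psi k a j : has_content l (colour k) ->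
  part (tnth k (lo a)) = j -> part (tnth k (hi a)) = j ->
  inj j (psiN j (rk j (colour k) (lo a))) * e_prod k =
  e_prod (sw a k) * inj j (psiN j (rk j (colour k) (lo a))).
Proof.
move=> Hk ka kb; have [u [b [uE rE _ _]]] := neighbours Hk ka kb.
apply: inj_prod_comm => [|i ij].
  rewrite (kres_act_eq uE ka kb rE) -uE !eNE rE psiNE.
  exact: (rel_psie (@R j)).
by rewrite kres_act_out // ?ka ?kb eq_sym.
Qed.

Lemma e_prod_act_neq k a : part (tnth k (lo a)) != part (tnth k (hi a)) ->
  e_prod (sw a k) = e_prod k.
Proof.
move=> ne; congr inj_prod; apply: functional_extensionality_dep => j.
by rewrite kres_act_neq.
Qed.

Lemma e_prod_psiyS k a j : has_content l (colour k) ->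
  part (tnth k (lo a)) = j -> part (tnth k (hi a)) = j ->
  let r := rk j (colour k) (lo a) in
  inj j (psiN j r) * inj j (yN j r.+1) * e_prod k =
  (inj j (yN j r) * inj j (psiN j r) +
   (tnth k (lo a) == tnth k (hi a))%:R) * e_prod k.
Proof.
move=> Hk ka kb r; have [u [b [uE rE ua ub]]] := neighbours Hk ka kb.
rewrite -!rmorphM -(rmorph_nat (inj j)) -rmorphD; apply: inj_prod_absorb.
rewrite -uE eNE /r rE psiNE (yNE (lo b)) (yNE (hi b)) -ua -ub val_eqE.
exact: (rel_psiyS (@R j)).
Qed.

Lemma e_prod_ySpsi k a j : has_content l (colour k) ->
  part (tnth k (lo a)) = j -> part (tnth k (hi a)) = j ->
  let r := rk j (colour k) (lo a) in
  inj j (yN j r.+1) * inj j (psiN j r) * e_prod k =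
  (inj j (psiN j r) * inj j (yN j r) +
   (tnth k (lo a) == tnth k (hi a))%:R) * e_prod k.
Proof.
move=> Hk ka kb r; have [u [b [uE rE ua ub]]] := neighbours Hk ka kb.
rewrite -!rmorphM -(rmorph_nat (inj j)) -rmorphD; apply: inj_prod_absorb.
rewrite -uE eNE /r rE psiNE (yNE (lo b)) (yNE (hi b)) -ua -ub val_eqE.
exact: (rel_ySpsi (@R j)).
Qed.

Lemma e_prod_psi2 k a j : has_content l (colour k) ->
  part (tnth k (lo a)) = j -> part (tnth k (hi a)) = j ->
  let r := rk j (colour k) (lo a) in
  inj j (psiN j r) * inj j (psiN j r) * e_prod k =
  ev2 (Q (tnth k (lo a)) (tnth k (hi a))) (inj j (yN j r)) (inj j (yN j r.+1)) * e_prod k.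
Proof.
move=> Hk ka kb r; have [u [b [uE rE ua ub]]] := neighbours Hk ka kb.
rewrite -rmorphM -alghom_ev2; apply: inj_prod_absorb.
rewrite -uE eNE /r rE psiNE (yNE (lo b)) (yNE (hi b)) -ua -ub -expr2.
exact: (rel_psi2 (@R j)).
Qed.

(** Both braid relations of the factor at once: three neighbouring strands of colour [j] have ranks
    [r], [r.+1], [r.+2], and the error is present when the outer labels agree. *)
Lemma e_prod_braid k (a a' : 'I_n.-1) j : has_content l (colour k) -> a' = a.+1 :> nat ->
  part (tnth k (lo a)) = j -> part (tnth k (hi a)) = j -> part (tnth k (hi a')) = j ->
  let r := rk j (colour k) (lo a) in
  inj j (psiN j r.+1) * inj j (psiN j r) * inj j (psiN j r.+1) * e_prod k =
  inj j (psiN j r) * inj j (psiN j r.+1) * inj j (psiN j r) * e_prod k +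
  (if tnth k (lo a) == tnth k (hi a') then
     divdiff (Q (tnth k (lo a)) (tnth k (hi a))) (inj j (yN j r)) (inj j (yN j r.+1))
       (inj j (yN j r.+2)) * e_prod k else 0).
Proof.
move=> Hk aS ka kb kc r; have [u [b [uE rE ua ub]]] := neighbours Hk ka kb.
have lb : lo a' = hi a by exact: val_inj.
rewrite -lb in kb ub *; have [u' [b' [uE' rE' ua' ub']]] := neighbours Hk kb kc.
have uu : u' = u by apply: val_inj; exact: etrans uE' (esym uE).
subst u'; have bS : b' = b.+1 :> nat.
  have := rk_hi (colour k) a; rewrite tnth_colour ka -lb rE' rE => ->.
  by [].
have rS : r.+1 = b' by rewrite /r rE bS.
have rS2 : r.+2 = hi b' by rewrite /= -rS.
have hh : hi b = lo b' by apply: val_inj; rewrite /= bS.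
rewrite -!rmorphM; case: eqP => kk.
  rewrite -alghom_divdiff -mulrDl -rmorphD; apply: inj_prod_absorb.
  rewrite -uE eNE rS2 rS /r rE !psiNE (yNE (lo b)) (yNE (lo b')) (yNE (hi b')) mulrDl.
  have := @rel_braid_eq _ _ _ _ _ _ _ _ (@R j) b b' u bS.
  rewrite /Qj !hh ua ua' => -> //.
  by apply: val_inj; rewrite /= ua kk -ub'.
rewrite addr0; apply: inj_prod_absorb.
rewrite -uE eNE rS /r rE !psiNE; apply: (rel_braid_neq (@R j)) => // E.
by case: kk; rewrite -ua -ub' E.
Qed.

Lemma yN_comm j r r' : yN j r * yN j r' = yN j r' * yN j r.
Proof.
rewrite /yN; case: insubP => [i _ _|_]; last by rewrite mul0r mulr0.
case: insubP => [i' _ _|_]; last by rewrite mul0r mulr0.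
exact: (rel_yy (@R j)).
Qed.

Lemma psiN_yN j r r' : r' != r -> r' != r.+1 ->
  psiN j r * yN j r' = yN j r' * psiN j r.
Proof.
rewrite /yN /psiN; case: insubP => [b _ <-|_]; last by rewrite mul0r mulr0.
case: insubP => [i _ <- h1 h2|_]; last by rewrite mul0r mulr0.
exact: (rel_psiy (@R j)).
Qed.

Lemma psiN_psiN j r r' : (r.+1 < r')%N || (r'.+1 < r)%N ->
  psiN j r * psiN j r' = psiN j r' * psiN j r.
Proof.
rewrite /psiN; case: insubP => [b _ <-|_]; last by rewrite mul0r mulr0.
case: insubP => [i _ <- h1|_]; last by rewrite mul0r mulr0.
exact: (rel_psipsi (@R j)).
Qed.

(** [e_prod] depends only on the restrictions, so [t] may be sorted. For [tlam l] the tuples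
    correspond to families of restrictions through [concat], and the sum factors into the sums of
    the idempotents of each factor. *)
Lemma sum_e_prod t : has_content l t -> \sum_(k | colour k == t) e_prod k = 1.
Proof.
elim/weight_ind: t => t IH Ht; have [S|/sortedbPn[a D]] := boolP (sortedb t); last first.
  rewrite -[RHS](IH _ (weight_desc D)); last exact: act_content.
  rewrite [RHS](reindex (fun k => sw a k)) /=; last first.
    by exists (fun k => sw a k) => k _; exact: act_spermK.
  apply: eq_big => [k|k /eqP kt].
    by rewrite colour_act (inj_eq (inv_inj (act_spermK a))).
  by rewrite e_prod_act_neq // -!tnth_colour kt -val_eqE neq_ltn D orbT.
have {}S := elimT (sortedbP t) S; rewrite (nodesc_uniq S Ht) {S IH Ht t}.
pose h (t : fprod (fun j => (m j).-tuple (Kj j))) := concat (fun j => t j).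
have h_inj : injective h.
  move=> t t' tt; apply/fprodP => j; apply: val_inj.
  have E1 := kres_concat (fun j => t j) j; have E2 := kres_concat (fun j => t' j) j.
  exact: etrans (esym E1) (etrans (congr1 (fun k : n.-tuple K => kres j k) tt) E2).
transitivity (\sum_(t : fprod (fun j => (m j).-tuple (Kj j))) e_prod (h t)).
  rewrite -[RHS](big_imset e_prod (h := h) (A := predT)); last by move=> ? ? _ _; exact: h_inj.
  apply: eq_bigl => k; apply/eqP/imsetP => [kt|[t _ ->]]; last exact: colour_concat.
  have Hk : has_content l (colour k) by rewrite kt; exact: tlam_content.
  pose U j := sval (kres_tuple j Hk).
  exists [fprod j => U j] => //; apply: val_inj; apply: (kres_inj (part := part)).
    by have := congr1 val (etrans kt (esym (colour_concat (fun j => [fprod j => U j] j)))).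
  move=> j; rewrite (kres_concat (fun j => [fprod j => U j] j)) fprodE.
  by rewrite /U; case: (kres_tuple j Hk).
transitivity (\prod_(j < d) \sum_(u : (m j).-tuple (Kj j)) inj j (e u)).
  rewrite prod_sum_fprod; apply: eq_bigr => t _.
  rewrite /e_prod inj_prodE; apply: eq_bigr => j _.
  by rewrite (kres_concat (fun j => t j)) eNE.
by rewrite big1 // => j _; rewrite -rmorph_sum (rel_sum1 (@R j)) rmorph1.
Qed.


Definition y_coef (i : 'I_n) (t : n.-tuple 'I_d) : H :=
  inj (tnth t i) (yN (tnth t i) (rk (tnth t i) t i)).
Definition psi_coef (a : 'I_n.-1) (t : n.-tuple 'I_d) : H :=
  if tnth t (lo a) == tnth t (hi a) then
    inj (tnth t (lo a)) (psiN (tnth t (lo a)) (rk (tnth t (lo a)) t (lo a)))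
  else 1.

Local Notation J := (Jset l).
Definition mat_e (k : n.-tuple K) : 'Mat[H]_J := locked_with product_key
  (mono id (fun t : J => if colour k == sval t then e_prod k else 0)).
Definition mat_y (i : 'I_n) : 'Mat[H]_J := mono id (fun t : J => y_coef i (sval t)).
Definition mat_psi (a : 'I_n.-1) : 'Mat[H]_J :=
  mono (fun t : J => actJ (sperm a) t) (fun t : J => psi_coef a (sval t)).

Lemma mat_eE k : mat_e k = mono id (fun t : J => if colour k == sval t then e_prod k else 0).
Proof. exact: unlock. Qed.

Lemma mat_psi_mul (a b : 'I_n.-1) : mat_psi a * mat_psi b =
  mono ((fun t => actJ (sperm a) t) \o (fun t => actJ (sperm b) t))
    (fun t : J => psi_coef a (act (sperm b) (sval t)) * psi_coef b (sval t)).
Proof. by rewrite /mat_psi mono_mul. Qed.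

Lemma mat_psi_mul3 (a b c : 'I_n.-1) : mat_psi a * mat_psi b * mat_psi c =
  mono (((fun t => actJ (sperm a) t) \o (fun t => actJ (sperm b) t)) \o
         (fun t => actJ (sperm c) t))
    (fun t : J => psi_coef a (act (sperm b) (act (sperm c) (sval t))) *
       psi_coef b (act (sperm c) (sval t)) * psi_coef c (sval t)).
Proof. by rewrite mat_psi_mul [LHS]mono_mul. Qed.

(** Multiplication by [mat_e k] leaves only the column of the colour of [k]. The correction [D] is
    diagonal, so wherever it does not vanish the main terms have to be diagonal too. *)
Lemma mono_mat_e_add M M' M2 s s' x x' D k :
  M = mono s x -> M' = mono s' x' -> M2 = mono id D ->
  (forall t : J, colour k = sval t ->
     [/\ x t * e_prod k = x' t * e_prod k + D t * e_prod k, s t = s' t &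
         D t * e_prod k = 0 \/ s' t = t]) ->
  M * mat_e k = M' * mat_e k + M2 * mat_e k.
Proof.
move=> -> -> -> Hk; apply: entry_inj => t' t; rewrite entryD !mat_eE !mono_mul !mono_entry /=.
case: (colour k =P sval t) => [/Hk [-> -> [->|->]]|_].
- by rewrite addr0 if_same addr0.
- by case: eqP; rewrite ?addr0.
- by rewrite !mulr0 !if_same addr0.
Qed.

Lemma mono_mat_e M M' s s' x x' k : M = mono s x -> M' = mono s' x' ->
  (forall t : J, colour k = sval t -> x t * e_prod k = x' t * e_prod k /\ s t = s' t) ->
  M * mat_e k = M' * mat_e k.
Proof.
move=> -> -> Hk; apply: entry_inj => t' t; rewrite !mat_eE !mono_mul !mono_entry /=.
case: (colour k =P sval t) => [/Hk [-> ->]|_] //.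
by rewrite !mulr0 !if_same.
Qed.

Lemma mono_nat (r : nat) : mono id (fun _ : J => r%:R) = r%:R :> 'Mat[H]_J.
Proof.
apply: entry_inj => t' t; rewrite mono_entry.
by rewrite -(rmorph_nat (@alg A 'Mat[H]_J)) entry_alg rmorph_nat.
Qed.

Lemma actJ_id a (t : J) : tnth (sval t) (lo a) = tnth (sval t) (hi a) ->
  actJ (sperm a) t = t.
Proof. by move=> E; apply: val_inj; rewrite /= act_id. Qed.

Lemma Jbraid (a b : 'I_n.-1) (t : J) : b = a.+1 :> nat ->
  actJ (sperm b) (actJ (sperm a) (actJ (sperm b) t)) =
  actJ (sperm a) (actJ (sperm b) (actJ (sperm a) t)).
Proof. by move=> ba; apply: val_inj; exact/esym/act_braid. Qed.

Lemma y_coef_act a i (t : n.-tuple 'I_d) : tnth t (lo a) != tnth t (hi a) ->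
  y_coef (sperm a i) (sw a t) = y_coef i t.
Proof.
by move=> ne; rewrite /y_coef tnth_act spermV /sperm tpermK rk_act_perm.
Qed.

Lemma colourJ k (t : J) : colour k = sval t -> has_content l (colour k).
Proof. by move->; exact: JsetP. Qed.

Lemma sum_mat_e : \sum_k mat_e k = 1.
Proof.
apply: entry_inj => t' t; rewrite entry_sum -mono1 mono_entry.
under eq_bigr do rewrite !mat_eE mono_entry.
case: eqP => _; last by rewrite big1.
by rewrite -big_mkcond /= sum_e_prod //; exact: JsetP.
Qed.

Lemma mat_e_idem k k' : mat_e k * mat_e k' = if k == k' then mat_e k else 0.
Proof.
apply: entry_inj => t' t; rewrite !mat_eE mono_mul mono_entry /=.
have -> : entry (if k == k' then mono id (fun t : J => if colour k == sval t then e_prod k else 0)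
    else 0) t' t = if k == k' then if t' == t then (if colour k == sval t then e_prod k else 0) else 0 else 0.
  by case: (k == k'); rewrite ?mono_entry // /entry mxE.
case: (t' == t); last by rewrite if_same.
case: (colour k =P sval t) => [kt|_]; last by rewrite mul0r if_same.
case: (colour k' =P sval t) => [kt'|kt'].
  by rewrite e_prod_idem ?kt ?kt' //; exact: JsetP.
by rewrite mulr0; case: eqP => // kk; case: kt'; rewrite -kk.
Qed.

(** When strand [i] has the colour of an equally coloured pair at [a], its rank avoids both ranks of
    the pair by [rk_inj]; when the colours differ, the two coefficients lie in different factors. *)
Lemma mat_psi_y a i : i != lo a -> i != hi a -> mat_psi a * mat_y i = mat_y i * mat_psi a.
Proof.
move=> il ih; rewrite /mat_psi /mat_y !mono_mul; apply: mono_eq => t /=; split; last by left.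
rewrite {1}/psi_coef; case: eqP => E; last first.
  rewrite mul1r -(y_coef_act i (introN eqP E)) /sperm tpermD 1?eq_sym //.
  by rewrite /psi_coef (introF eqP E) mulr1.
rewrite /psi_coef E eqxx -E act_id // /y_coef.
have [ij|ij] := eqVneq (tnth (sval t) i) (tnth (sval t) (lo a)); last by rewrite injC // eq_sym.
rewrite ij -!rmorphM psiN_yN //.
  by apply: contra il => /eqP E'; apply/eqP/(@rk_inj _ _ (sval t)); rewrite ij.
rewrite -rk_hi; apply: contra ih => /eqP E'; apply/eqP/(@rk_inj _ _ (sval t)); rewrite ij //.
Qed.

Lemma psi_coef_far (a b : 'I_n.-1) (t : n.-tuple 'I_d) : (a.+1 < b)%N || (b.+1 < a)%N ->
  psi_coef a (sw b t) = psi_coef a t.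
Proof.
move=> far; have [h1 h2 h3 h4] := sperm_far far.
rewrite /psi_coef !act_out 1?eq_sym // rk_act //=.
by apply/eqP => E; case/orP: far; rewrite E ltnNge ?leqnSn ?leqnn // ltnW.
Qed.

Lemma mat_psi_far (a b : 'I_n.-1) : (a.+1 < b)%N || (b.+1 < a)%N -> mat_psi a * mat_psi b = mat_psi b * mat_psi a.
Proof.
move=> far; rewrite !mat_psi_mul; apply: mono_eq => t /=; split; last first.
  by left; apply: val_inj; rewrite /= act_far.
rewrite !psi_coef_far //; last by rewrite orbC.
have [h1 h2 h3 h4] := sperm_far far.
rewrite /psi_coef; case: eqP => E; last by rewrite mul1r mulr1.
case: eqP => E'; last by rewrite mul1r mulr1.
have [ij|ij] := eqVneq (tnth (sval t) (lo a)) (tnth (sval t) (lo b)); last by rewrite injC.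
rewrite ij -!rmorphM psiN_psiN //.
wlog : a b E E' ij far {h1 h2 h3 h4} / (a.+1 < b)%N.
  move=> H'; have := far => /orP[|] ab; first exact: H'.
  by rewrite orbC -ij; apply: H' => //; rewrite orbC.
(* The strand at [hi a] lies to the left of the one at [lo b] and has the same colour, so the ranks
   of the two pairs differ by more than one. *)
move=> ab; apply/orP; left; rewrite -ij -rk_hi E.
by apply: rk_lt.
Qed.

Lemma mat_psi_yS a k : mat_psi a * mat_y (hi a) * mat_e k =
  (mat_y (lo a) * mat_psi a + (tnth k (lo a) == tnth k (hi a))%:R) * mat_e k.
Proof.
rewrite mulrDl -mono_nat; apply: (mono_mat_e_add (mono_mul _ _ _ _) (mono_mul _ _ _ _) erefl) => t kt /=.
have Hk := colourJ kt; have [E|ne] := eqVneq (tnth (sval t) (lo a)) (tnth (sval t) (hi a)).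
  split; [|by []|by right; exact: actJ_id].
  rewrite act_id // /psi_coef /y_coef -E eqxx rk_hi -kt tnth_colour -mulrDl e_prod_psiyS //.
  by rewrite -!tnth_colour kt E.
have ne' := ne; rewrite -kt in ne'; have [_ kk] := neq_colour ne'.
rewrite kk mul0r; split; [|by []|by left].
rewrite addr0 /psi_coef (negPf ne) mul1r mulr1 -[in RHS](tpermR (lo a) (hi a)).
by rewrite (y_coef_act (hi a) ne).
Qed.

Lemma mat_yS_psi a k : mat_y (hi a) * mat_psi a * mat_e k =
  (mat_psi a * mat_y (lo a) + (tnth k (lo a) == tnth k (hi a))%:R) * mat_e k.
Proof.
rewrite mulrDl -mono_nat; apply: (mono_mat_e_add (mono_mul _ _ _ _) (mono_mul _ _ _ _) erefl) => t kt /=.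
have Hk := colourJ kt; have [E|ne] := eqVneq (tnth (sval t) (lo a)) (tnth (sval t) (hi a)).
  split; [|by []|by right; exact: actJ_id].
  rewrite act_id // /psi_coef /y_coef -E eqxx rk_hi -kt tnth_colour -mulrDl e_prod_ySpsi //.
  by rewrite -!tnth_colour kt E.
have ne' := ne; rewrite -kt in ne'; have [_ kk] := neq_colour ne'.
rewrite kk mul0r; split; [|by []|by left].
rewrite addr0 /psi_coef (negPf ne) mul1r mulr1 -[in LHS](tpermL (lo a) (hi a)).
by rewrite (y_coef_act (lo a) ne).
Qed.

Lemma mat_psi2 a k : mat_psi a ^+ 2 * mat_e k =
  ev2 (Q (tnth k (lo a)) (tnth k (hi a))) (mat_y (lo a)) (mat_y (hi a)) * mat_e k.
Proof.
rewrite expr2; apply: (mono_mat_e (mat_psi_mul _ _) (mono_ev2 _ _ _)) => t kt /=.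
have Hk := colourJ kt; split; last by apply: val_inj; rewrite /= act_spermK.
have [E|ne] := eqVneq (tnth (sval t) (lo a)) (tnth (sval t) (hi a)).
  rewrite act_id // /psi_coef /y_coef -E eqxx rk_hi -kt tnth_colour e_prod_psi2 //.
  by rewrite -!tnth_colour kt E.
have ne' := ne; rewrite -kt in ne'; have [ne2 _] := neq_colour ne'.
by rewrite /psi_coef act_lo act_hi eq_sym (negPf ne) mul1r Q_part // ev2_1.
Qed.

(** If three colours are not all equal, at most one pair of strands agrees. That pair meets once in
    either word and with the same rank, so both products have the same single nontrivial factor. *)
Lemma psi_coef_braid (a b : 'I_n.-1) (t : n.-tuple 'I_d) : b = a.+1 :> nat ->
  ~~ ((tnth t (lo a) == tnth t (hi a)) && (tnth t (hi a) == tnth t (hi b))) ->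
  psi_coef b (sw a (sw b t)) * psi_coef a (sw b t) * psi_coef b t =
  psi_coef a (sw b (sw a t)) * psi_coef b (sw a t) * psi_coef a t.
Proof.
move=> ba; have T3 := act_triple 'I_d ba.
have rkh j t' : rk j t' (hi a) = (rk j t' (lo a) + (tnth t' (lo a) == j))%N.
  exact: (rkS j t' (lo a)).
have rka j t' : rk j (sw a t') (lo a) = rk j t' (lo a).
  by rewrite rk_act //= neq_ltn ltnSn.
have rkb j t' : rk j (sw b t') (lo a) = rk j t' (lo a).
  by rewrite rk_act //= ba neq_ltn ltnW.
rewrite /psi_coef !T3 !rkh !rka !rkb !T3 ?rka ?rkb.
move: (tnth t (lo a)) (tnth t (hi a)) (tnth t (hi b)) => x u z.
have [E|xu] := eqVneq x u; first subst u.
  by have [E|xz] := eqVneq x z => //= _; rewrite ?eqxx ?addn0 ?mul1r ?mulr1.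
have [E|xz] := eqVneq x z => /= _; first subst z.
  by rewrite ?(eq_sym u x) ?(negPf xu) ?addn0 ?mul1r ?mulr1.
by have [E|uz] := eqVneq u z; rewrite ?addn0 ?mul1r ?mulr1.
Qed.

Lemma mat_psi_braid_neq (a b : 'I_n.-1) k : b = a.+1 :> nat -> tnth k (lo a) <> tnth k (hi b) ->
  mat_psi b * mat_psi a * mat_psi b * mat_e k = mat_psi a * mat_psi b * mat_psi a * mat_e k.
Proof.
move=> ba kk; apply: (mono_mat_e (mat_psi_mul3 _ _ _) (mat_psi_mul3 _ _ _)) => t kt /=.
have Hk := colourJ kt; split; last exact: Jbraid.
have [/andP[/eqP E1 /eqP E2]|ne] := boolP ((tnth (sval t) (lo a) == tnth (sval t) (hi a)) &&
  (tnth (sval t) (hi a) == tnth (sval t) (hi b))); last by rewrite psi_coef_braid.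
have lb : lo b = hi a by exact: val_inj.
have E3 : tnth (sval t) (lo b) = tnth (sval t) (hi b) by rewrite lb.
rewrite !(act_id E1, act_id E3) /psi_coef lb -E2 -E1 eqxx rk_hi -kt tnth_colour.
rewrite (e_prod_braid Hk ba) // -?tnth_colour ?kt ?E1 ?E2 //.
by rewrite (introF eqP kk) addr0.
Qed.

Lemma mat_psi_braid_eq (a b : 'I_n.-1) k : b = a.+1 :> nat -> tnth k (lo a) = tnth k (hi b) ->
  mat_psi b * mat_psi a * mat_psi b * mat_e k = mat_psi a * mat_psi b * mat_psi a * mat_e k +
  divdiff (Q (tnth k (lo a)) (tnth k (hi a))) (mat_y (lo a)) (mat_y (hi a)) (mat_y (hi b)) * mat_e k.
Proof.
move=> ba kk; apply: (mono_mat_e_add (mat_psi_mul3 _ _ _) (mat_psi_mul3 _ _ _) (mono_divdiff _ _ _ _)) => t kt /=.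
have Hk := colourJ kt.
have lb : lo b = hi a by exact: val_inj.
have E13 : tnth (sval t) (lo a) = tnth (sval t) (hi b) by rewrite -kt !tnth_colour kk.
(* Equal outer labels around a strand of another colour: Q is 1 there, so the divided difference
   vanishes. *)
have [E1|ne] := eqVneq (tnth (sval t) (lo a)) (tnth (sval t) (hi a)); last first.
  split; [|exact: Jbraid|left]; last first.
    by rewrite Q_part ?divdiff_1 ?mul0r // -!tnth_colour kt.
  rewrite psi_coef_braid // ?(negPf ne) // Q_part ?divdiff_1 ?mul0r ?addr0 //.
  by rewrite -!tnth_colour kt.
have E3 : tnth (sval t) (lo b) = tnth (sval t) (hi b) by rewrite lb -E1 E13.
have rk3 : rk (tnth (sval t) (lo a)) (sval t) (hi b) =
    (rk (tnth (sval t) (lo a)) (sval t) (lo a)).+2.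
  by rewrite -rk_hi E1 -lb -rk_hi.
split; [|exact: Jbraid|right]; last first.
  by apply: val_inj; rewrite /= !(act_id E1, act_id E3).
rewrite !(act_id E1, act_id E3) /psi_coef /y_coef lb -E13 -E1 eqxx rk3 rk_hi -kt tnth_colour.
by rewrite (e_prod_braid Hk ba) // -?tnth_colour ?kt // ?kk ?eqxx -?kk.
Qed.

Lemma mat_rels : qHrels Q mat_e mat_y mat_psi.
Proof.
split.
- exact: sum_mat_e.
- exact: mat_e_idem.
- move=> i k; rewrite /mat_y !mat_eE !mono_mul; apply: mono_eq => t /=; split; last by left.
  case: eqP => [kt|_]; last by rewrite mulr0 mul0r.
  by rewrite e_prod_y //; exact: (colourJ kt).
- move=> a k; rewrite /mat_psi !mat_eE !mono_mul; apply: mono_eq => t /=; split; last by left.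
  rewrite colour_act (inj_eq (inv_inj (act_spermK a))).
  case: eqP => [kt|_]; last by rewrite mulr0 mul0r.
  rewrite /psi_coef; case: eqP => E; last first.
    by rewrite mul1r mulr1 e_prod_act_neq // -!tnth_colour kt; exact/eqP.
  rewrite -kt tnth_colour e_prod_psi //; first exact: (colourJ kt).
  by rewrite -!tnth_colour kt -E.
- move=> i i'; rewrite /mat_y !mono_mul; apply: mono_eq => t /=; split; last by left.
  rewrite /y_coef; have [ij|ij] := eqVneq (tnth (sval t) i) (tnth (sval t) i'); last by rewrite injC.
  by rewrite ij -!rmorphM yN_comm.
- exact: mat_psi_y.
- exact: mat_psi_far.
- exact: mat_psi_yS.
- exact: mat_yS_psi.
- exact: mat_psi2.
- exact: mat_psi_braid_eq.
- exact: mat_psi_braid_neq.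
Qed.

End CommutingFamily.

Lemma act_sperm_eq (n : nat) (T : eqType) (a : 'I_n.-1) (x x' : n.-tuple T) :
  (act (sperm a) x == act (sperm a) x') = (x == x').
Proof. exact: (inj_eq (inv_inj (act_spermK a))). Qed.

Lemma tval_eqE (n : nat) (T : eqType) (x x' : n.-tuple T) :
  (tval x == tval x') = (x == x').
Proof. by []. Qed.

(** * The corner of the sorted colour sequence *)

Section CornerFactors.
Variables (A : comNzRingType) (d n : nat) (K : finType) (part : K -> 'I_d).
Variable (Q : K -> K -> {poly {poly A}}).
Variables (C : algOverType A) (e : n.-tuple K -> C) (y : 'I_n -> C).
Variables (psi : 'I_n.-1 -> C) (R : qHrels Q e y psi) (l : dcomp d n).
Local Notation m := (part_of l).
Local Notation colour := (colour part).
Local Notation kres := (kres part).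
Local Notation sw a t := (act (sperm a) t).
Local Notation Kj := (Kj part).
Local Notation E := (ecol part e (tlam l)).

Definition ecol_tlam_idem : E * E = E := ecol2 part R (tlam l).
Local Notation CC := (corner ecol_tlam_idem).

(** The commutation clause makes the relation stable under products, so that identities in the
    corner are verified on representatives in [C]. *)
Definition represents (x : CC) (X : C) := cval x = X * E /\ X * E = E * X.

Lemma repM x x' X X' : represents x X -> represents x' X' -> represents (x * x') (X * X').
Proof.
move=> [xX XE] [xX' XE']; split; first exact: corner_val_mul.
by rewrite -mulrA XE' mulrA XE mulrA.
Qed.

Lemma repD x x' X X' : represents x X -> represents x' X' -> represents (x + x') (X + X').
Proof.
move=> [xX XE] [xX' XE']; split; first by rewrite raddfD /= xX xX' mulrDl.
by rewrite mulrDl mulrDr XE XE'.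
Qed.

Lemma rep1 : represents 1 1. Proof. by split; rewrite mul1r ?mulr1. Qed.

Lemma rep_nat r : represents r%:R r%:R.
Proof.
elim: r => [|r IH]; first by split; rewrite ?raddf0 ?mul0r ?mulr0.
by rewrite !mulrSr; apply: repD IH rep1.
Qed.

Lemma rep_ev2 p x x' X X' : represents x X -> represents x' X' -> cval (ev2 p x x') = ev2 p X X' * E.
Proof. by move=> [? ?] [? ?]; exact: corner_val_ev2. Qed.

Lemma rep_divdiff p x x' x2 X X' X2 : represents x X -> represents x' X' -> represents x2 X2 ->
  cval (divdiff p x x' x2) = divdiff p X X' X2 * E.
Proof. by move=> [? ?] [? ?] [? ?]; exact: corner_val_divdiff. Qed.

Lemma rep_eq x x' X X' : represents x X -> represents x' X' -> X * E = X' * E -> x = x'.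
Proof. by move=> [xX _] [xX' _] XX; apply: cval_inj; rewrite xX xX'. Qed.

Variable j : 'I_d.
Implicit Types (u : (m j).-tuple (Kj j)) (b : 'I_(m j).-1) (i : 'I_(m j)).

Lemma shiftp_lo b : lo (shiftp b) = shift (lo b). Proof. exact: val_inj. Qed.
Lemma shiftp_hi b : hi (shiftp b) = shift (hi b).
Proof. by apply: val_inj; rewrite /= addnS. Qed.

Lemma tlam_shift i : tnth (tlam l) (shift i) = j.
Proof. exact: (nodesc_shift i (tlam_nodesc l) (tlam_content l)).1. Qed.
Lemma rk_shift i : rk j (tlam l) (shift i) = i.
Proof. exact: (nodesc_shift i (tlam_nodesc l) (tlam_content l)).2. Qed.

Lemma tlam_shiftp b :
  tnth (tlam l) (lo (shiftp b)) = tnth (tlam l) (hi (shiftp b)).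
Proof. by rewrite shiftp_lo shiftp_hi !tlam_shift. Qed.

Lemma tnth_shift k u i : colour k = tlam l -> kres j k = u ->
  val (tnth u i) = tnth k (shift i).
Proof.
move=> kt ku; apply: (kres_tnth (part := part) (esym ku)); last by rewrite kt rk_shift.
by rewrite -tnth_colour kt tlam_shift.
Qed.

(** What will be the image of the tensor with [e(u)] in slot [j] and [1] in all others: the
    restrictions to the other colours are summed over. *)
Definition block_e u : C := \sum_(k | (colour k == tlam l) && (kres j k == u :> seq _)) e k.

Lemma block_e_e u k : block_e u * e k =
  if (colour k == tlam l) && (kres j k == u :> seq _) then e k else 0.
Proof.
rewrite /block_e mulr_suml; case: ifPn => ku.
  rewrite (bigD1 k) //= (rel_idem R) eqxx big1 ?addr0 // => k' /andP[_ /negPf kk].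
  by rewrite (rel_idem R) kk.
rewrite big1 // => k' k'u; rewrite (rel_idem R); case: eqP => // kk.
by move: ku; rewrite -kk k'u.
Qed.

Lemma block_e_ext (x x' : C) u :
  (forall k, colour k = tlam l -> kres j k = u -> x * e k = x' * e k) ->
  x * block_e u = x' * block_e u.
Proof.
move=> H; rewrite /block_e !mulr_sumr; apply: eq_bigr => k /andP[/eqP kt /eqP ku].
exact: H.
Qed.

Lemma E_block_e u : E * block_e u = block_e u.
Proof.
rewrite -[RHS]mul1r; apply: block_e_ext => k kt _.
by rewrite (ecol_e part R) kt eqxx mul1r.
Qed.

Lemma block_e_E u : block_e u * E = block_e u.
Proof.
rewrite /block_e mulr_suml; apply: eq_bigr => k /andP[kt _].
by rewrite (e_ecol part R) kt.
Qed.

Definition cut_e u : CC := corner_cut ecol_tlam_idem (block_e u).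
Definition cut_y i : CC := corner_cut ecol_tlam_idem (y (shift i)).
Definition cut_psi b : CC := corner_cut ecol_tlam_idem (psi (shiftp b)).

Lemma cval_cut_e u : cval (cut_e u) = block_e u.
Proof. by rewrite /cval /= E_block_e block_e_E. Qed.

Lemma psi_E b : psi (shiftp b) * E = E * psi (shiftp b).
Proof. by rewrite (psi_ecol part R) act_id // tlam_shiftp. Qed.

Lemma rep_cut_y i : represents (cut_y i) (y (shift i)).
Proof.
split; last exact: (y_ecol part R).
by rewrite /cval /= -(y_ecol part R) -mulrA ecol_tlam_idem.
Qed.

Lemma rep_cut_psi b : represents (cut_psi b) (psi (shiftp b)).
Proof. by split; [rewrite /cval /= -psi_E -mulrA ecol_tlam_idem | exact: psi_E]. Qed.

Lemma rep_cut_e x X u : represents x X -> cval (x * cut_e u) = X * block_e u.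
Proof. by case=> xX _; rewrite corner_valM cval_cut_e xX -mulrA E_block_e. Qed.

Lemma val_cut_e x X u : cval x = X * E -> cval (x * cut_e u) = X * block_e u.
Proof. by move=> xX; rewrite corner_valM cval_cut_e xX -mulrA E_block_e. Qed.

(** [shift] sends neighbours to neighbours, and the labels of [k] at shifted positions are those of
    its restriction [u]; each relation is then the one of [C] tested on the summands [e k] of
    [block_e u]. *)
Lemma corner_rels : qHrels (@Qj A d K part Q j) cut_e cut_y cut_psi.
Proof.
have Rlo b u k : colour k = tlam l -> kres j k = u ->
    tnth k (lo (shiftp b)) = val (tnth u (lo b)).
  by move=> kt ku; rewrite shiftp_lo (tnth_shift _ kt ku).
have Rhi b u k : colour k = tlam l -> kres j k = u ->
    tnth k (hi (shiftp b)) = val (tnth u (hi b)).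
  by move=> kt ku; rewrite shiftp_hi (tnth_shift _ kt ku).
have repy := rep_cut_y; have repp := rep_cut_psi.
split.
- apply: cval_inj; rewrite raddf_sum corner_val1 /=.
  under eq_bigr do rewrite cval_cut_e.
  rewrite /block_e (exchange_big_dep (fun k => colour k == tlam l)) /=; last by move=> u k _ /andP[].
  apply: eq_bigr => k kt; have Hk : has_content l (colour k).
    by rewrite (eqP kt); exact: tlam_content.
  have [u uE] := kres_tuple j Hk; rewrite (big_pred1 u) // => u'.
  by rewrite kt -uE /= eq_sym.
- move=> u u'; apply: cval_inj; rewrite corner_valM !cval_cut_e {2}/block_e mulr_sumr.
  rewrite (_ : cval (if u == u' then cut_e u else 0) = if u == u' then block_e u else 0); last first.
    by case: eqP => _; rewrite ?cval_cut_e ?raddf0.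
  case: eqP => [<-|uu]; first by apply: eq_bigr => k ku; rewrite block_e_e ku.
  rewrite big1 // => k /andP[kt /eqP ku]; rewrite block_e_e kt ku /=; case: eqP => // vv.
  by case: uu; apply: val_inj.
- move=> i u; apply: cval_inj; rewrite !corner_valM !cval_cut_e (rep_cut_y i).1 -mulrA E_block_e.
  rewrite (y_ecol part R) mulrA block_e_E /block_e mulr_sumr mulr_suml.
  by apply: eq_bigr => k _; rewrite (rel_ye R).
- move=> b u; apply: cval_inj; rewrite !corner_valM !cval_cut_e (rep_cut_psi b).1 -mulrA E_block_e.
  rewrite psi_E mulrA block_e_E /block_e mulr_sumr mulr_suml.
  (* Both exchanged strands have colour [j], so the exchange preserves sorted colour and acts on the
     [j]-restriction by [sperm b]. *)
  rewrite [RHS](reindex (fun k => sw (shiftp b) k)); last first.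
    by exists (fun k => sw (shiftp b) k) => k _; exact: act_spermK.
  apply: eq_big => [k|k _]; last by rewrite (rel_psie R).
  rewrite colour_act -{2}(act_id (tlam_shiftp b)) act_sperm_eq.
  case: (colour k =P tlam l) => [kt|//]; rewrite !andTb.
  have Hk : has_content l (colour k) by rewrite kt; exact: tlam_content.
  have [v vE] := kres_tuple j Hk.
  rewrite (kres_act_eq (u := v) (b := b)) // -?tnth_colour ?kt ?shiftp_lo ?shiftp_hi ?tlam_shift ?rk_shift //.
  by rewrite -vE !tval_eqE act_sperm_eq.
- move=> i i'; apply: (rep_eq (repM (repy i) (repy i')) (repM (repy i') (repy i))).
  by rewrite (rel_yy R).
- move=> b i bl bh; apply: (rep_eq (repM (repp b) (repy i)) (repM (repy i) (repp b))).
  congr (_ * _); apply: (rel_psiy R).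
    by rewrite shiftp_lo; apply: contra bl => /eqP/(congr1 val)/addnI/val_inj ->.
  by rewrite shiftp_hi; apply: contra bh => /eqP/(congr1 val)/addnI/val_inj ->.
- move=> b b' bb; apply: (rep_eq (repM (repp b) (repp b')) (repM (repp b') (repp b))).
  congr (_ * _); apply: (rel_psipsi R); by rewrite /= -!addnS !leq_add2l.
- move=> b u; apply: cval_inj.
  rewrite (rep_cut_e u (repM (repp b) (repy (hi b)))).
  rewrite (rep_cut_e u (repD (repM (repy (lo b)) (repp b)) (rep_nat _))).
  apply: block_e_ext => k kt ku; rewrite -shiftp_hi -shiftp_lo (rel_psiyS R).
  by rewrite (Rlo b u k kt ku) (Rhi b u k kt ku) val_eqE.
- move=> b u; apply: cval_inj.
  rewrite (rep_cut_e u (repM (repy (hi b)) (repp b))).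
  rewrite (rep_cut_e u (repD (repM (repp b) (repy (lo b))) (rep_nat _))).
  apply: block_e_ext => k kt ku; rewrite -shiftp_hi -shiftp_lo (rel_ySpsi R).
  by rewrite (Rlo b u k kt ku) (Rhi b u k kt ku) val_eqE.
- move=> b u; apply: cval_inj.
  rewrite expr2 (rep_cut_e u (repM (repp b) (repp b))).
  rewrite (val_cut_e u (rep_ev2 _ (repy (lo b)) (repy (hi b)))).
  apply: block_e_ext => k kt ku; rewrite -expr2 (rel_psi2 R) shiftp_lo shiftp_hi.
  by rewrite -(tnth_shift _ kt ku) -(tnth_shift _ kt ku).
- move=> b b' u bS uu; apply: cval_inj.
  have sS : shiftp b' = (shiftp b).+1 :> nat by rewrite /= bS addnS.
  rewrite (rep_cut_e u (repM (repM (repp b') (repp b)) (repp b'))) raddfD /=.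
  rewrite (rep_cut_e u (repM (repM (repp b) (repp b')) (repp b))).
  rewrite (val_cut_e u (rep_divdiff _ (repy (lo b)) (repy (hi b)) (repy (hi b')))).
  rewrite -mulrDl; apply: block_e_ext => k kt ku; rewrite mulrDl.
  rewrite (rel_braid_eq R sS); last by rewrite (Rlo b u k kt ku) (Rhi b' u k kt ku) uu.
  by rewrite (Rlo b u k kt ku) (Rhi b u k kt ku) shiftp_lo !shiftp_hi.
- move=> b b' u bS uu; apply: cval_inj.
  have sS : shiftp b' = (shiftp b).+1 :> nat by rewrite /= bS addnS.
  rewrite (rep_cut_e u (repM (repM (repp b') (repp b)) (repp b'))).
  rewrite (rep_cut_e u (repM (repM (repp b) (repp b')) (repp b))).
  apply: block_e_ext => k kt ku; apply: (rel_braid_neq R sS).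
  by rewrite (Rlo b u k kt ku) (Rhi b' u k kt ku) => /val_inj.
Qed.

End CornerFactors.

Section CornerCommute.
Variables (A : comNzRingType) (d n : nat) (K : finType) (part : K -> 'I_d).
Variable (Q : K -> K -> {poly {poly A}}).
Variables (C : algOverType A) (e : n.-tuple K -> C) (y : 'I_n -> C).
Variables (psi : 'I_n.-1 -> C) (R : qHrels Q e y psi) (l : dcomp d n).
Local Notation m := (part_of l).
Local Notation sw a t := (act (sperm a) t).
Local Notation E := (ecol part e (tlam l)).
Local Notation cut_e := (cut_e R (l := l)).
Local Notation cut_y := (cut_y part R (l := l)).
Local Notation cut_psi := (cut_psi part R (l := l)).
Variables (i j : 'I_d).
Hypothesis ij : i != j.

Lemma cut_e_comm (u : (m i).-tuple (Kj part i)) (v : (m j).-tuple (Kj part j)) :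
  cut_e u * cut_e v = cut_e v * cut_e u.
Proof.
apply: cval_inj; rewrite !corner_valM !cval_cut_e.
have F (i' j' : 'I_d) (u' : (m i').-tuple (Kj part i')) (v' : (m j').-tuple (Kj part j')) :
    block_e e u' * block_e e v' = \sum_(k | [&& colour part k == tlam l, kres part i' k == u' :> seq _ &
      kres part j' k == v' :> seq _]) e k.
  rewrite {2}/block_e mulr_sumr [LHS]big_mkcond [RHS]big_mkcond; apply: eq_bigr => k _.
  by rewrite (block_e_e R); do 3!case: eqP => //=.
by rewrite !F; apply: eq_bigl => k; congr (_ && _); rewrite andbC.
Qed.

Lemma cut_e_cut_y (u : (m i).-tuple (Kj part i)) (b : 'I_(m j)) :
  cut_e u * cut_y b = cut_y b * cut_e u.
Proof.
apply: cval_inj; rewrite !corner_valM !cval_cut_e (rep_cut_y part R b).1 -[RHS]mulrA.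
rewrite (E_block_e R) (y_ecol part R) mulrA (block_e_E R) /block_e mulr_sumr mulr_suml.
by apply: eq_bigr => k _; rewrite (rel_ye R).
Qed.

Lemma cut_e_cut_psi (u : (m i).-tuple (Kj part i)) (b : 'I_(m j).-1) :
  cut_e u * cut_psi b = cut_psi b * cut_e u.
Proof.
apply: cval_inj; rewrite !corner_valM !cval_cut_e (rep_cut_psi part R b).1 -[RHS]mulrA.
rewrite (E_block_e R) (psi_E part R) mulrA (block_e_E R) /block_e mulr_sumr mulr_suml.
rewrite [LHS](reindex (fun k => sw (shiftp b) k)) /=; last first.
  by exists (fun k => sw (shiftp b) k) => k _; exact: act_spermK.
apply: eq_big => [k|k _]; last by rewrite (rel_psie R).
rewrite colour_act -{1}(act_id (tlam_shiftp b)) act_sperm_eq.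
case: (colour part k =P tlam l) => //= kt.
by rewrite kres_act_out // -tnth_colour kt ?shiftp_lo ?shiftp_hi tlam_shift eq_sym.
Qed.

Lemma cut_y_comm (b : 'I_(m i)) (b' : 'I_(m j)) : cut_y b * cut_y b' = cut_y b' * cut_y b.
Proof.
have rb := rep_cut_y part R b; have rb' := rep_cut_y part R b'.
by apply: (rep_eq (repM rb rb') (repM rb' rb)); rewrite (rel_yy R).
Qed.

Lemma cut_y_cut_psi (b : 'I_(m i)) (b' : 'I_(m j).-1) : cut_y b * cut_psi b' = cut_psi b' * cut_y b.
Proof.
have rb := rep_cut_y part R b; have rb' := rep_cut_psi part R b'.
apply: (rep_eq (repM rb rb') (repM rb' rb)); congr (_ * _); apply/esym/(rel_psiy R).
  apply: contra_neq ij => E; rewrite -(tlam_shift b) E shiftp_lo.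
  exact: tlam_shift.
apply: contra_neq ij => E; rewrite -(tlam_shift b) E shiftp_hi.
exact: tlam_shift.
Qed.

Lemma cut_psi_comm (b : 'I_(m i).-1) (b' : 'I_(m j).-1) : cut_psi b * cut_psi b' = cut_psi b' * cut_psi b.
Proof.
have rb := rep_cut_psi part R b; have rb' := rep_cut_psi part R b'.
apply: (rep_eq (repM rb rb') (repM rb' rb)); congr (_ * _); apply: (rel_psipsi R) => /=.
(* Both strands exchanged inside block [i'] lie before its end, hence strictly before the first
   strand of any later block. *)
have H (i' j' : 'I_d) (c : 'I_(m i').-1) (c' : 'I_(m j').-1) : (i' < j')%N ->
    ((offset l i' + c).+1 < offset l j' + c')%N.
  move=> lt; apply: (@leq_trans (offset l j')); last exact: leq_addr.
  apply: leq_trans (offset_mono l lt).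
  by rewrite -!addnS leq_add2l; have := ltn_ord c; rewrite ltn_predRL.
have := ij; rewrite -val_eqE neq_ltn => /orP[lt|lt]; apply/orP; [left|right]; exact: H.
Qed.

End CornerCommute.

(** The induction principle [qH_ind] as a property of given elements, so that it can be assumed of
    an abstract algebra. *)
Definition qH_generated (A : comNzRingType) (K : finType) (n : nat) (B : algOverType A)
    (e : n.-tuple K -> B) (y : 'I_n -> B) (psi : 'I_n.-1 -> B) :=
  forall P : B -> Prop,
  (forall a, P (alg a)) -> (forall k, P (e k)) ->
  (forall a, P (y a)) -> (forall a, P (psi a)) ->
  (forall u v, P u -> P v -> P (u + v)) ->
  (forall u v, P u -> P v -> P (u * v)) -> forall z, P z.

Section GeneratedCommute.
Variables (A : comNzRingType) (K : finType) (n : nat) (B D : algOverType A).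
Variables (e : n.-tuple K -> B) (y : 'I_n -> B) (psi : 'I_n.-1 -> B).
Hypothesis G : qH_generated e y psi.
Variables (g : {alghom B -> D}) (x : D).

Lemma generated_comm :
  (forall k, x * g (e k) = g (e k) * x) -> (forall a, x * g (y a) = g (y a) * x) ->
  (forall a, x * g (psi a) = g (psi a) * x) -> forall z, x * g z = g z * x.
Proof.
move=> He Hy Hp; apply: G => // [a|u v Hu Hv|u v Hu Hv].
- by rewrite alg_homE algC.
- by rewrite rmorphD mulrDl mulrDr Hu Hv.
- by rewrite rmorphM mulrA Hu -mulrA Hv mulrA.
Qed.

End GeneratedCommute.

Section CornerLift.
Variables (A : comNzRingType) (d n : nat) (K : finType) (part : K -> 'I_d).
Variable (Q : K -> K -> {poly {poly A}}).
Variables (C : algOverType A) (e : n.-tuple K -> C) (y : 'I_n -> C).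
Variables (psi : 'I_n.-1 -> C) (R : qHrels Q e y psi) (l : dcomp d n).
Local Notation m := (part_of l).
Local Notation Kj := (Kj part).
Variables (B : 'I_d -> algOverType A) (ej : forall j, (m j).-tuple (Kj j) -> B j).
Variables (yj : forall j, 'I_(m j) -> B j) (psij : forall j, 'I_(m j).-1 -> B j).
Hypothesis Bgen : forall j, qH_generated (@ej j) (@yj j) (@psij j).
Variable g : forall j, {alghom B j -> corner (ecol_tlam_idem part R l)}.
Hypothesis g_e : forall j u, g j (@ej j u) = cut_e R u.
Hypothesis g_y : forall j i, g j (@yj j i) = cut_y part R i.
Hypothesis g_psi : forall j b, g j (@psij j b) = cut_psi part R b.

(** Generation is used once for each factor, which leaves nine pairs of generators. *)
Lemma corner_factorC i j (x : B i) (z : B j) : i != j ->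
  g i x * g j z = g j z * g i x.
Proof.
move=> ij; have ji : j != i by rewrite eq_sym.
apply: (generated_comm (@Bgen j)) => [k|a|a]; rewrite ?g_e ?g_y ?g_psi;
  apply/esym; apply: (generated_comm (@Bgen i)) => [k'|a'|a'];
  rewrite ?g_e ?g_y ?g_psi.
- exact: cut_e_comm.
- exact: cut_e_cut_y.
- exact: cut_e_cut_psi.
- exact/esym/cut_e_cut_y.
- exact: cut_y_comm.
- exact: cut_y_cut_psi.
- exact/esym/cut_e_cut_psi.
- exact/esym/cut_y_cut_psi.
- exact: cut_psi_comm.
Qed.

End CornerLift.

(** * The map f and its interplay with Psi_lambda *)

Section MatrixUnits.
Variables (A : comNzRingType) (d n : nat) (K : finType) (part : K -> 'I_d).
Variable (Q : K -> K -> {poly {poly A}}).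
Hypothesis Q_part : forall k k' : K, part k != part k' -> Q k k' = 1.
Variables (C : algOverType A) (e : n.-tuple K -> C) (y : 'I_n -> C).
Variables (psi : 'I_n.-1 -> C) (R : qHrels Q e y psi) (l : dcomp d n).
Hypothesis Cgen : qH_generated e y psi.
Local Notation m := (part_of l).
Local Notation Kj := (Kj part).
Local Notation colour := (colour part).
Local Notation kres := (kres part).
Local Notation sw a t := (act (sperm a) t).
Local Notation J := (Jset l).
Local Notation ecol := (ecol part e).
Local Notation E := (ecol (tlam l)).
Local Notation crossing := (crossing part e psi).
Local Notation crossing_inv := (crossing_inv part e psi).
Variables (B : 'I_d -> algOverType A) (ej : forall j, (m j).-tuple (Kj j) -> B j).
Variables (yj : forall j, 'I_(m j) -> B j) (psij : forall j, 'I_(m j).-1 -> B j).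
Hypothesis Bgen : forall j, qH_generated (@ej j) (@yj j) (@psij j).
Hypothesis Rj : forall j, qHrels (@Qj A d K part Q j) (@ej j) (@yj j) (@psij j).
Variables (H : algOverType A) (inj : forall j, {alghom B j -> H}).
Hypothesis injC : forall i j (x : B i) (z : B j), i != j ->
  inj i x * inj j z = inj j z * inj i x.
Hypothesis Hgen : forall P : H -> Prop,
  (forall a, P (alg a)) -> (forall j (x : B j), P (inj j x)) ->
  (forall u v, P u -> P v -> P (u + v)) ->
  (forall u v, P u -> P v -> P (u * v)) -> forall z, P z.
Variable T : {alghom C -> 'Mat[H]_J}.
Hypothesis T_e : forall k, T (e k) = mat_e inj ej k.
Hypothesis T_y : forall i, T (y i) = mat_y inj yj i.
Hypothesis T_psi : forall a, T (psi a) = mat_psi inj psij a.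
Variable L : {alghom H -> corner (ecol_tlam_idem part R l)}.
Hypothesis L_e : forall j u, L (inj j (@ej j u)) = cut_e R u.
Hypothesis L_y : forall j i, L (inj j (@yj j i)) = cut_y part R i.
Hypothesis L_psi : forall j b, L (inj j (@psij j b)) = cut_psi part R b.
Implicit Types (t : J) (k : n.-tuple K).

Definition embed (z : H) : C := cval (L z).

Lemma embedD z z' : embed (z + z') = embed z + embed z'.
Proof. by rewrite /embed !rmorphD. Qed.
Lemma embedM z z' : embed (z * z') = embed z * embed z'.
Proof. by rewrite /embed rmorphM corner_valM. Qed.
Lemma embed0 : embed 0 = 0.
Proof. by rewrite /embed !raddf0. Qed.
Lemma embed1 : embed 1 = E.
Proof. by rewrite /embed rmorph1. Qed.
Lemma embed_sum (I : Type) (r : seq I) (P : pred I) (F : I -> H) :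
  embed (\sum_(i <- r | P i) F i) = \sum_(i <- r | P i) embed (F i).
Proof. by rewrite /embed !raddf_sum. Qed.
Lemma embed_alg a : embed (alg a) = alg a * E.
Proof. by rewrite /embed alg_homE. Qed.
Lemma embedE z : embed z * E = embed z.
Proof. exact: corner_er. Qed.
Lemma Eembed z : E * embed z = embed z.
Proof. exact: corner_el. Qed.
Lemma embed_y j i : embed (inj j (yj i)) = y (shift i) * E.
Proof. by rewrite /embed L_y; exact: (rep_cut_y part R i).1. Qed.
Lemma embed_psi j b : embed (inj j (psij (j := j) b)) = psi (shiftp b) * E.
Proof. by rewrite /embed L_psi; exact: (rep_cut_psi part R b).1. Qed.
Lemma embed_e j u : embed (inj j (ej (j := j) u)) = block_e e u.
Proof. by rewrite /embed L_e cval_cut_e. Qed.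

(** Each [block_e] prescribes one restriction. A tuple of sorted colour is determined by all of
    them, so the product of the blocks is the single idempotent [e k']. *)
Lemma embed_e_prod k k' : has_content l (colour k) -> colour k' = tlam l ->
  (forall j, kres j k' = kres j k) -> embed (e_prod inj ej k) = e k'.
Proof.
move=> Hk k't kk.
have P (s : seq 'I_d) k2 : colour k2 = tlam l ->
    embed (\prod_(j <- s) inj j (eN ej (kres j k))) * e k2 =
    if all (fun j => kres j k2 == kres j k) s then e k2 else 0.
  move=> k2t; elim: s => [|j s IH].
    by rewrite big_nil embed1 (ecol_e part R) k2t eqxx.
  have [u uE] := kres_tuple j Hk.
  rewrite big_cons embedM -mulrA IH /= -uE eNE embed_e.
  case: all; last by rewrite mulr0 andbF.
  by rewrite (block_e_e R) k2t eqxx andbT.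
rewrite /e_prod inj_prodE -[LHS]embedE /ecol mulr_sumr.
rewrite (bigD1 k') /= ?k't ?eqxx // P // big1 ?addr0.
  by rewrite (introT allP) // => j _; rewrite kk eqxx.
move=> k2 /andP[/eqP k2t /negP k2k]; rewrite P //; case: allP => // Hk2.
case: k2k; apply/eqP/val_inj/(kres_inj (part := part)).
  by have := congr1 val (etrans k2t (esym k't)).
by move=> j; rewrite kk; apply/eqP/Hk2; rewrite mem_index_enum.
Qed.

Lemma sorted_tuple k : has_content l (colour k) ->
  exists2 k' : n.-tuple K, colour k' = tlam l & forall j, kres j k' = kres j k.
Proof.
move=> Hk; exists (concat (fun j => sval (kres_tuple j Hk))).
  exact: colour_concat.
by move=> j; rewrite (kres_concat (fun j => sval (kres_tuple j Hk)) j); case: (kres_tuple j Hk).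
Qed.

Lemma insert_ecol (a x x' b : C) :
  a * (x * x') * b = \sum_(r : n.-tuple 'I_d) a * x * ecol r * (ecol r * x' * b).
Proof.
have -> : a * (x * x') * b = a * x * 1 * (x' * b) by rewrite mulr1 !mulrA.
rewrite -(sum_ecol part R) big_distrr /= big_distrl /=; apply: eq_bigr => r _.
by rewrite -[in LHS](ecol2 part R r) !mulrA.
Qed.

(** This is the centrality of e(lambda): generators only permute the colours, and products are split
    by inserting the sum of all [ecol r]. *)
Lemma ecol_block (x : C) (t s : n.-tuple 'I_d) : ~~ perm_eq t s -> ecol t * x * ecol s = 0.
Proof.
have neq (t' s' : n.-tuple 'I_d) : ~~ perm_eq t' s' -> (t' == s') = false.
  by apply: contraNF => /eqP ->; exact: perm_refl.
elim/Cgen: x t s => [a|k|i|a|x x' IH IH'|x x' IH IH'] t s ts.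
- by rewrite -algC -mulrA (ecol_idem part R) neq // mulr0.
- rewrite -mulrA (e_ecol part R); case: eqP => [kt|_]; last by rewrite mulr0.
  by rewrite (ecol_e part R) kt; case: eqP => // E'; rewrite -E' perm_refl in ts.
- by rewrite -(y_ecol part R) -mulrA (ecol_idem part R) neq // mulr0.
- rewrite -mulrA (psi_ecol part R) mulrA (ecol_idem part R) neq ?mul0r //.
  by rewrite (permPr (perm_act _ _)).
- by rewrite mulrDr mulrDl IH // IH' // addr0.
- rewrite insert_ecol big1 // => r _.
  have [tr|tr] := boolP (perm_eq t r); last by rewrite IH // mul0r.
  by rewrite IH' ?mulr0 // -(permPl tr).
Qed.

Lemma crossing_block (x : C) t (s : n.-tuple 'I_d) : ~ has_content l s ->
  crossing (sval t) * x * ecol s = 0.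
Proof.
move=> Hs; rewrite -(crossing_ecol part R) -2!mulrA (mulrA (ecol _)) ecol_block ?mulr0 //.
by apply/negP => /(elimT seq.permP) ts; apply: Hs => j; rewrite -ts; exact: JsetP.
Qed.

Lemma sum_Jset (V : zmodType) (F : n.-tuple 'I_d -> V) :
  (forall s, ~ has_content l s -> F s = 0) -> \sum_s F s = \sum_(t : J) F (sval t).
Proof.
move=> F0; rewrite (bigID (fun s : n.-tuple 'I_d => [forall j, count_mem j s == m j])) /= [X in _ + X]big1 ?addr0.
  rewrite (reindex_omap (val : J -> _) insub) /= => [|s Hs]; last by rewrite insubT.
  by apply: eq_bigl => t; rewrite valK eqxx (valP t).
move=> s /forallPn[j /eqP Hj]; apply: F0 => Hs; exact: Hj.
Qed.

Lemma entry_embed (x : C) (t' t : J) :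
  embed (entry (T x) t' t) = crossing (sval t') * x * crossing_inv (sval t).
Proof.
elim/Cgen: x t' t => [a|k|i|a|x x' IH IH'|x x' IH IH'] t' t.
- rewrite alg_homE entry_alg -algC -mulrA; case: eqP => [->|/eqP ne].
    by rewrite embed_alg (crossing_crossing_inv Q_part R (JsetP t)).
  by rewrite (crossing_crossing_inv_neq part R) ?mulr0 ?embed0.
- rewrite T_e mat_eE mono_entry; case: (colour k =P sval t) => kt; last first.
    rewrite if_same embed0 -(ecol_crossing_inv part R) -mulrA (mulrA (e k)) (e_ecol part R).
    by rewrite (introF eqP kt) mul0r mulr0.
  case: eqP => [->|/eqP ne]; last first.
    rewrite embed0 -(crossing_ecol part R) -(mulrA _ _ (e k)) (ecol_e part R) kt.
    by rewrite eq_sym (negPf (ne : sval t' != sval t)) mulr0 mul0r.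
  have Hk := colourJ kt; have [k' k't kk] := sorted_tuple Hk.
  rewrite (embed_e_prod Hk k't kk) (crossing_e R (JsetP t) kt k't kk) -mulrA.
  by rewrite (crossing_crossing_inv Q_part R (JsetP t)) (e_ecol part R) k't eqxx.
- rewrite T_y mono_entry; case: eqP => [->|/eqP ne]; last first.
    rewrite embed0 -(crossing_ecol part R) -(ecol_crossing_inv part R) -!mulrA (mulrA (y i)).
    rewrite (y_ecol part R) -mulrA (mulrA (ecol _) (ecol _)) (ecol_idem part R).
    by rewrite (negPf (ne : sval t' != sval t)) mul0r mulr0.
  have lt : (rk (tnth (sval t) i) (sval t) i < m (tnth (sval t) i))%N.
    by rewrite -(JsetP t); exact: rk_lt_count.
  rewrite /y_coef (yNE yj (Ordinal lt)) embed_y.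
  rewrite (crossing_y part R (i' := shift (Ordinal lt)) (JsetP t)) // -mulrA.
  by rewrite (crossing_crossing_inv Q_part R (JsetP t)).
- rewrite T_psi mono_entry; case: eqP => [->|/eqP ne]; last first.
    rewrite embed0 -(crossing_ecol part R) -(ecol_crossing_inv part R) -!mulrA (mulrA (psi a)).
    rewrite (psi_ecol part R) -mulrA (mulrA (ecol _) (ecol _)) (ecol_idem part R).
    by rewrite (negPf (ne : sval t' != act (sperm a) (sval t))) mul0r mulr0.
  rewrite /psi_coef /=; have [aE|ne] := eqVneq (tnth (sval t) (lo a)) (tnth (sval t) (hi a)); last first.
    by rewrite embed1 -(crossing_neq Q_part R) // (crossing_crossing_inv Q_part R (JsetP t)).
  rewrite act_id //; set j := tnth (sval t) (lo a).
  have lt : (rk j (sval t) (lo a) < (m j).-1)%N.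
    rewrite ltn_predRL -rk_hi /j aE -(JsetP t); exact: rk_lt_count.
  rewrite (psiNE psij (Ordinal lt)) embed_psi.
  rewrite (crossing_psi part R (b := shiftp (Ordinal lt)) (JsetP t) aE) // -mulrA.
  by rewrite (crossing_crossing_inv Q_part R (JsetP t)).
- by rewrite rmorphD entryD embedD IH IH' mulrDr mulrDl.
(* The matrix product sums over sequences of content [l] only; the other intermediate sequences
   contribute zero, and at each [s] of content [l] the idempotent is N_s^-1 N_s. *)
- rewrite rmorphM entryM embed_sum insert_ecol [RHS]sum_Jset => [|s Hs]; last first.
    by rewrite crossing_block // mul0r.
  apply: eq_bigr => s _; rewrite embedM IH IH' -!mulrA; congr (_ * (_ * _)).
  by rewrite !mulrA (crossing_inv_crossing Q_part R) (ecol2 part R).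
Qed.

Definition tlamJ : J := mkJset (tlam_content l).

Lemma T_ecol (t0 t' t : J) : entry (T (ecol (sval t0))) t' t =
  if (t' == t) && (t == t0) then 1 else 0.
Proof.
rewrite rmorph_sum entry_sum /=; under eq_bigr do rewrite T_e mat_eE mono_entry.
case: eqP => _ /=; last by rewrite big1.
rewrite -big_mkcondr /=; case: eqP => [->|ne].
  rewrite (eq_bigl (fun k => colour k == sval t0)) => [|k /=]; last by rewrite andbb.
  exact: (sum_e_prod inj Rj (JsetP t0)).
rewrite big1 // => k /andP[/eqP kt0 /eqP kt]; case: ne; apply: val_inj.
by rewrite /= -kt -kt0.
Qed.

Lemma entry_ecolr (x : C) (t0 t' t : J) :
  entry (T (x * ecol (sval t0))) t' t = if t == t0 then entry (T x) t' t else 0.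
Proof.
rewrite rmorphM entryM (bigD1 t) //= big1 ?addr0 => [|s st]; last first.
  by rewrite T_ecol (negPf st) mulr0.
by rewrite T_ecol eqxx /=; case: eqP; rewrite ?mulr1 ?mulr0.
Qed.

Lemma embedK (z : H) : entry (T (embed z)) tlamJ tlamJ = z.
Proof.
pose G z := entry (T (embed z)) tlamJ tlamJ.
have GD u v : G (u + v) = G u + G v by rewrite /G embedD rmorphD entryD.
have GM u v : G (u * v) = G u * G v.
  (* [embed u] ends in the idempotent of [tlam l], so only the column [tlamJ] of its matrix is
     nonzero. *)
  rewrite /G embedM rmorphM entryM (bigD1 tlamJ) //= big1 ?addr0 // => s st.
  by rewrite -(embedE u) (entry_ecolr _ tlamJ) (negPf st) mul0r.
have Ga a : G (alg a) = alg a.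
  by rewrite /G embed_alg (entry_ecolr _ tlamJ) eqxx alg_homE entry_alg eqxx.
rewrite -/(G z); elim/Hgen: z => // [j x|u v Hu Hv|u v Hu Hv]; last 2 first.
- by rewrite GD Hu Hv.
- by rewrite GM Hu Hv.
elim/(@Bgen j): x => [a|u|i|b|u v Hu Hv|u v Hu Hv].
- by rewrite alg_homE Ga.
- rewrite /G embed_e /block_e rmorph_sum entry_sum /=.
  under eq_bigr do rewrite T_e mat_eE mono_entry eqxx.
  (* Expanding [1] into the [e_prod k], the factor [inj j (ej u)] keeps exactly those whose
     restriction is [u], as the sum [block_e u] does. *)
  rewrite -[RHS]mulr1 -(sum_e_prod inj Rj (tlam_content l)) mulr_sumr.
  rewrite big_mkcondr; apply: eq_bigr => k /eqP kt; rewrite kt eqxx.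
  have Hk : has_content l (colour k) by rewrite kt; exact: tlam_content.
  have [v vE] := kres_tuple j Hk; rewrite -vE tval_eqE.
  rewrite -[if _ then e_prod inj ej k else 0]mul1r; case: eqP => [<-|ne].
    rewrite -(rmorph1 (inj j)); apply: inj_prod_absorb => //.
    by rewrite -vE eNE (rel_idem (@Rj j)) eqxx mul1r.
  rewrite mul1r -(mul0r (e_prod inj ej k)) -(rmorph0 (inj j)); apply: inj_prod_absorb => //.
  by rewrite -vE eNE (rel_idem (@Rj j)) mul0r eq_sym (introF eqP ne).
- rewrite /G embed_y (entry_ecolr _ tlamJ) eqxx T_y mono_entry eqxx.
  by rewrite /y_coef tlam_shift rk_shift yNE.
- rewrite /G embed_psi (entry_ecolr _ tlamJ) eqxx T_psi mono_entry.
  rewrite (actJ_id (t := tlamJ) (tlam_shiftp b)) eqxx.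
  transitivity (psi_coef inj psij (shiftp b) (tlam l)) => //.
  rewrite /psi_coef tlam_shiftp eqxx shiftp_hi tlam_shift shiftp_lo rk_shift.
  by rewrite -(psiNE psij b).
- by rewrite rmorphD GD Hu Hv.
- by rewrite rmorphM GM Hu Hv.
Qed.

Lemma embed_image (w : C) : embed (entry (T w) tlamJ tlamJ) = E * w * E.
Proof.
have N : crossing (sval tlamJ) = E by exact: (crossing_sorted part R (tlam_nodesc l)).
have NI : crossing_inv (sval tlamJ) = E.
  by have := crossing_crossing_inv Q_part R (JsetP tlamJ); rewrite N (ecol_crossing_inv part R).
by rewrite entry_embed N NI.
Qed.

Lemma embed_corner (z : H) : E * embed z * E = embed z.
Proof. by rewrite Eembed embedE. Qed.

Lemma embed_scale a (z : H) : embed (alg a * z) = alg a * embed z.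
Proof. by rewrite embedM embed_alg -mulrA Eembed. Qed.

Lemma embed_inj : injective embed.
Proof. by move=> z z' zz; rewrite -(embedK z) -(embedK z') zz. Qed.

Lemma embed_im (z : C) : (exists x, embed x = z) <-> (exists w, z = E * w * E).
Proof.
split=> [[x <-]|[w ->]]; first by exists (embed x); rewrite embed_corner.
by exists (entry (T w) tlamJ tlamJ); exact: embed_image.
Qed.

Lemma embed_concat (k : forall j, (m j).-tuple (Kj j)) :
  embed (\prod_(j < d) inj j (ej (k j))) = e (concat k).
Proof.
have Hk : has_content l (colour (concat k)).
  by rewrite colour_concat; exact: tlam_content.
rewrite -(embed_e_prod Hk (colour_concat k)) // /e_prod inj_prodE; congr embed.
by apply: eq_bigr => j _; rewrite kres_concat eNE.
Qed.

Variables (Lam : K -> nat) (c : K -> nat -> A).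

Definition cycC (i0 : 'I_n) k : C :=
  \sum_(r < (Lam (tnth k i0)).+1) alg (c (tnth k i0) r) * (y i0 ^+ r * e k).

Definition cycB j (b0 : 'I_(m j)) (u : (m j).-tuple (Kj j)) : B j :=
  \sum_(r < (Lam (val (tnth u b0))).+1)
    alg (c (val (tnth u b0)) r) * (yj b0 ^+ r * ej u).

Lemma mono_exp r (x : J -> H) : mono id x ^+ r = mono id (fun t => x t ^+ r).
Proof.
elim: r => [|r IH]; first exact/esym/mono1.
by rewrite exprS IH mono_mul; apply: mono_eq => t; rewrite exprS; split=> //; left.
Qed.

Lemma mono_alg a : alg a = mono id (fun=> alg a) :> 'Mat[H]_J.
Proof. exact/esym/diag_alg. Qed.

Lemma entry_cyc i0 k t' t : entry (T (cycC i0 k)) t' t =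
  if (t' == t) && (colour k == sval t) then
    \sum_(r < (Lam (tnth k i0)).+1) alg (c (tnth k i0) r) *
      (y_coef inj yj i0 (sval t) ^+ r * e_prod inj ej k)
  else 0.
Proof.
rewrite rmorph_sum entry_sum /=.
transitivity (\sum_(r < (Lam (tnth k i0)).+1) if (t' == t) && (colour k == sval t) then
    alg (c (tnth k i0) r) * (y_coef inj yj i0 (sval t) ^+ r * e_prod inj ej k) else 0).
  apply: eq_bigr => r _; rewrite !rmorphM rmorphXn /= alg_homE T_e T_y mat_eE.
  rewrite mono_exp mono_mul mono_alg mono_mul mono_entry /=.
  by case: eqP => //= _; case: eqP => //= _; rewrite !mulr0.
by case: ifP => // _; rewrite big1.
Qed.

(** The first strand of [t] has rank 0 within its colour, so the first y becomes the first y of the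
    factor; [ej u] is absorbed by slot [j] of [e_prod]. *)
Lemma entry_cyc_diag (i0 : 'I_n) k t j (b0 : 'I_(m j)) (u : (m j).-tuple (Kj j)) :
  i0 = 0 :> nat -> b0 = 0 :> nat -> colour k = sval t -> tnth (sval t) i0 = j ->
  tval u = kres j k ->
  entry (T (cycC i0 k)) t t = inj j (cycB b0 u) * e_prod inj ej k.
Proof.
move=> i00 b00 kt tj uE; have {b00}b00 : b0 = 0%N :> nat := b00; rewrite entry_cyc eqxx kt eqxx /=.
have rk0 : rk j (sval t) i0 = 0%N by rewrite /rk i00 take0.
have -> : y_coef inj yj i0 (sval t) = inj j (yj b0).
  by rewrite /y_coef tj rk0 -b00 yNE.
have -> : tnth k i0 = val (tnth u b0).
  apply/esym/(kres_tnth (part := part) uE); last by rewrite kt rk0 b00.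
  by rewrite -tnth_colour kt.
rewrite /cycB rmorph_sum mulr_suml /=; apply: eq_bigr => r _.
rewrite !rmorphM rmorphXn /= alg_homE -!mulrA; congr (_ * (_ * _)).
rewrite -{1}[e_prod inj ej k]mul1r -(rmorph1 (inj j)); apply: inj_prod_absorb => //.
by rewrite -uE eNE (rel_idem (@Rj j)) eqxx mul1r.
Qed.

Lemma entry_cyc_kill (D : algOverType A) (p : {alghom H -> D}) (i0 : 'I_n) k t' t :
  i0 = 0 :> nat ->
  (forall j (b0 : 'I_(m j)) u, b0 = 0 :> nat -> p (inj j (cycB b0 u)) = 0) ->
  p (entry (T (cycC i0 k)) t' t) = 0.
Proof.
move=> i00 Hp.
have [/andP[/eqP -> /eqP kt]|ne] := boolP ((t' == t) && (colour k == sval t)); last first.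
  by rewrite entry_cyc (negPf ne) raddf0.
have Hk := colourJ kt; set j := tnth (sval t) i0; have [u uE] := kres_tuple j Hk.
have mj : (0 < m j)%N.
  by rewrite -(JsetP t); apply: leq_ltn_trans (rk_lt_count (sval t) i0).
rewrite (entry_cyc_diag (b0 := Ordinal mj) i00 erefl kt erefl uE).
by rewrite rmorphM /= Hp // mul0r.
Qed.

Variable I : C -> Prop.
Hypothesis I_cyc : forall (i0 : 'I_n) k, i0 = 0 :> nat -> I (cycC i0 k).

(** With [t] starting in colour [j], [1] is expanded into the [e_prod k] for [k] of colour [t].
    Terms with restriction other than [u] vanish; the others are diagonal entries of a cyclotomic
    element, which [entry_embed] turns into its conjugate by N_t. *)
Lemma embed_cyc j (b0 : 'I_(m j)) (u : (m j).-tuple (Kj j)) :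
  b0 = 0 :> nat -> idealgen I (embed (inj j (cycB b0 u))).
Proof.
move=> b00; have mj : (0 < m j)%N by apply: leq_ltn_trans (ltn_ord b0).
have n0 : (0 < n)%N by apply: leq_trans mj (leq_trans (leq_addl _ _) (offset_le l j)).
pose i0 := Ordinal n0; have [t tj] := content_head (i0 := i0) mj erefl.
rewrite -[inj j _]mulr1 -(sum_e_prod inj Rj (JsetP t)) mulr_sumr embed_sum.
apply: (big_ind (idealgen I)) => [||k /eqP kt]; first exact: idealgen0.
  by move=> ? ?; exact: idealgenD.
have Hk := colourJ kt; have [v vE] := kres_tuple j Hk.
have [vu|vu] := eqVneq v u.
  rewrite -vu -(entry_cyc_diag (i0 := i0) _ b00 kt tj vE) // entry_embed.
  by apply: idealgenM; apply: idealgen_mem; exact: I_cyc.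
suff -> : inj j (cycB b0 u) * e_prod inj ej k = 0 by rewrite embed0; exact: idealgen0.
rewrite -(mul0r (e_prod inj ej k)) -(rmorph0 (inj j)); apply: inj_prod_absorb => //.
rewrite -vE eNE mul0r /cycB mulr_suml big1 // => r _.
by rewrite -!mulrA (rel_idem (@Rj j)) eq_sym (negPf vu) !mulr0.
Qed.

End MatrixUnits.

(** * Bijectivity and cyclotomic quotients *)

Lemma inj_surj_bij (X Y : Type) (f : X -> Y) :
  injective f -> (forall y, exists x, f x = y) -> bijective f.
Proof.
move=> fI fS; pose g y := projT1 (cid (fS y)).
have gK y : f (g y) = y by rewrite /g; case: cid.
by exists g => // x; apply: fI; rewrite gK.
Qed.

Section AlghomConstructions.
Variable A : comNzRingType.

Lemma alghom_commute (B C : algOverType A) (f : {alghom B -> C}) x y :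
  x * y = y * x -> f x * f y = f y * f x.
Proof. by move=> xy; rewrite -rmorphM xy rmorphM. Qed.

Section Comp.
Variables (B C D : algOverType A) (g : {alghom C -> D}) (f : {alghom B -> C}).
Definition alghom_comp_fun x := g (f x).
Local Notation gf := alghom_comp_fun.
Lemma alghom_comp_zmod : zmod_morphism gf.
Proof. by move=> x y; rewrite /gf !rmorphB. Qed.
Lemma alghom_comp_monoid : monoid_morphism gf.
Proof. by split=> [|x y]; rewrite /gf ?rmorph1 ?rmorphM. Qed.
Lemma alghom_comp_alg a : gf (alg a) = alg a.
Proof. by rewrite /gf !alg_homE. Qed.
HB.instance Definition _ := GRing.isZmodMorphism.Build B D gf alghom_comp_zmod.
HB.instance Definition _ := GRing.isMonoidMorphism.Build B D gf alghom_comp_monoid.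
HB.instance Definition _ := isAlgHom.Build A B D gf alghom_comp_alg.
Definition alghom_comp : {alghom B -> D} := gf.
Lemma alghom_compE x : alghom_comp x = g (f x). Proof. by []. Qed.
End Comp.

Section MapMatrix.
Variables (B C : algOverType A) (f : {alghom B -> C}) (n : nat).
Definition mxmap (M : 'M[B]_n) : 'M[C]_n := map_mx f M.
Lemma mxmap_zmod : zmod_morphism mxmap.
Proof. by move=> M N; apply/matrixP => i j; rewrite !mxE rmorphB. Qed.
Lemma mxmap_monoid : monoid_morphism mxmap.
Proof.
split=> [|M N]; apply/matrixP => i j; rewrite !mxE; first by rewrite rmorph_nat.
by rewrite rmorph_sum; apply: eq_bigr => k _; rewrite !mxE rmorphM.
Qed.
Lemma mxmap_alg a : mxmap (alg a) = alg a.
Proof. by apply/matrixP => i j; rewrite !mxE rmorphMn /= alg_homE. Qed.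
HB.instance Definition _ := GRing.isZmodMorphism.Build 'M[B]_n 'M[C]_n mxmap mxmap_zmod.
HB.instance Definition _ := GRing.isMonoidMorphism.Build 'M[B]_n 'M[C]_n mxmap mxmap_monoid.
HB.instance Definition _ := isAlgHom.Build A 'M[B]_n 'M[C]_n mxmap mxmap_alg.
End MapMatrix.

Lemma entry_mxmap (B C : algOverType A) (f : {alghom B -> C}) (T : finType)
  (M : 'Mat[B]_T) t' t : entry (mxmap f M) t' t = f (entry M t' t).
Proof. by rewrite /entry mxE. Qed.

Section DirectProductLift.
Variables (I : Type) (C : algOverType A) (B : I -> algOverType A).
Variable g : forall i, {alghom C -> B i}.
Definition dlift_fun (x : C) : dprodalg B := fun i => g i x.
Local Notation gg := dlift_fun.
Lemma dlift_zmod : zmod_morphism gg.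
Proof. by move=> x y; apply: functional_extensionality_dep => i; exact: rmorphB. Qed.
Lemma dlift_monoid : monoid_morphism gg.
Proof.
by split=> [|x y]; apply: functional_extensionality_dep => i; [exact: rmorph1|exact: rmorphM].
Qed.
Lemma dlift_alg a : gg (alg a) = alg a.
Proof. by apply: functional_extensionality_dep => i; exact: alg_homE. Qed.
HB.instance Definition _ := GRing.isZmodMorphism.Build C (dprodalg B) gg dlift_zmod.
HB.instance Definition _ := GRing.isMonoidMorphism.Build C (dprodalg B) gg dlift_monoid.
HB.instance Definition _ := isAlgHom.Build A C (dprodalg B) gg dlift_alg.
Definition dlift : {alghom C -> dprodalg B} := gg.
Lemma dliftE x i : dlift x i = g i x. Proof. by []. Qed.
End DirectProductLift.

End AlghomConstructions.

Section TensorQuotient.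
Variables (A : comNzRingType) (d : nat) (B : 'I_d -> algOverType A).

Lemma tens_map_in (C : 'I_d -> algOverType A) (f : forall j, {alghom B j -> C j}) j (x : B j) :
  tens_map f (tensin x) = tensin (f j x).
Proof.
rewrite /tensin tens_map_pure tens_map_with.
rewrite (_ : (fun i => f i ((1 : dprodalg B) i)) = (1 : dprodalg C)) //.
by apply: functional_extensionality_dep => i; rewrite rmorph1.
Qed.

Lemma tens_map_surj (C : 'I_d -> algOverType A) (f : forall j, {alghom B j -> C j}) :
  (forall j z, exists x, f j x = z) -> forall z, exists x, tens_map f x = z.
Proof.
move=> fS; elim/tens_ind => [a|j z|u v [x <-] [x' <-]|u v [x <-] [x' <-]].
- by exists (alg a); rewrite alg_homE.
- by have [x <-] := fS j z; exists (tensin x); rewrite tens_map_in.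
- by exists (x + x'); rewrite rmorphD.
- by exists (x * x'); rewrite rmorphM.
Qed.

Lemma tens_alghom_ext (D : algOverType A) (f g : {alghom tens B -> D}) :
  (forall j (x : B j), f (tensin x) = g (tensin x)) -> f =1 g.
Proof.
move=> fg; elim/tens_ind => [a|j x|u v Hu Hv|u v Hu Hv]; rewrite ?alg_homE //.
- by rewrite [LHS]rmorphD [RHS]rmorphD /= Hu Hv.
- by rewrite [LHS]rmorphM [RHS]rmorphM /= Hu Hv.
Qed.

Variable S : forall j, B j -> Prop.
Definition tens_rels (w : tens B) := exists j (x : B j), S x /\ w = tensin x.
Local Notation D := (algquot tens_rels : algOverType A).

Definition factor_in j : {alghom B j -> D} :=
  alghom_comp (aqproj tens_rels) (@tensin A _ B j).

Lemma factor_in_S j (x : B j) : S x -> factor_in j x = 0.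
Proof.
move=> Sx; rewrite alghom_compE; apply/aqproj_eq0/idealgen_mem.
by exists j, x.
Qed.

Definition quot_in j : {alghom algquot (@S j) -> D} := aqlift (@factor_in_S j).

Lemma quot_inE j (x : B j) : quot_in j (aqproj (@S j) x) = aqproj tens_rels (tensin x).
Proof. exact: aqliftE. Qed.

Lemma quot_inC i j (x : algquot (@S i)) (z : algquot (@S j)) : i != j ->
  quot_in i x * quot_in j z = quot_in j z * quot_in i x.
Proof.
move=> ij; have [[x' ->] [z' ->]] := (aqproj_surj x, aqproj_surj z).
rewrite !quot_inE; exact: (alghom_commute (aqproj tens_rels) (tensinC x' z' ij)).
Qed.

(* The projections of the factors, pushed to the quotient by [tens_rels], define
   a left inverse of [tens_map] modulo [tens_rels]. *)
Lemma ker_tens_map (w : tens B) :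
  tens_map (fun j => aqproj (@S j) : {alghom B j -> algquot (@S j)}) w = 0 ->
  idealgen tens_rels w.
Proof.
move=> w0; apply/aqproj_eq0.
pose p := tens_map (fun j => aqproj (@S j) : {alghom B j -> algquot (@S j)}).
have /(_ w) <- : alghom_comp (tens_lift quot_inC) p =1 aqproj tens_rels.
  apply: tens_alghom_ext => j x.
  by rewrite alghom_compE /p tens_map_in tens_lift_in quot_inE.
by rewrite alghom_compE w0 rmorph0.
Qed.

End TensorQuotient.

(** * Recovering elements and ideals of H_n from matrix entries *)

Section Reconstruction.
Variables (A : comNzRingType) (d n : nat) (K : finType) (part : K -> 'I_d).
Variable (Q : K -> K -> {poly {poly A}}).
Hypothesis Q_part : forall k k' : K, part k != part k' -> Q k k' = 1.
Variables (C : algOverType A) (e : n.-tuple K -> C) (y : 'I_n -> C).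
Variables (psi : 'I_n.-1 -> C) (R : qHrels Q e y psi).
Hypothesis Cgen : qH_generated e y psi.
Local Notation ecol := (ecol part e).
Local Notation crossing := (crossing part e psi).
Local Notation crossing_inv := (crossing_inv part e psi).
Variables (H : dcomp d n -> algOverType A).
Variable T : forall l, {alghom C -> 'Mat[H l]_(Jset l)}.
Variable f : forall l, H l -> C.
Hypothesis fT : forall l x (t' t : Jset l),
  f (entry (T l x) t' t) = crossing (sval t') * x * crossing_inv (sval t).
Hypothesis f_inj : forall l, injective (@f l).
Hypothesis f_corner : forall l x, ecol (tlam l) * @f l x * ecol (tlam l) = f x.

Lemma content_exists (t : n.-tuple 'I_d) : exists l : dcomp d n, has_content l t.
Proof.
have le j : (count_mem j t < n.+1)%N by rewrite ltnS -[leqRHS](size_tuple t) count_size.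
pose c := [ffun j => Ordinal (le j)].
have sc : (\sum_j c j)%N == n.
  apply/eqP; under eq_bigr do rewrite ffunE /=.
  rewrite -[RHS](size_tuple t) -sum1_size [RHS](partition_big id xpredT) //=.
  by apply: eq_bigr => j _; rewrite -sum1_count; apply: eq_bigl => x; rewrite eq_sym.
by exists (exist _ c sc) => j; rewrite /part_of /= ffunE.
Qed.

Lemma content_inj (l l' : dcomp d n) t : has_content l t -> has_content l' t -> l = l'.
Proof.
move=> Hl Hl'; apply: val_inj; apply/ffunP => j; apply: val_inj.
exact: etrans (esym (Hl j)) (Hl' j).
Qed.

(** [x] is the sum of its pieces [ecol t' * x * ecol t], and a nonzero piece equals N_t'^-1 f(entry)
    N_t. With no ideal generators this gives injectivity of [T], with the cyclotomic ones that of
    the quotient map. *)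
Lemma recon_ideal (I : C -> Prop) (x : C) :
  (forall l (t' t : Jset l), idealgen I (f (entry (T l x) t' t))) -> idealgen I x.
Proof.
move=> Hx; have -> : x = \sum_(t' : n.-tuple 'I_d) \sum_(t : n.-tuple 'I_d) ecol t' * x * ecol t.
  rewrite -[LHS]mul1r -[LHS]mulr1 -(sum_ecol part R) big_distrl big_distrl /=.
  by apply: eq_bigr => t' _; rewrite big_distrr.
have ID := @idealgenD _ _ I; have I0 := @idealgen0 _ _ I.
apply: (big_ind (idealgen I)) => // t' _; apply: (big_ind (idealgen I)) => // t _.
have [tt|tt] := boolP (perm_eq t' t); last by rewrite (ecol_block part R Cgen x tt).
have [l Hl] := content_exists t.
have Hl' : has_content l t' by move=> j; rewrite (elimT seq.permP tt); exact: Hl.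
rewrite -!(crossing_inv_crossing Q_part R).
have -> : crossing_inv t' * crossing t' * x * (crossing_inv t * crossing t) =
    crossing_inv t' * f (entry (T l x) (mkJset Hl') (mkJset Hl)) * crossing t.
  by rewrite fT !mulrA.
exact: idealgenM.
Qed.

Lemma idealgen_empty (x : C) : idealgen (fun _ : C => False) x -> x = 0.
Proof.
elim=> {x} // [x x' _ -> _ ->|u x v _ ->]; first exact: addr0.
by rewrite mulr0 mul0r.
Qed.

Lemma T_injective x x' : (forall l, T l x = T l x') -> x = x'.
Proof.
move=> Hx; apply/eqP; rewrite -subr_eq0; apply/eqP/idealgen_empty/recon_ideal => l t' t.
rewrite rmorphB /= Hx subrr.
have -> : entry (0 : 'Mat[H l]_(Jset l)) t' t = entry (T l 0) t' t by rewrite raddf0.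
by rewrite fT mulr0 mul0r; exact: idealgen0.
Qed.

Lemma T_surjective (M : forall l, 'Mat[H l]_(Jset l)) : exists x, forall l, T l x = M l.
Proof.
(* The identity [fT] solved for [x]; different pairs do not interact, because N_t N_s^-1 is zero for
   different t and s. *)
exists (\sum_l \sum_(t' : Jset l) \sum_(t : Jset l)
  crossing_inv (sval t') * f (entry (M l) t' t) * crossing (sval t)) => l.
apply: entry_inj => s' s; apply: f_inj; rewrite fT.
pose F l' (t' t : Jset l') : C := crossing_inv (sval t') * f (entry (M l') t' t) * crossing (sval t).
have F0 l' (t' t : Jset l') : (sval t' != sval s') || (sval t != sval s) ->
    crossing (sval s') * F l' t' t * crossing_inv (sval s) = 0.
  rewrite /F; case/orP => ne.
    by rewrite !mulrA (crossing_crossing_inv_neq part R) 1?eq_sym // !mul0r.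
  by rewrite -!mulrA (crossing_crossing_inv_neq part R) // !mulr0.
have -> : crossing (sval s') * (\sum_l' \sum_t' \sum_t F l' t' t) * crossing_inv (sval s) =
    \sum_l' \sum_t' \sum_t crossing (sval s') * F l' t' t * crossing_inv (sval s).
  rewrite mulr_sumr mulr_suml; apply: eq_bigr => l' _.
  rewrite mulr_sumr mulr_suml; apply: eq_bigr => t' _.
  by rewrite mulr_sumr mulr_suml; apply: eq_bigr.
rewrite (bigD1 l) //= [X in _ + X]big1 ?addr0 => [|l' ll']; last first.
  rewrite big1 // => t' _; rewrite big1 // => t _; apply: F0; apply/orP; left.
  apply: contra_neq ll' => E; apply: (content_inj (JsetP t')).
  exact: (eq_ind_r (has_content l) (JsetP s') E).
rewrite (bigD1 s') //= [X in _ + X]big1 ?addr0 => [|t' ne]; last first.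
  by rewrite big1 // => t _; apply: F0; rewrite (ne : sval t' != sval s').
rewrite (bigD1 s) //= [X in _ + X]big1 ?addr0 => [|t ne]; last first.
  by apply: F0; rewrite (ne : sval t != sval s) orbT.
rewrite /F !mulrA (crossing_crossing_inv Q_part R (JsetP s')) -mulrA (crossing_crossing_inv Q_part R (JsetP s)).
exact: f_corner.
Qed.

Lemma dlift_bij : bijective (dlift T).
Proof.
apply: inj_surj_bij => [x x' E|M].
  by apply: T_injective => l; rewrite -!(dliftE T) E.
have [x Hx] := T_surjective M; exists x.
by apply: functional_extensionality_dep => l; rewrite dliftE Hx.
Qed.

Variables (Hc : dcomp d n -> algOverType A) (p : forall l, {alghom H l -> Hc l}).
Hypothesis p_surj : forall l z, exists w, p l w = z.
Variable I : C -> Prop.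
Hypothesis I_kill : forall l x (t' t : Jset l), I x -> p l (entry (T l x) t' t) = 0.
Hypothesis ker_p : forall l w, p l w = 0 -> idealgen I (f w).

Definition mxproj : {alghom C -> dprodalg (fun l => 'Mat[Hc l]_(Jset l) : algOverType A)} :=
  dlift (fun l => alghom_comp (@mxmap A (H l) (Hc l) (p l) _ :
    {alghom 'Mat[H l]_(Jset l) -> 'Mat[Hc l]_(Jset l)}) (T l)).

Lemma mxprojE x l (t' t : Jset l) : entry (mxproj x l) t' t = p l (entry (T l x) t' t).
Proof. exact: entry_mxmap. Qed.

Lemma mxproj_I x : I x -> mxproj x = 0.
Proof.
move=> Ix; apply: functional_extensionality_dep => l; apply: entry_inj => t' t.
by rewrite mxprojE I_kill // /entry [RHS]mxE.
Qed.

(** If the projected matrix is zero, [ker_p] puts every entry into the ideal after applying [f], and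
    [recon_ideal] concludes. For surjectivity the entries are lifted one by one through [p]. *)
Lemma quotient_iso :
  exists Phi : {alghom algquot I -> dprodalg (fun l => 'Mat[Hc l]_(Jset l) : algOverType A)},
    bijective Phi /\
    forall x l (t' t : Jset l), entry (Phi (aqproj I x) l) t' t = p l (entry (T l x) t' t).
Proof.
have [Phi PhiE] : exists Phi : {alghom algquot I ->
      dprodalg (fun l => 'Mat[Hc l]_(Jset l) : algOverType A)},
    forall x, Phi (aqproj I x) = mxproj x.
  by exists (aqlift mxproj_I) => x; exact: aqliftE.
exists Phi; split; last by move=> x l t' t; rewrite PhiE mxprojE.
apply: inj_surj_bij => [z z' E|N].
  have [x zx] := aqproj_surj (z - z'); apply/eqP; rewrite -subr_eq0 zx.
  apply/eqP/aqproj_eq0/recon_ideal => l t' t; apply: ker_p.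
  rewrite -mxprojE -PhiE -zx rmorphB /= E subrr.
  by rewrite /entry [LHS]mxE.
have [M MN] : exists M : forall l, 'Mat[H l]_(Jset l), forall l, mxmap (p l) (M l) = N l.
  exists (fun l => \matrix_(i, j) projT1 (cid (p_surj (N l i j)))) => l.
  by apply/matrixP => i j; rewrite !mxE; case: cid.
have [x Hx] := T_surjective M; exists (aqproj I x); rewrite PhiE.
by apply: functional_extensionality_dep => l; rewrite -MN -Hx.
Qed.

End Reconstruction.

Lemma ecol_e_t (A : comNzRingType) (d n : nat) (K : finType) (part : K -> 'I_d)
    (Q : K -> K -> {poly {poly A}}) (t : n.-tuple 'I_d) :
  e_t part Q t = ecol part (@qH_e A K Q n) t.
Proof.
apply: eq_bigl => k; apply/forallP/eqP => [H|<- a]; last by rewrite tnth_colour.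
by apply: eq_from_tnth => a; rewrite tnth_colour; exact/eqP.
Qed.

(** * Reduced words of pi_t and of its inverse *)

Section MinimalWords.
Variables (A : comNzRingType) (d n : nat) (K : finType) (part : K -> 'I_d).
Variable (Q : K -> K -> {poly {poly A}}).
Hypothesis Q_part : forall k k' : K, part k != part k' -> Q k k' = 1.
Variables (C : algOverType A) (e : n.-tuple K -> C) (y : 'I_n -> C).
Variables (psi : 'I_n.-1 -> C) (R : qHrels Q e y psi).
Variable red : 'S_n -> seq 'I_n.-1.
Hypothesis redP : forall w : 'S_n, reduced_expr w (red w).
Variables (l : dcomp d n) (t : Jset l).

Lemma pi_tP : act (pi_t red t) (val t) = tlam l /\
  forall w, act w (val t) = tlam l -> (size (red (pi_t red t)) <= size (red w))%N.
Proof.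
have [s sE] := perm_act_exists (content_perm (JsetP t) (tlam_content l)).
(* The default [1%g] need not send [t] to [tlam l], so [extremum] is opened and its default branch
   is refuted by a minimiser started from [s]. *)
rewrite /pi_t /arg_min /extremum; case: pickP => [w /andP[/eqP wE /forallP Hw]|no] /=.
  by split=> // w' w'E; have := implyP (Hw w'); apply; exact/eqP.
pose w0 := arg_min s (fun w => act w (val t) == tlam l) (fun w => size (red w)).
have [w /eqP wE Hw] : extremum_spec leq (fun w => act w (val t) == tlam l)
  (fun w => size (red w)) w0 by apply: arg_minnP; exact/eqP.
have /negP[/=] := no w; rewrite wE eqxx /=; apply/forallP => w'.
by apply/implyP; exact: Hw.
Qed.

Lemma word_perm_rev (w : seq 'I_n.-1) : word_perm (rev w) = (word_perm w)^-1%g.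
Proof.
elim: w => [|a w IH] /=; first by rewrite invg1.
rewrite rev_cons invMg spermV -IH {IH}; elim: (rev w) => [|b v IH] /=.
  by rewrite mul1g mulg1.
by rewrite IH mulgA.
Qed.

(** A word with the same effect on [t] spells a permutation competing with [pi_t], hence is not
    shorter than its reduced word; this is the premise of [short_cpath]. *)
Lemma psiw_pi : psiw psi (red (pi_t red t)) * ecol part e (val t) = crossing part e psi (val t).
Proof.
have [pE pmin] := pi_tP; have [rE _] := redP (pi_t red t).
have wE : wact (red (pi_t red t)) (val t) = tlam l by rewrite wact_perm rE.
apply: (cpath_crossing Q_part R); last by rewrite wE; exact: tlam_nodesc.
apply: short_cpath => w'; rewrite wE wact_perm => /pmin.
by move/leq_trans; apply; have [_] := redP (word_perm w'); apply.
Qed.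

(** Reversal turns words for [pi_t] into words for its inverse, and any word from [tlam l] to [t]
    into one back, so the minimality of [pi_t] passes to the inverse. *)
Lemma psiw_piV : ecol part e (val t) * psiw psi (red (pi_t red t)^-1%g) =
  crossing_inv part e psi (val t).
Proof.
have [pE pmin] := pi_tP; have [rE rmin] := redP (pi_t red t)^-1%g.
have wE : wact (red (pi_t red t)^-1%g) (tlam l) = val t.
  by rewrite wact_perm rE -pE -tupactM mulgV tupact1.
rewrite -[in LHS]wE -(psiw_ecol part R); apply: (cpath_crossing_inv Q_part R (JsetP t)) => //.
apply: short_cpath => w'; rewrite wE => w'E.
have [r2E _] := redP (pi_t red t).
apply: leq_trans (rmin (rev (red (pi_t red t))) _) _; first by rewrite word_perm_rev r2E.
rewrite size_rev -(size_rev w'); apply: leq_trans (pmin (word_perm (rev w')) _) _.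
  by rewrite -wact_perm -w'E wact_revK.
by have [_] := redP (word_perm (rev w')); apply.
Qed.

End MinimalWords.

Lemma crossing_red (A : comNzRingType) (d n : nat) (K : finType) (part : K -> 'I_d)
    (Q : K -> K -> {poly {poly A}})
    (Q_part : forall k k' : K, part k != part k' -> Q k k' = 1)
    (C : algOverType A) (e : n.-tuple K -> C) (y : 'I_n -> C) (psi : 'I_n.-1 -> C)
    (R : qHrels Q e y psi) (red : 'S_n -> seq 'I_n.-1)
    (redP : forall w : 'S_n, reduced_expr w (red w))
    (l : dcomp d n) (x : C) (t' t : Jset l) :
  crossing part e psi (sval t') * x * crossing_inv part e psi (sval t) =
  psiw psi (red (pi_t red t')) * (ecol part e (val t') * x * ecol part e (val t)) *
  psiw psi (red (pi_t red t)^-1%g).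
Proof.
by rewrite -(psiw_pi Q_part R redP t') -(psiw_piV Q_part R redP t) !mulrA.
Qed.

(** * Specialisation to H_n(Q), its factors and their cyclotomic quotients *)

Section QuiverHeckeSplitting.
Variables (A : comNzRingType) (d n : nat) (K : finType) (part : K -> 'I_d).
Variable (Q : K -> K -> {poly {poly A}}).
Hypothesis Q_part : forall k k' : K, part k != part k' -> Q k k' = 1.

Local Notation R := (@qH_rels A K Q n).
Local Notation B l := (Hfactor part Q l).

Definition factor_e (l : dcomp d n) j : (part_of l j).-tuple (Kj part j) -> B l j :=
  @qH_e A (Kj part j) (@Qj A d K part Q j) (part_of l j).
Definition factor_y (l : dcomp d n) j : 'I_(part_of l j) -> B l j :=
  @qH_y A (Kj part j) (@Qj A d K part Q j) (part_of l j).
Definition factor_psi (l : dcomp d n) j : 'I_(part_of l j).-1 -> B l j :=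
  @qH_psi A (Kj part j) (@Qj A d K part Q j) (part_of l j).
Definition factor_incl (l : dcomp d n) j : {alghom B l j -> Hlam part Q l} :=
  @tensin A _ (B l) j.

Lemma factor_rels l j : qHrels (@Qj A d K part Q j) (@factor_e l j) (@factor_y l j) (@factor_psi l j).
Proof. exact: qH_rels. Qed.

Lemma factor_generated l j : qH_generated (@factor_e l j) (@factor_y l j) (@factor_psi l j).
Proof. exact: qH_ind. Qed.

Lemma qH_generators : qH_generated (@qH_e A K Q n) (@qH_y A K Q n) (@qH_psi A K Q n).
Proof. exact: qH_ind. Qed.

Lemma factor_inclC l i j (x : B l i) (z : B l j) : i != j ->
  factor_incl l i x * factor_incl l j z = factor_incl l j z * factor_incl l i x.
Proof. exact: tensinC. Qed.

Lemma factor_incl_gen l (P : Hlam part Q l -> Prop) :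
  (forall a, P (alg a)) -> (forall j (x : B l j), P (factor_incl l j x)) ->
  (forall u v, P u -> P v -> P (u + v)) ->
  (forall u v, P u -> P v -> P (u * v)) -> forall z, P z.
Proof. exact: tens_ind. Qed.

Definition Psi_mat l : {alghom qH Q n -> 'Mat[Hlam part Q l]_(Jset l)} :=
  qH_lift (mat_rels (@factor_inclC l) Q_part (@factor_rels l)).

Lemma Psi_mat_e l k : Psi_mat l (qH_e Q k) = mat_e (@factor_incl l) (@factor_e l) k.
Proof. exact: qH_lift_e. Qed.
Lemma Psi_mat_y l i : Psi_mat l (qH_y Q i) = mat_y (@factor_incl l) (@factor_y l) i.
Proof. exact: qH_lift_y. Qed.
Lemma Psi_mat_psi l a : Psi_mat l (qH_psi Q a) = mat_psi (@factor_incl l) (@factor_psi l) a.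
Proof. exact: qH_lift_psi. Qed.

Definition factor_corner l j : {alghom B l j -> corner (ecol_tlam_idem part R l)} :=
  qH_lift (corner_rels part R l j).

Lemma factor_corner_e l j u : factor_corner l j (@factor_e l j u) = cut_e R u.
Proof. exact: qH_lift_e. Qed.
Lemma factor_corner_y l j i : factor_corner l j (@factor_y l j i) = cut_y part R i.
Proof. exact: qH_lift_y. Qed.
Lemma factor_corner_psi l j b : factor_corner l j (@factor_psi l j b) = cut_psi part R b.
Proof. exact: qH_lift_psi. Qed.

Definition Hlam_corner l : {alghom Hlam part Q l -> corner (ecol_tlam_idem part R l)} :=
  tens_lift (corner_factorC (@factor_generated l) (@factor_corner_e l) (@factor_corner_y l) (@factor_corner_psi l)).

Lemma Hlam_corner_in l j x : Hlam_corner l (factor_incl l j x) = factor_corner l j x.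
Proof. exact: tens_lift_in. Qed.
Lemma Hlam_corner_e l j u : Hlam_corner l (factor_incl l j (factor_e u)) = cut_e R u.
Proof. by rewrite Hlam_corner_in factor_corner_e. Qed.
Lemma Hlam_corner_y l j i : Hlam_corner l (factor_incl l j (factor_y i)) = cut_y part R i.
Proof. by rewrite Hlam_corner_in factor_corner_y. Qed.
Lemma Hlam_corner_psi l j b : Hlam_corner l (factor_incl l j (factor_psi b)) = cut_psi part R b.
Proof. by rewrite Hlam_corner_in factor_corner_psi. Qed.

Definition Hlam_embed l : Hlam part Q l -> qH Q n := embed (Hlam_corner l).

Lemma Hlam_embed_inj l : injective (@Hlam_embed l).
Proof.
exact: (embed_inj (@factor_generated l) (@factor_rels l) (@factor_inclC l) (@factor_incl_gen l) (Psi_mat_e l)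
  (Psi_mat_y l) (Psi_mat_psi l) (@Hlam_corner_e l) (@Hlam_corner_y l) (@Hlam_corner_psi l)).
Qed.

Lemma Hlam_embed_Psi_mat l x (t' t : Jset l) : Hlam_embed (entry (Psi_mat l x) t' t) =
  crossing part (@qH_e A K Q n) (@qH_psi A K Q n) (sval t') * x *
  crossing_inv part (@qH_e A K Q n) (@qH_psi A K Q n) (sval t).
Proof.
exact: (entry_embed Q_part qH_generators (Psi_mat_e l) (Psi_mat_y l) (Psi_mat_psi l)
  (@Hlam_corner_e l) (@Hlam_corner_y l) (@Hlam_corner_psi l)).
Qed.

Lemma Hlam_embed_corner l z : ecol part (@qH_e A K Q n) (tlam l) * @Hlam_embed l z *
  ecol part (@qH_e A K Q n) (tlam l) = Hlam_embed z.
Proof. exact: embed_corner. Qed.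

Lemma Hlam_embed_corner_iso l : corner_iso (@Hlam_embed l).
Proof.
split; rewrite ?ecol_e_t.
- exact: embedD.
- exact: embed_scale.
- exact: embedM.
- exact: embed1.
- exact: Hlam_embed_inj.
- exact: (embed_im Q_part qH_generators (Psi_mat_e l) (Psi_mat_y l) (Psi_mat_psi l)
    (@Hlam_corner_e l) (@Hlam_corner_y l) (@Hlam_corner_psi l)).
- exact: (embed_y (@Hlam_corner_y l)).
- exact: (embed_psi (@Hlam_corner_psi l)).
- by move=> k; rewrite pure_prod; exact: (embed_concat (@Hlam_corner_e l)).
Qed.

Lemma Hlam_embed_Psi_entry (red : 'S_n -> seq 'I_n.-1)
    (redP : forall w : 'S_n, reduced_expr w (red w)) x l (t' t : Jset l) :
  Hlam_embed (entry (Psi_mat l x) t' t) = Psi_entry part red t' t x.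
Proof.
apply: etrans (Hlam_embed_Psi_mat x t' t) _; apply: etrans (crossing_red Q_part R redP x t' t) _.
by rewrite /Psi_entry !ecol_e_t.
Qed.

Variables (Lam : K -> nat) (c : K -> nat -> A).

Lemma Hlam_proj_surj (l : dcomp d n) z : exists w, Hlam_proj part Q Lam c l w = z.
Proof. by apply: tens_map_surj => j x; have [w ->] := aqproj_surj x; exists w. Qed.

Lemma cyc_eltE (i0 : 'I_n) k : i0 = 0 :> nat ->
  cyc_elt Lam c (cycC (@qH_e A K Q n) (@qH_y A K Q n) Lam c i0 k).
Proof. exact: CycElt. Qed.

Lemma Hlam_proj_cyc l x (t' t : Jset l) :
  @cyc_elt A K Q n Lam c x -> Hlam_proj part Q Lam c l (entry (Psi_mat l x) t' t) = 0.
Proof.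
case=> i0 k i00.
apply: (entry_cyc_kill (@factor_rels l) (@factor_inclC l) (Psi_mat_e l) (Psi_mat_y l) (Lam := Lam) (c := c)
  (p := Hlam_proj part Q Lam c l) k t' t i00) => j b0 u b00.
apply: etrans (tens_map_in _ _) _; apply: etrans (raddf0 (@tensin A _ (Hfactor_cyc part Q Lam c l) j)).
congr tensin; apply/aqproj_eq0/idealgen_mem; exact: CycElt.
Qed.

(** Together with [Hlam_proj_cyc] this matches the two ideals: [ker_tens_map] reduces the kernel to
    the cyclotomic elements of single factors, which [embed_cyc] handles. *)
Lemma ker_Hlam_proj l w : Hlam_proj part Q Lam c l w = 0 ->
  idealgen (@cyc_elt A K Q n Lam c) (Hlam_embed w).
Proof.
move=> /ker_tens_map; elim=> {w} [w|||].
- move=> [j [x [[b0 u b00] ->]]].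
  exact: (embed_cyc Q_part qH_generators (@factor_rels l) (@factor_inclC l) (Psi_mat_e l) (Psi_mat_y l)
    (Psi_mat_psi l) (@Hlam_corner_e l) (@Hlam_corner_y l) (@Hlam_corner_psi l) cyc_eltE u b00).
- by rewrite /Hlam_embed embed0; exact: idealgen0.
- by move=> w w' _ Iw _ Iw'; rewrite /Hlam_embed embedD; exact: idealgenD.
- by move=> u w v _ Iw; rewrite /Hlam_embed !embedM; exact: idealgenM.
Qed.

End QuiverHeckeSplitting.

Theorem theorem6p29 (A : comNzRingType) (d n : nat)
    (d_gt0 : (0 < d)%N) (n_gt0 : (0 < n)%N)
    (K : finType) (part : K -> 'I_d) (Q : K -> K -> {poly {poly A}})
    (Q_sym : forall k k' : K, Q k k' = swapXY (Q k' k))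
    (Q_diag : forall k : K, Q k k = 0)
    (Q_part : forall k k' : K, part k != part k' -> Q k k' = 1)
    (Lam : K -> nat) (c : K -> nat -> A)
    (c_monic : forall k : K, c k (Lam k) = 1)
    (red : 'S_n -> seq 'I_n.-1)
    (redP : forall w : 'S_n, reduced_expr w (red w)) :
  (forall l : dcomp d n, #|Jset l| = multinom l) /\
  exists f : forall l : dcomp d n, Hlam part Q l -> qH Q n,
    (forall l : dcomp d n, corner_iso (f l)) /\
    exists Psi : {alghom qH Q n -> sum_mat (@Hlam A d n K part Q)},
      [/\ bijective Psi,
          forall (x : qH Q n) (l : dcomp d n) (t' t : Jset l),
            f l (entry (Psi x l) t' t) = Psi_entry part red t' t x
        & exists Phi : {alghom qHcyc Q n Lam c ->
                               sum_mat (@Hlam_cyc A d n K part Q Lam c)},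
            bijective Phi /\
            forall (x : qH Q n) (l : dcomp d n) (t' t : Jset l),
              entry (Phi (qHcyc_proj Q n Lam c x) l) t' t =
              Hlam_proj part Q Lam c l (entry (Psi x l) t' t)].
Proof.
split; first exact: card_Jset.
exists (@Hlam_embed A d n K part Q); split; first exact: Hlam_embed_corner_iso.
exists (dlift (Psi_mat Q_part)); split.
- exact: (dlift_bij Q_part (qH_rels Q n) (@qH_generators A n K Q) (Hlam_embed_Psi_mat Q_part) (Hlam_embed_inj Q_part)
    (@Hlam_embed_corner A d n K part Q)).
- by move=> x l t' t; exact: (Hlam_embed_Psi_entry Q_part redP).
- have [Phi [Phi_bij PhiE]] := (quotient_iso Q_part (qH_rels Q n) (@qH_generators A n K Q) (Hlam_embed_Psi_mat Q_part)
    (Hlam_embed_inj Q_part) (@Hlam_embed_corner A d n K part Q) (@Hlam_proj_surj A d n K part Q Lam c)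
    (Hlam_proj_cyc Q_part (Lam := Lam) (c := c)) (ker_Hlam_proj Q_part (Lam := Lam) (c := c))).
  exists Phi; split; first exact: Phi_bij.
  exact: PhiE.
Qed.
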